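(* Let $(M,\tau,\ell,\mathfrak m)$ be a metric measure spacetime, $f:M\to\bar{\mathbb R}$ causal and $\varphi:\mathbb R\to\mathbb R$ non-decreasing. Then $\varphi\circ f$ is causal and $$|\mathrm d(\varphi\circ f)|=(\varphi'\circ f)\,|\mathrm df|\qquad\mathfrak m\text{-a.e. on }\mathrm{Vis}(M)\cap\big(\{|\mathrm df|>0\}\cup\{\varphi'\circ f<+\infty\}\big),$$ where $\varphi'$ is (a representative of) the density of the absolutely continuous part of the distributional derivative of $\varphi$, and it is intended that $\varphi(\pm\infty)=\pm\infty$ and $\varphi'(\pm\infty)=+\infty$.
   Context: Conventions in $\bar{\mathbb R}=[-\infty,+\infty]$: $+\infty-(+\infty)=+\infty$, $-\infty-(-\infty)=+\infty$, $\pm\infty+z=\pm\infty$ for every $z\in\bar{\mathbb R}$, $0\cdot(\pm\infty)=0$. A time separation on a set $M$ is a map $\ell:M\times M\to\{-\infty\}\cup[0,+\infty]$ with $\ell(x,x)=0$ and $\min\{\ell(x,y)+\ell(y,z),\ell(y,z)+\ell(x,y)\}\le\ell(x,z)$; write $x\le y$ if $\ell(x,y)\ge0$. A metric measure spacetime $(M,\tau,\ell,\mathfrak m)$: $\tau$ is a Polish topology, $\ell$ a time separation with $\le$ a partial order and $\{\ell\ge0\}$ closed in $M^2$, $\mathfrak m$ a non-zero non-negative Radon measure. $\gamma:[0,1]\to M$ is causal if $s\le t$ implies $\gamma_s\le\gamma_t$. Its causal speed $|\dot\gamma_t|\in[0,+\infty]$ is the density of the absolutely continuous part (w.r.t. Lebesgue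 measure) of the largest Borel measure $\nu$ on $[0,1]$ with $\nu((a,b))\le\ell(\gamma_a,\gamma_b)$ for all $0\le a<b\le1$; for a.e. $t$ it equals $\lim_{h\downarrow0}\ell(\gamma_t,\gamma_{t+h})/h$. $\mathrm{LCC}([0,1];M)$ is the set of left-continuous causal curves with the topology of the distance $\mathsf D(\gamma,\eta)=\mathsf d(\gamma_0,\eta_0)+\int_0^1\mathsf d(\gamma_t,\eta_t)\,\mathrm dt$, $\mathsf d$ a bounded distance inducing $\tau$. $\mathsf e_t(\gamma):=\gamma_t$. A causal function is an $\mathfrak m$-measurable $f:M\to\bar{\mathbb R}$ such that $x\le y$ implies $f(x)\le f(y)$. A test plan is a Borel probability measure $\boldsymbol\pi$ on $\mathrm{LCC}([0,1];M)$ such that for some $C>0$, $(\mathsf e_t)_*\boldsymbol\pi\le C\mathfrak m$ for all $t\in[0,1]$. A Borel $G:M\to[0,+\infty]$ is a weak subslope of $f$ if $\int[f(\gamma_1)-f(\gamma_0)]\,\mathrm d\boldsymbol\pi\ge\iint_0^1G(\gamma_t)|\dot\gamma_t|\,\mathrm dt\,\mathrm d\boldsymbol\pi$ for every test plan $\boldsymbol\pi$; $|\mathrm df|$ denotes the $\mathfrak m$-a.e. largest weak subslope (it exists and is $\mathfrak m$-a.e. unique). For a test plan $\boldsymbol\pi$ let $\rho_{\boldsymbol\pi}$ be the $\mathfrak m$-density of the push-forward of the measure $|\dot\gamma_t|\,\mathrm d\boldsymbol\pi(\gamma)\,\mathrm dt$ on $\mathrm{LCC}([0,1];M)\times[0,1]$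 under $(\gamma,t)\mapsto\gamma_t$. $\mathrm{Vis}(M)$ is the $\mathfrak m$-essential union of the sets $\{\rho_{\boldsymbol\pi}>0\}$ over all test plans $\boldsymbol\pi$ (the smallest Borel set, up to $\mathfrak m$-null sets, containing each of them up to $\mathfrak m$-null sets).
   Formalization: The representative of φ' is required to be +∞ on a Lebesgue-null set carrying the singular part of the distributional derivative of φ; for an arbitrary representative the claim fails (f an increasing singular homeomorphism of the Minkowski line, φ its inverse, φ'=0). *)

(* Defs.v *)
From HB Require Import structures.
From mathcomp Require Import all_boot all_order all_algebra.
From mathcomp Require Import all_classical all_reals all_analysis.
From mathcomp Require Import measurable_realfun.
Import Order.TTheory GRing.Theory Num.Theory.
Import numFieldNormedType.Exports.

Set Implicit Arguments.
Unset Strict Implicit.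
Unset Printing Implicit Defensive.

Local Open Scope classical_set_scope.
Local Open Scope ring_scope.

(* ** Arithmetic of [-oo, +oo]

   The library sets +oo + -oo = -oo + +oo = -oo and +oo - +oo = -oo, which is
   not the convention wanted here.  The library product already satisfies
   0 * +oo = 0 * -oo = 0. *)

(* Addition in which an infinite left operand absorbs: it is not commutative. *)
Definition addx {R : realType} (x y : \bar R) : \bar R :=
  if x is r%:E then (x + y)%E else x.

Definition subx {R : realType} (x y : \bar R) : \bar R :=
  match x, y with
  | +oo%E, +oo%E => +oo%E
  | -oo%E, -oo%E => +oo%E
  | _, _ => (x - y)%E
  end.

(* ** Polish spaces, Borel sets, Radon measures *)

Definition borel (M : ptopologicalType) := g_sigma_algebraType (@open M).

Definition is_distance {R : realType} {M : Type} (d : M -> M -> R) : Prop :=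
  [/\ forall x y, 0 <= d x y,
      forall x y, d x y = 0 <-> x = y,
      forall x y, d x y = d y x &
      forall x y z, d x z <= d x y + d y z].

Definition induces_topology {R : realType} {M : topologicalType}
    (d : M -> M -> R) : Prop :=
  forall (x : M) (A : set M),
    nbhs x A <-> exists2 e : R, 0 < e & [set y | d x y < e] `<=` A.

Definition complete_distance {R : realType} {M : topologicalType}
    (d : M -> M -> R) : Prop :=
  forall u : nat -> M,
    (forall e : R, 0 < e -> exists N : nat, forall m n : nat,
       (N <= m)%N -> (N <= n)%N -> d (u m) (u n) < e) ->
    exists x : M, u @ \oo --> x.

Definition polish (R : realType) (M : topologicalType) : Prop :=
  (exists d : M -> M -> R,
     [/\ is_distance d, induces_topology d & complete_distance d]) /\
  (exists2 A : set M, countable A & dense A).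

Definition bounded_distance {R : realType} {M : topologicalType}
    (d : M -> M -> R) : Prop :=
  [/\ is_distance d, induces_topology d &
      exists C : R, forall x y, d x y <= C].

Definition radon {R : realType} {M : ptopologicalType}
    (m : {measure set (borel M) -> \bar R}) : Prop :=
  (forall x : M, exists U : set M, [/\ open U, U x & (m U < +oo)%E]) /\
  (forall A : set (borel M), measurable A ->
     m A = ereal_sup [set m K | K in [set K : set M | compact K /\ K `<=` A]]).

(* ** Metric measure spacetimes *)

Definition time_separation {R : realType} {M : Type} (l : M -> M -> \bar R)
    : Prop :=
  [/\ forall x y, l x y = -oo%E \/ (0 <= l x y)%E,
      forall x, l x x = 0%E &
      forall x y z,
        (Order.min (addx (l x y) (l y z)) (addx (l y z) (l x y)) <= l x z)%E].

Definition tsep_le {R : realType} {M : Type} (l : M -> M -> \bar R) (x y : M)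
    : Prop :=
  (0 <= l x y)%E.

(* The base point carried by a [ptopologicalType] is required by the
   measurable types of the library.  It is no restriction, since
   [mms_vol_neq0] forces the space to be nonempty, and no other definition
   depends on it. *)
Record mmSpacetime (R : realType) := MMSpacetime {
  mms_sort :> ptopologicalType ;
  mms_polish : polish R mms_sort ;
  tsep : mms_sort -> mms_sort -> \bar R ;
  mms_tsep : time_separation tsep ;
  mms_refl : forall x, tsep_le tsep x x ;
  mms_antisym : forall x y, tsep_le tsep x y -> tsep_le tsep y x -> x = y ;
  mms_trans : forall x y z,
    tsep_le tsep x y -> tsep_le tsep y z -> tsep_le tsep x z ;
  mms_closed : closed [set xy : mms_sort * mms_sort | (0 <= tsep xy.1 xy.2)%E] ;
  vol : {measure set (borel mms_sort) -> \bar R} ;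
  mms_radon : radon vol ;
  mms_vol_neq0 : vol setT != 0%E
}.

Arguments tsep {R m}.
Arguments vol {R}.

Definition causal_le {R : realType} {X : mmSpacetime R} : X -> X -> Prop :=
  tsep_le tsep.

(* ** Left-continuous causal curves *)

(* A curve on [0,1] is encoded by its extension to R that is constant on
   ]-oo, 0] and on [1, +oo[: this makes the encoding unique. *)
Record lcc (R : realType) (X : mmSpacetime R) := Lcc {
  lcc_fun :> R -> X ;
  lcc_causal : forall s t : R, 0 <= s -> s <= t -> t <= 1 ->
    causal_le (lcc_fun s) (lcc_fun t) ;
  lcc_left_continuous : forall t : R, 0 < t -> t <= 1 ->
    lcc_fun s @[s --> t^'-] --> lcc_fun t ;
  lcc_before : forall t : R, t < 0 -> lcc_fun t = lcc_fun 0 ;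
  lcc_after : forall t : R, 1 < t -> lcc_fun t = lcc_fun 1
}.

Program Definition lcc_cst (R : realType) (X : mmSpacetime R) (x : X) : lcc X :=
  @Lcc R X (fun=> x) _ _ _ _.
Next Obligation. by move=> R X x s t _ _ _; exact: mms_refl. Qed.
Next Obligation. by move=> R X x t _ _; exact: cvg_cst. Qed.
Next Obligation. by []. Qed.
Next Obligation. by []. Qed.

HB.instance Definition _ (R : realType) (X : mmSpacetime R) :=
  gen_eqMixin (lcc X).
HB.instance Definition _ (R : realType) (X : mmSpacetime R) :=
  gen_choiceMixin (lcc X).
HB.instance Definition _ (R : realType) (X : mmSpacetime R) :=
  isPointed.Build (lcc X) (lcc_cst point).

Definition lcc_dist {R : realType} {X : mmSpacetime R} (d : X -> X -> R)
    (c e : lcc X) : R :=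
  d (c 0) (e 0) + \int[lebesgue_measure]_(t in `[0, 1]) d (c t) (e t).

Definition lcc_open {R : realType} {X : mmSpacetime R} (d : X -> X -> R)
    : set (set (lcc X)) :=
  [set U | forall c, U c ->
    exists2 r : R, 0 < r & [set e | lcc_dist d c e < r] `<=` U].

Definition borel_lcc {R : realType} {X : mmSpacetime R} (d : X -> X -> R) :=
  g_sigma_algebraType (lcc_open d).

(* ** Causal speed *)

Definition below_tsep {R : realType} {X : mmSpacetime R} (c : lcc X)
    (nu : {measure set (measurableTypeR R) -> \bar R}) : Prop :=
  forall a b : R, 0 <= a -> a < b -> b <= 1 ->
    (nu `]a, b[%classic <= tsep (c a) (c b))%E.

(* [nu] stands for a measure on [0,1]: its values on sets that are not included
   in [0,1] are irrelevant. *)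
Definition largest_below_tsep {R : realType} {X : mmSpacetime R} (c : lcc X)
    (nu : {measure set (measurableTypeR R) -> \bar R}) : Prop :=
  below_tsep c nu /\
  forall nu' : {measure set (measurableTypeR R) -> \bar R},
    below_tsep c nu' ->
    forall A : set (measurableTypeR R), measurable A -> A `<=` `[0, 1] ->
      (nu' A <= nu A)%E.

Definition density_below {R : realType}
    (nu : {measure set (measurableTypeR R) -> \bar R}) (g : R -> \bar R)
    : Prop :=
  [/\ measurable_fun [set: R] g,
      forall t, (0 <= g t)%E &
      forall A : set (measurableTypeR R), measurable A -> A `<=` `[0, 1] ->
        (\int[lebesgue_measure]_(t in A) g t <= nu A)%E].

(* Density of the absolutely continuous part of [nu] on [0,1], defined as the
   a.e. largest density of an absolutely continuous measure below [nu].  This is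
   the usual density when the Lebesgue decomposition exists, in particular for
   sigma-finite [nu]; but the measure in [largest_below_tsep] has infinite atoms
   at 0 and 1, and it is infinite on every nonempty set of times if tsep is
   infinite along the curve, in which case it has no Lebesgue decomposition. *)
Definition is_ac_density {R : realType}
    (nu : {measure set (measurableTypeR R) -> \bar R}) (g : R -> \bar R)
    : Prop :=
  density_below nu g /\
  forall h : R -> \bar R, density_below nu h ->
    {ae lebesgue_measure, forall t : R, `[0, 1]%classic t -> (h t <= g t)%E}.

(* A choice of representative: only integrals over [0,1] of the speed are used. *)
Definition causal_speed {R : realType} {X : mmSpacetime R} (c : lcc X)
    : R -> \bar R :=
  xget (cst 0%E) [set g | exists2 nu : {measure set (measurableTypeR R) -> \bar R},
    largest_below_tsep c nu & is_ac_density nu g].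

(* ** Causal functions, test plans, subslopes, visible set *)

(* Measurability with respect to the completion of the Borel sigma-algebra. *)
Definition ae_measurable {R : realType} {X : mmSpacetime R} (f : X -> \bar R)
    : Prop :=
  forall B : set (\bar R), measurable B ->
    exists A1 A2 : set (borel X),
      [/\ measurable A1, measurable A2, A1 `<=` f @^-1` B, f @^-1` B `<=` A2 &
          vol X (A2 `\` A1) = 0%E].

Definition causal_function {R : realType} {X : mmSpacetime R}
    (f : X -> \bar R) : Prop :=
  ae_measurable f /\ forall x y : X, causal_le x y -> (f x <= f y)%E.

Definition test_plan {R : realType} {X : mmSpacetime R} (d : X -> X -> R)
    (P : probability (borel_lcc d) R) : Prop :=
  exists2 C : R, 0 < C &
    forall t : R, 0 <= t -> t <= 1 ->
    forall A : set (borel X), measurable A ->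
      (P [set c : lcc X | A (c t)] <= C%:E * vol X A)%E.

(* The time separation is not assumed to be measurable, so that an integral in
   time of the causal speed need not be a measurable function of the curve.  The
   upper integral is the integral on nonnegative measurable functions. *)
Definition upper_integral d {T : measurableType d} {R : realType}
    (mu : {measure set T -> \bar R}) (F : T -> \bar R) : \bar R :=
  ereal_inf [set \int[mu]_x h x | h in
    [set h : T -> \bar R | measurable_fun setT h /\ forall x, (F x <= h x)%E]]%E.

(* The integral of the function [h] on X against the push-forward under
   (c, t) |-> c t of the measure |c'_t| dP(c) dt. *)
Definition plan_integral {R : realType} {X : mmSpacetime R} {d : X -> X -> R}
    (P : probability (borel_lcc d) R) (h : X -> \bar R) : \bar R :=
  upper_integral P (fun c : lcc X =>
    \int[lebesgue_measure]_(t in `[0%R, 1%R]) (h (c t) * causal_speed c t))%E.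

Definition nneg_borel {R : realType} {X : mmSpacetime R} (G : X -> \bar R)
    : Prop :=
  measurable_fun [set: borel X] (G : borel X -> \bar R) /\ forall x, (0 <= G x)%E.

Definition weak_subslope {R : realType} {X : mmSpacetime R} (d : X -> X -> R)
    (f G : X -> \bar R) : Prop :=
  nneg_borel G /\
  forall P : probability (borel_lcc d) R, test_plan P ->
    (plan_integral P G <= \int[P]_c subx (f ((c : lcc X) 1%R)) (f ((c : lcc X) 0%R)))%E.

(* [G] is a representative of |df|. *)
Definition is_slope {R : realType} {X : mmSpacetime R} (d : X -> X -> R)
    (f G : X -> \bar R) : Prop :=
  weak_subslope d f G /\
  forall H : X -> \bar R, weak_subslope d f H ->
    {ae vol X, forall x : X, (H x <= G x)%E}.

Definition plan_density {R : realType} {X : mmSpacetime R} {d : X -> X -> R}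
    (P : probability (borel_lcc d) R) (rho : X -> \bar R) : Prop :=
  nneg_borel rho /\
  forall A : set (borel X), measurable A ->
    (\int[vol X]_(x in A) rho x = plan_integral P (fun x => (\1_A x)%:E))%E.

Definition covers_plans {R : realType} {X : mmSpacetime R} (d : X -> X -> R)
    (V : set X) : Prop :=
  forall (P : probability (borel_lcc d) R) (rho : X -> \bar R),
    test_plan P -> plan_density P rho ->
    {ae vol X, forall x : X, (0 < rho x)%E -> V x}.

(* [V] is a representative of Vis(M). *)
Definition is_vis {R : realType} {X : mmSpacetime R} (d : X -> X -> R)
    (V : set X) : Prop :=
  [/\ measurable (V : set (borel X)), covers_plans d V &
      forall W : set X, measurable (W : set (borel X)) -> covers_plans d W ->
        {ae vol X, forall x : X, V x -> W x}].

(* ** Distributional derivative of a function of one real variable *)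

Definition test_function {R : realType} (psi : R -> R) : Prop :=
  (forall (n : nat) (x : R), derivable (derive1n n psi) x 1) /\
  compact (closure [set x | psi x != 0]).

Definition distributional_derivative {R : realType} (phi : R -> R)
    (mu : {measure set (measurableTypeR R) -> \bar R}) : Prop :=
  forall psi : R -> R, test_function psi ->
    (\int[mu]_x (psi x)%:E =
     - \int[lebesgue_measure]_x (phi x * derive1 psi x)%:E)%E.

(* [mu] is the derivative of [phi], and [mu] = g * Lebesgue + [sigma] is its
   Lebesgue decomposition.  Among the representatives of the density, those
   considered are infinite on a null set that carries [sigma]; the pointwise
   derivative of [phi], completed by +oo where it does not exist, is one of them.
   A causal function may take its values in a null set, so that an arbitrary
   representative will not do: if [phi] is the inverse of an increasing singular
   homeomorphism f of the Minkowski line, then 0 represents the density,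
   |df| = 0, and |d(phi o f)| = 1. *)
Definition is_ac_derivative {R : realType} (phi : R -> R) (g : R -> \bar R)
    : Prop :=
  [/\ measurable_fun [set: R] g,
      forall x, (0 <= g x)%E &
      exists mu sigma : {measure set (measurableTypeR R) -> \bar R},
        [/\ distributional_derivative phi mu,
            forall A : set (measurableTypeR R), measurable A ->
              mu A = (\int[lebesgue_measure]_(x in A) g x + sigma A)%E,
            lebesgue_measure [set x | g x = +oo%E] = 0%E &
            sigma [set x | (g x < +oo)%E] = 0%E]].

Definition extend {R : realType} (phi : R -> R) (x : \bar R) : \bar R :=
  match x with
  | r%:E => (phi r)%:E
  | +oo%E => +oo%E
  | -oo%E => -oo%E
  end.

Definition extend_derivative {R : realType} (g : R -> \bar R) (x : \bar R)
    : \bar R :=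
  if x is r%:E then g r else +oo%E.

(* Main.v *)
(* Write u for f along a curve c, and v for G(c) |c'|, where G is a weak subslope.
   Conditioning a test plan on a set of curves and restricting the curves to [s, t]
   yields another test plan.  Testing G against all of these shows that, along
   almost every curve, the integral of v over [s, t] is at most u(t) - u(s) for
   all rational s < t: the push-forward of v dt under u is at most the Lebesgue
   measure, or at most mu = phi' if G is a weak subslope of phi o f.

   In the first case the integral of phi'(u) v is at most phi(u(1)) - phi(u(0)),
   so phi'(f) |df| is a weak subslope of phi o f.  In the second case, as the
   singular part of mu is carried by {phi' = +oo}, the integral of v / phi'(u) over
   the times with 0 < phi'(u) < +oo is at most u(1) - u(0), and v vanishes a.e. where
   phi'(u) = 0.  So |d(phi o f)| / phi'(f) is a weak subslope of f, and no test
   plan charges {phi'(f) = 0 < |d(phi o f)|}, which is therefore invisible. *)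
Require Import Defs.
From HB Require Import structures.
From mathcomp Require Import all_boot all_order all_algebra.
From mathcomp Require Import all_classical all_reals all_analysis.
From mathcomp Require Import measurable_realfun.
From mathcomp Require Import unstable ring lra.
Import Order.TTheory GRing.Theory Num.Theory.
Import numFieldNormedType.Exports.

Set Implicit Arguments.
Unset Strict Implicit.
Unset Printing Implicit Defensive.

Local Open Scope classical_set_scope.
Local Open Scope ring_scope.

(** * Integration of nonnegative functions *)

(** The obstacle is measurability. The causal speed is built from [tsep], which need not be Borel,
    so its time integral need not be a measurable function of the curve and only an upper integral
    is available. The curvewise inequality can therefore not be obtained by testing on the set where
    it fails; a minimal measurable majorant takes over that role. The function [f] is measurable
    only up to a null set [N], but almost every curve avoids [N] at a given time and, by Fubini, at
    almost every time, so a Borel modification can stand in for [f]. Plans live on the Borel sets of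
    an integral distance, for which evaluation at a positive time is in general not continuous; left
    continuity recovers its measurability. Finally, [phi] may jump and its derivative is known only
    through test functions: masses of intervals are computed with explicit bumps, and open and
    closed ends must be kept apart. The measure [v dt] may fail to be sigma-finite, which is why it
    is always compared with a measure that is finite on bounded intervals. *)

Section nonneg_integral.
Local Open Scope ereal_scope.
Context d (T : measurableType d) (R : realType).
Variable mu : {measure set T -> \bar R}.

Import HBNNSimple.

(** The integral of a nonnegative function is a supremum over the simple functions below it, so
    monotonicity extends to increments of [f] along curves, which are in general not measurable
    functions of the curve. *)
Lemma le_integral_nonneg (D : set T) (f g : T -> \bar R) :
  (forall x, D x -> 0 <= f x) -> (forall x, D x -> f x <= g x) ->
  \int[mu]_(x in D) f x <= \int[mu]_(x in D) g x.
Proof.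
move=> f0 fg; rewrite !ge0_integralE//; last first.
  by move=> x Dx; exact: le_trans (f0 x Dx) (fg x Dx).
apply: ge_ereal_sup => _ [h /= hf <-].
apply: le_ereal_sup_tmp; exists (sintegral mu h) => //; exists h => // x.
apply: le_trans (hf x) _.
by rewrite !patchE; case: ifPn => // /set_mem Dx; exact: fg.
Qed.

Definition mdensity (v : T -> \bar R) (_ : measurable_fun setT v)
  (_ : forall x, 0 <= v x) (A : set T) := \int[mu]_(x in A) v x.

Section mdensity.
Variables (v : T -> \bar R) (mv : measurable_fun setT v) (v0 : forall x, 0 <= v x).

Let mdensity_set0 : mdensity mv v0 set0 = 0.
Proof. exact: integral_set0. Qed.

Let mdensity_ge0 A : 0 <= mdensity mv v0 A.
Proof. exact: integral_ge0. Qed.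

Let mdensity_sigma_additive : semi_sigma_additive (mdensity mv v0).
Proof.
move=> F mF tF mUF; rewrite /mdensity ge0_integral_bigcup//=.
- by apply: is_cvg_nneseries => n _ _; exact: integral_ge0.
- exact: measurable_funTS.
Qed.

HB.instance Definition _ := isMeasure.Build _ _ _ (mdensity mv v0)
  mdensity_set0 mdensity_ge0 mdensity_sigma_additive.
End mdensity.

End nonneg_integral.

Section change_of_density.
Local Open Scope ereal_scope.
Context d1 d2 (T1 : measurableType d1) (T2 : measurableType d2) (R : realType).
Variables (mu : {measure set T1 -> \bar R}) (nu : {measure set T2 -> \bar R}).

Import HBNNSimple.

(* Both sides are increasing limits over the simple functions below [h]. *)
Lemma le_integral_comp (u : T1 -> T2) (v : T1 -> \bar R) (g : T2 -> \bar R)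
    (D : set T1) (h : T2 -> \bar R) :
  measurable D -> measurable_fun setT u ->
  measurable_fun setT v -> (forall x, 0 <= v x) ->
  measurable_fun setT g -> (forall x, 0 <= g x) ->
  measurable_fun setT h -> (forall x, 0 <= h x) ->
  (forall B, measurable B ->
     \int[mu]_(x in D `&` u @^-1` B) v x <= \int[nu]_(y in B) g y) ->
  \int[mu]_(x in D) (h (u x) * v x) <= \int[nu]_y (h y * g y).
Proof.
move=> mD mu_ mv v0 mg g0 mh h0 H.
pose h_ := nnsfun_approx measurableT mh.
have hsup y : h y = ereal_sup (range (fun n => (h_ n y)%:E)).
  have hu : (EFin \o h_^~ y) @ \oo --> h y by apply: cvg_nnsfun_approx.
  rewrite -(cvg_lim _ hu)//; apply/cvg_lim => //; apply: ereal_nondecreasing_cvgn.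
  by move=> m n mn; rewrite lee_fin; exact/lefP/nd_nnsfun_approx.
have h_le n y : (h_ n y)%:E <= h y.
  by rewrite hsup; apply: le_ereal_sup_tmp; exists (h_ n y)%:E => //; exists n.
have mhn n : measurable_fun setT (fun y => (h_ n y)%:E).
  by apply/measurable_EFinP.
(* Multiplication is not continuous at 0 and [+oo], hence the case split: [v x = 0] is trivial, a
   finite [v x] is divided out, and for [v x = +oo] some [h_ n (u x)] is positive unless
   [h (u x) = 0]. *)
have E x : h (u x) * v x = limn (fun n => (h_ n (u x))%:E * v x).
  apply/esym/cvg_lim => //; rewrite muleC.
  under eq_fun do rewrite muleC.
  have [->|v00] := eqVneq (v x) 0.
    by under eq_fun do rewrite mul0e; rewrite mul0e; exact: cvg_cst.
  have vgt0 : 0 < v x by rewrite lt0e v00 v0.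
  have nd : nondecreasing_seq (fun n => v x * (h_ n (u x))%:E).
    move=> m n mn; apply: lee_wpmul2l => //.
    by rewrite lee_fin; exact/lefP/nd_nnsfun_approx.
  have := ereal_nondecreasing_cvgn nd.
  suff -> : ereal_sup (range (fun n => v x * (h_ n (u x))%:E)) = v x * h (u x) by [].
  have le1 : ereal_sup (range (fun n => v x * (h_ n (u x))%:E)) <= v x * h (u x).
    apply: ge_ereal_sup => _ [n _ <-].
    by apply: lee_wpmul2l.
  apply/eqP; rewrite eq_le le1/=.
  have [vfin|] := boolP (v x \is a fin_num).
    rewrite -(fineK vfin) muleC -lee_pdivlMr; last by rewrite fine_gt0// vgt0 ltey_eq vfin.
    rewrite hsup; apply: ge_ereal_sup => _ [n _ <-].
    rewrite lee_pdivlMr; last by rewrite fine_gt0// vgt0 ltey_eq vfin.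
    rewrite muleC; apply: le_ereal_sup_tmp.
    by exists ((fine (v x))%:E * (h_ n (u x))%:E) => //; exists n.
  rewrite ge0_fin_numE// -leNgt leye_eq => /eqP ->.
  have [h00|hn0] := eqVneq (h (u x)) 0.
    rewrite h00 mule0; apply: le_ereal_sup_tmp; exists (+oo * (h_ 0%N (u x))%:E).
      by exists 0%N.
    by apply: mule_ge0 => //; rewrite lee_fin.
  have [n hn] : exists n, 0 < (h_ n (u x))%:E.
    apply: contrapT => /forallNP hn; move: hn0; apply/negP; rewrite negbK.
    rewrite eq_le h0 andbT hsup; apply: ge_ereal_sup => _ [n _ <-].
    by rewrite leNgt; exact/negP/hn.
  apply: (@le_trans _ _ +oo); first by rewrite leey.
  apply: le_ereal_sup_tmp; exists (+oo * (h_ n (u x))%:E); first by exists n.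
  by rewrite gt0_mulye.
under eq_integral do rewrite E.
have mvn n : measurable_fun setT (fun x => (h_ n (u x))%:E * v x).
  by apply: emeasurable_funM => //; exact: (measurableT_comp (mhn n)).
rewrite monotone_convergence//; last 3 first.
- by move=> n; exact: measurable_funTS.
- by move=> n x _; rewrite mule_ge0// lee_fin.
- move=> x _ m n mn; apply: lee_wpmul2r => //.
  by rewrite lee_fin; exact/lefP/nd_nnsfun_approx.
apply: lime_le.
  apply: ereal_nondecreasing_is_cvgn => m n mn; apply: ge0_le_integral => //.
  - by move=> x _; rewrite mule_ge0// lee_fin.
  - exact: measurable_funTS.
  - exact: measurable_funTS.
  - move=> x _; apply: lee_wpmul2r => //.
    by rewrite lee_fin; exact/lefP/nd_nnsfun_approx.
apply: nearW => n.
apply: (@le_trans _ _ (\int[nu]_y ((h_ n y)%:E * g y))); last first.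
  apply: le_integral_nonneg => y _; first by rewrite mule_ge0// lee_fin.
  apply: lee_wpmul2r => //.
have preim r : measurable (h_ n @^-1` [set r]) by [].
have intl : \int[mu]_(x in D) ((h_ n (u x))%:E * v x) =
  \sum_(r \in range (h_ n)) r%:E * \int[mu]_(x in D `&` u @^-1` (h_ n @^-1` [set r])) v x.
  under eq_integral => x _.
    rewrite fimfunE -fsumEFin// ge0_mule_fsuml; last first.
      by move=> r; rewrite EFinM nnfun_muleindic_ge0.
    over.
  rewrite ge0_integral_fsum//; last 2 first.
  - move=> r; apply: emeasurable_funM; last exact: measurable_funTS.
    apply/measurable_EFinP; apply: measurable_funM => //.
    apply: measurable_funTS; apply: (measurableT_comp _ mu_) => //.
  - by move=> r x _; rewrite mule_ge0// EFinM nnfun_muleindic_ge0.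
  apply: eq_fsbigr => r; rewrite inE => -[y _ <-].
  under eq_integral do rewrite EFinM -muleA.
  rewrite ge0_integralZl_EFin//; last 2 first.
  - by move=> x _; rewrite mule_ge0// lee_fin.
  - apply: emeasurable_funM; last exact: measurable_funTS.
    apply/measurable_EFinP; apply: measurable_funTS; apply: (measurableT_comp _ mu_) => //.
  congr (_ * _); rewrite integral_mkcondr; apply: eq_integral => x _.
  rewrite patchE /indic/=; case: ifPn => [/set_mem/= xr|xr].
    by rewrite mem_set// mul1e.
  rewrite memNset ?mul0e// => xr'; move: xr; rewrite mem_set//.
have intr : \int[nu]_y ((h_ n y)%:E * g y) =
  \sum_(r \in range (h_ n)) r%:E * \int[nu]_(y in (h_ n @^-1` [set r])) g y.
  under eq_integral => x _.
    rewrite fimfunE -fsumEFin// ge0_mule_fsuml; last first.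
      by move=> r; rewrite EFinM nnfun_muleindic_ge0.
    over.
  rewrite ge0_integral_fsum//; last 2 first.
  - move=> r; apply: emeasurable_funM => //.
    by apply/measurable_EFinP; apply: measurable_funM.
  - by move=> r x _; rewrite mule_ge0// EFinM nnfun_muleindic_ge0.
  apply: eq_fsbigr => r; rewrite inE => -[y _ <-].
  under eq_integral do rewrite EFinM -muleA.
  rewrite ge0_integralZl_EFin//; last 2 first.
  - by move=> x _; rewrite mule_ge0// lee_fin.
  - by apply: emeasurable_funM => //; exact/measurable_EFinP.
  congr (_ * _); rewrite [RHS]integral_mkcond; apply: eq_integral => x _.
  rewrite patchE /indic/=; case: ifPn => [/set_mem/= xr|xr].
    by rewrite mul1e.
  by rewrite mul0e.
rewrite intl intr; apply: lee_fsum => //.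
move=> r [y _ <-]; apply: lee_wpmul2l; first by rewrite lee_fin.
exact: H.
Qed.

End change_of_density.

(** * Measures on the line *)

Section measures_on_the_line.
Local Open Scope ereal_scope.
Context (R : realType).
Implicit Types mu nu : {measure set (measurableTypeR R) -> \bar R}.

Section ocitv_restriction.
Variable mu : {measure set (measurableTypeR R) -> \bar R}.

(** [mu] seen on the semiring of half-open intervals, where uniqueness of the extension can be
    invoked. *)
Definition ocitv_restriction (A : set (ocitv_type R)) : \bar R := mu A.

Let restr0 : ocitv_restriction set0 = 0. Proof. exact: measure0. Qed.

Let restr_ge0 A : 0 <= ocitv_restriction A. Proof. exact: measure_ge0. Qed.

Let restr_sigma_additive : semi_sigma_additive ocitv_restriction.
Proof.
move=> F mF tF mUF; apply: measure_semi_sigma_additive => //.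
- by move=> i; apply: sub_sigma_algebra; exact: mF.
- by apply: sub_sigma_algebra; exact: mUF.
Qed.

HB.instance Definition _ := isMeasure.Build _ _ _ ocitv_restriction
  restr0 restr_ge0 restr_sigma_additive.
End ocitv_restriction.

(** By uniqueness of the extension, [mu A] is the infimum of the total masses of covers of [A] by
    half-open intervals, and countable subadditivity bounds [nu A] by each of them. The asymmetry
    matters: [nu] will be a push-forward of [v dt], which may fail to be sigma-finite. *)
Lemma le_measure_itv mu nu :
  (forall a b : R, (a < b)%R -> mu `]a, b]%classic < +oo) ->
  (forall a b : R, (a < b)%R -> nu `]a, b]%classic <= mu `]a, b]%classic) ->
  forall A : set (measurableTypeR R), measurable A -> nu A <= mu A.
Proof.
move=> mufin numu A mA.
have numu' (B : set (ocitv_type R)) : measurable B -> nu B <= mu B.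
  move=> /ocitvP[->|[x x12 ->]]; first by rewrite !measure0.
  exact: numu.
have sf : sigma_finite [set: ocitv_type R] (ocitv_restriction mu).
  exists (fun k : nat => `](- k%:R)%R, k%:R]%classic).
    apply/esym; rewrite -subTset => x _ /=; exists (Num.bound x) => //=.
    by rewrite in_itv/= ltrNl ltrNbound ltW// ltr_bound.
  move=> k; split; first exact: is_ocitv.
  have [k0|k0] := ltP (- (k%:R : R))%R k%:R; first exact: mufin.
  by rewrite set_itv_ge ?measure0// bnd_simp -leNgt.
have <- := measure_extension_unique sf (fun X _ => erefl) mA.
apply: le_ereal_inf_tmp => _ [F [mF AF] <-].
have mF' i : measurable (F i : set (measurableTypeR R)).
  by apply: sub_sigma_algebra; exact: mF.
apply: (@le_trans _ _ (\sum_(i <oo) nu (F i))).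
  exact: measure_sigma_subadditive.
apply: lee_nneseries => // i _; exact: numu'.
Qed.

Lemma pushforward_measure d d' (T1 : measurableType d) (T2 : measurableType d')
    (m : {measure set T1 -> \bar R}) (f : T1 -> T2) : measurable_fun setT f ->
  exists nu : {measure set T2 -> \bar R}, forall A, nu A = m (f @^-1` A).
Proof. by move=> mf; unshelve eexists (pushforward m f); [exact: mf|]. Qed.

Lemma nondecreasing_emeasurable (u : R -> \bar R) :
  {homo u : s t / (s <= t)%R >-> s <= t} -> measurable_fun [set: R] u.
Proof.
move=> u_nd; apply: (measurability (@ErealGenCInfty.G R)) => [|/= _ [_] [r] -> <-].
  exact: ErealGenCInfty.measurableE.
apply: measurableI => //; apply: is_interval_measurable => s t/=.
rewrite !in_itv/= !andbT => us ut w /andP[sw wt].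
by rewrite in_itv/= andbT (le_trans us)// u_nd.
Qed.

(** The open interval between [inf I] and [sup I] is exhausted by compact ones, each contained in
    some [[p, q]] with rational ends in [I]. Rational times are imposed by the source of the bound:
    only countably many pairs of times can be handled outside one null set of curves. *)
Lemma integral_interval_le_rat (v : R -> \bar R) (I : set R) (K : \bar R) :
  measurable_fun setT v -> (forall x, 0 <= v x) -> 0 <= K ->
  is_interval I -> I `<=` `[0%R, 1%R]%classic ->
  (forall p q : rat, (ratr p < ratr q :> R)%R -> I (ratr p) -> I (ratr q) ->
     \int[lebesgue_measure]_(x in `[ratr p, ratr q]) v x <= K) ->
  \int[lebesgue_measure]_(x in I) v x <= K.
Proof.
move=> mv v0 K0 itvI I01 H.
have mI := is_interval_measurable itvI.
have [I0|/set0P I_neq0] := eqVneq I set0; first by rewrite I0 integral_set0.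
have lbI : has_lbound I by exists 0%R => x /I01/=; rewrite in_itv/= => /andP[].
have ubI : has_ubound I by exists 1%R => x /I01/=; rewrite in_itv/= => /andP[].
set a := inf I; set b := sup I.
have Iab : I `<=` `[a, b]%classic.
  by move=> x Ix /=; rewrite in_itv/= ge_inf//= ub_le_sup.
have in_I x : (a < x)%R -> (x < b)%R -> I x.
  move=> /(inf_lt I_neq0)[y Iy yx] /(sup_gt I_neq0)[z Iz xz].
  by apply: (itvI _ _ Iy Iz); rewrite !ltW.
apply: (@le_trans _ _ (\int[lebesgue_measure]_(x in `[a, b]) v x)).
  by apply: ge0_subset_integral => //; exact: measurable_funTS.
rewrite (integral_itv_bndoo true false); last exact: measurable_funTS.
pose F n := `[a + n.+1%:R^-1, b - n.+1%:R^-1]%classic%R.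
have nd_F : nondecreasing_seq F.
  move=> m n mn; rewrite subsetEset; apply: subset_itv; rewrite bnd_simp.
    by rewrite lerD2l lef_pV2 ?posrE ?ltr0n// ler_nat.
  by rewrite lerD2l lerN2 lef_pV2 ?posrE ?ltr0n// ler_nat.
have FU : `]a, b[%classic = \bigcup_n F n.
  apply/seteqP; split => [x /=|x [n _]]; last first.
    rewrite /F /= !in_itv/= => /andP[ax xb]; apply/andP; split.
      by apply: (lt_le_trans _ ax); rewrite ltrDl invr_gt0.
    by apply: (le_lt_trans xb); rewrite gtrBl invr_gt0.
  rewrite in_itv/= => /andP[ax xb].
  have [n1 h1] : exists n : nat, (n.+1%:R^-1 <= x - a)%R.
    by exists (Num.trunc (x - a)^-1); rewrite -[leRHS]invrK lef_pV2 ?posrE ?invr_gt0 ?subr_gt0// ltW// truncnS_gt.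
  have [n2 h2] : exists n : nat, (n.+1%:R^-1 <= b - x)%R.
    by exists (Num.trunc (b - x)^-1); rewrite -[leRHS]invrK lef_pV2 ?posrE ?invr_gt0 ?subr_gt0// ltW// truncnS_gt.
  exists (maxn n1 n2) => //; rewrite /F /= in_itv/=; apply/andP; split.
    rewrite -lerBrDl (le_trans _ h1)// lef_pV2 ?posrE ?ltr0n// ler_nat ltnS.
    exact: leq_maxl.
  rewrite lerBrDr -lerBrDl (le_trans _ h2)// lef_pV2 ?posrE ?ltr0n// ler_nat ltnS.
  exact: leq_maxr.
have mF n : measurable (F n : set (measurableTypeR R)) by exact: measurable_itv.
have := @ge0_nondecreasing_set_cvg_integral _ (measurableTypeR R) R F v lebesgue_measure nd_F mF
  (fun n => measurable_funTS mv) (fun n x _ => v0 x).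
rewrite -FU => cvgF; rewrite -(cvg_lim _ cvgF)//.
apply: lime_le; first by apply/cvg_ex; eexists; exact: cvgF.
apply: nearW => n.
(* For small [n], [F n] is empty or a single point, and its integral vanishes. *)
have n0 : (0 < n.+1%:R^-1 :> R)%R by rewrite invr_gt0.
have [ab|ab] := ltP (a + n.+1%:R^-1)%R (b - n.+1%:R^-1)%R; last first.
  apply: (@le_trans _ _ 0) => //.
  rewrite (_ : 0 = \int[lebesgue_measure]_(x in [set (a + n.+1%:R^-1)%R]) v x); last first.
    by rewrite integral_set1.
  apply: ge0_subset_integral => //; first exact: measurable_funTS.
  move=> x; rewrite /F /= in_itv/= => /andP[x1 x2]; apply/eqP; rewrite eq_le x1 andbT.
  exact: le_trans ab.
have [p /andP[p1 p2]] : exists p : rat, (a < ratr p < a + n.+1%:R^-1)%R.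
  have aa : (a < a + n.+1%:R^-1)%R by rewrite ltrDl.
  by have [p] := rat_in_itvoo aa; rewrite in_itv/= => ?; exists p.
have [q /andP[q1 q2]] : exists q : rat, (b - n.+1%:R^-1 < ratr q < b)%R.
  have bb : (b - n.+1%:R^-1 < b)%R by rewrite gtrBl.
  by have [q] := rat_in_itvoo bb; rewrite in_itv/= => ?; exists q.
have pq : (ratr p < ratr q :> R)%R by exact: (lt_trans p2 (lt_trans ab q1)).
apply: (@le_trans _ _ (\int[lebesgue_measure]_(x in `[ratr p, ratr q]) v x)).
  apply: ge0_subset_integral => //; first exact: measurable_funTS.
  by apply: subset_itv; rewrite bnd_simp ltW.
apply: H => //; apply: in_I => //.
- exact: (lt_trans pq q2).
- exact: (lt_trans p1 pq).
Qed.

(** The left-hand side is the push-forward under [u] of [v dt], restricted to the times where [u] is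
    finite. Since [u] is monotone, the preimage of []a, b]] is an interval, so the bound on rational
    intervals passes to it and then from intervals to Borel sets. *)
Lemma integral_preimage_le (u v : R -> \bar R) mu :
  {homo u : s t / (s <= t)%R >-> s <= t} ->
  measurable_fun setT v -> (forall x, 0 <= v x) ->
  (forall a b : R, (a < b)%R -> mu `]a, b]%classic < +oo) ->
  (forall (a b : R) (p q : rat), (a < b)%R ->
     (0 <= ratr p :> R)%R -> (ratr p < ratr q :> R)%R -> (ratr q <= 1 :> R)%R ->
     a%:E < u (ratr p) -> u (ratr q) <= b%:E ->
     \int[lebesgue_measure]_(x in `[ratr p, ratr q]) v x <= mu `]a, b]%classic) ->
  forall B : set (measurableTypeR R), measurable B ->
  \int[lebesgue_measure]_(x in `[0%R, 1%R] `&` u @^-1` (EFin @` B)) v x <= mu B.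
Proof.
move=> u_nd mv v0 mufin H.
have mu_ := nondecreasing_emeasurable u_nd.
(* [fine] sends the infinite values to 0, so the times where [u] is infinite are removed before
   pushing forward. *)
pose D : set (measurableTypeR R) := `[0%R, 1%R] `&` [set x | u x \is a fin_num].
have mD : measurable D.
  apply: measurableI; first exact: measurable_itv.
  by have := emeasurable_fin_num measurableT mu_; rewrite setTI.
have mw : measurable_fun setT (v \_ D) by exact/(measurable_restrictT _ mD)/measurable_funTS.
have w0 x : 0 <= (v \_ D) x by rewrite patchE; case: ifPn.
have mfu : measurable_fun setT (fine \o u : measurableTypeR R -> measurableTypeR R).
  exact: measurableT_comp mu_.
move=> B mB.
have [theta thetaE] := pushforward_measure
  [the {measure set (measurableTypeR R) -> \bar R} of mdensity lebesgue_measure mw w0] mfu.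
have {}thetaE A : theta A =
    \int[lebesgue_measure]_(x in `[0%R, 1%R] `&` u @^-1` (EFin @` A)) v x.
  rewrite thetaE /= /mdensity -integral_mkcondr; congr (integral _ _ _).
  apply/seteqP; split => x /=.
    by move=> [Bx [x01 xfin]]; split => //; exists (fine (u x)) => //; rewrite fineK.
  by move=> [x01 [y By yx]]; rewrite /D /= -yx; do 2 split => //; rewrite -yx.
rewrite -thetaE; apply: le_measure_itv => // a b ab.
rewrite thetaE; apply: integral_interval_le_rat => //.
- move=> s t [s01 [y1 /= y1ab y1s]] [t01 [y2 /= y2ab y2t]] w /andP[sw wt].
  have w01 : (0 <= w <= 1)%R.
    move: s01 t01; rewrite /= !in_itv/= => /andP[s0 _] /andP[_ t1].
    by rewrite (le_trans s0 sw) (le_trans wt t1).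
  split; first by rewrite /= in_itv.
  have uw1 := u_nd _ _ sw; have uw2 := u_nd _ _ wt.
  rewrite -y1s in uw1; rewrite -y2t in uw2.
  have uwfin : u w \is a fin_num.
    by rewrite fin_numE -ltNye -ltey (lt_le_trans _ uw1) ?ltNyr// (le_lt_trans uw2)// ltry.
  exists (fine (u w)); last by rewrite fineK.
  move: y1ab y2ab; rewrite /= !in_itv/= => /andP[ay1 _] /andP[_ y2b].
  by rewrite -!lee_fin -lte_fin fineK// (lt_le_trans _ uw1) ?lte_fin// (le_trans uw2).
- move=> p q pq [p01 [y1 /= y1ab y1p]] [q01 [y2 /= y2ab y2q]].
  move: y1ab y2ab p01 q01; rewrite /= !in_itv/= => /andP[ay1 _] /andP[_ y2b] /andP[p0 _] /andP[_ q1].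
  by apply: H => //; rewrite -?y1p -?y2q.
Qed.

End measures_on_the_line.

(** * Smooth functions and distributional derivatives *)

Section smooth_functions.
Context (R : realType).
Implicit Types (f g : R -> R).

Definition smooth f := forall (n : nat) (x : R), derivable (derive1n n f) x 1.

Lemma smooth_stable (S : set (R -> R)) :
  (forall f, S f -> (forall x, derivable f x 1) /\ S (derive1 f)) ->
  forall f, S f -> smooth f.
Proof.
move=> H f Sf n; elim: n f Sf => [|n ih] f Sf x; first exact: (H f Sf).1.
by rewrite derive1Sn; apply: ih; exact: (H f Sf).2.
Qed.

Lemma smooth_derivable f : smooth f -> forall x, derivable f x 1.
Proof. by move=> sf x; exact: (sf 0%N). Qed.

Lemma smooth_derive1 f : smooth f -> smooth (derive1 f).
Proof. by move=> sf n x; rewrite -derive1Sn; exact: sf. Qed.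

Lemma derive1_eq f (x df : R) : is_derive x 1 f df -> derive1 f x = df.
Proof. by move=> h; rewrite derive1E derive_val. Qed.

(** The class that the Leibniz rule maps into itself, as [smooth_stable] requires. *)
Inductive sum_of_smooth_products : set (R -> R) :=
| ssp_mul f g : smooth f -> smooth g -> sum_of_smooth_products (f * g)
| ssp_add f g : sum_of_smooth_products f -> sum_of_smooth_products g ->
    sum_of_smooth_products (f + g).

Lemma smoothM f g : smooth f -> smooth g -> smooth (f * g).
Proof.
move=> sf sg; apply: (smooth_stable (S := sum_of_smooth_products)); last exact: ssp_mul.
move=> {f g sf sg} h; elim => {h} [f g sf sg|f g _ [df Sf] _ [dg Sg]].
  split=> [x|]; first by apply: derivableM; exact: smooth_derivable.
  rewrite (_ : derive1 _ = f * derive1 g + g * derive1 f); last first.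
    apply/funext => x; apply: derive1_eq; apply: is_deriveM.
      by rewrite derive1E; apply/derivableP/smooth_derivable.
    by rewrite derive1E; apply/derivableP/smooth_derivable.
  by apply: ssp_add; apply: ssp_mul; [exact: sf|exact: smooth_derive1|exact: sg|exact: smooth_derive1].
split=> [x|]; first exact: derivableD.
rewrite (_ : derive1 _ = derive1 f + derive1 g); first exact: ssp_add.
apply/funext => x; apply: derive1_eq.
by apply: is_deriveD; rewrite derive1E; exact/derivableP.
Qed.

End smooth_functions.

(** * Smooth functions flat at the origin *)

Section flat_function.
Context (R : realType).
Implicit Types (c : R) (p : {poly R}).

(** For [p = 1], the classical smooth function that vanishes to infinite order at 0. Polynomials in
    [x^-1] are allowed as factors so that the family is closed under derivation. *)
Definition flat c p (x : R) : R := if 0 < x then p.[x^-1] * expR (- (c / x)) else 0.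

(** The derivation in the variable [z = x^-1], whose derivative is [- z ^+ 2]. *)
Definition dflat c p : {poly R} := 'X^2 * (c *: p - p^`()).

(** In the variable [z = x^-1], induction on [p] with half the rate: the exponential is split into
    two equal factors, one bounding [p.[z]] by induction and the other absorbing the new factor [z],
    since [z * expR (- (c / 2 * z)) <= 2 / c]. *)
Lemma flat_bounded c p : 0 < c -> exists2 M : R, 0 < M & forall x, `|flat c p x| <= M.
Proof.
move=> c0; have [M M0 HM] : exists2 M : R, 0 < M &
    forall z, 0 < z -> `|p.[z]| * expR (- (c * z)) <= M.
  elim/poly_ind: p c c0 => [|p a ih] c c0.
    by exists 1 => // z _; rewrite horner0 normr0 mul0r.
  have [|M M0 HM] := ih (c / 2); first by rewrite divr_gt0.
  exists (2 / c * M + `|a| + 1); first by rewrite ltr_wpDl// addr_ge0// mulr_ge0 ?divr_ge0 ?ltW.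
  move=> z z0; rewrite hornerMXaddC.
  apply: (@le_trans _ _ ((`|p.[z]| * z + `|a|) * expR (- (c * z)))).
    apply: ler_wpM2r; first exact: expR_ge0.
    by rewrite (le_trans (ler_normD _ _))// normrM (gtr0_norm z0).
  rewrite mulrDl ler_wpDr// lerD//; last first.
    by rewrite ler_piMr// -expR0 ler_expR oppr_le0 mulr_ge0// ltW.
  have -> : - (c * z) = - (c / 2 * z) + - (c / 2 * z) by lra.
  rewrite expRD mulrACA [_ * expR _ * _]mulrC.
  apply: ler_pM => //; try by rewrite mulr_ge0// ?expR_ge0// ltW.
  - rewrite expRN -ler_pdivlMr ?invr_gt0 ?expR_gt0// invrK.
    apply: (@le_trans _ _ (2 / c * (c / 2 * z))); last first.
      apply: ler_wpM2l; first by rewrite divr_ge0// ltW.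
      by apply: le_trans (expR_ge1Dx _); lra.
    by rewrite le_eqVlt; apply/orP; left; apply/eqP; field; rewrite gt_eqF.
  - exact: HM.
exists M => // x; rewrite /flat; case: ifPn => x0; last by rewrite normr0 ltW.
by rewrite normrM (gtr0_norm (expR_gt0 _)); apply: HM; rewrite invr_gt0.
Qed.

Lemma is_derive_flat c p (x : R) : 0 < c -> is_derive x 1 (flat c p) (flat c (dflat c p) x).
Proof.
move=> c0; have [x0|x0|x0] := ltgtP 0 x.
- pose F := fun y : R => p.[y^-1] * expR (- (c / y)).
  apply: (@near_eq_is_derive _ _ _ F).
    by near=> y; rewrite /flat ifT//; near: y; exact: lt_nbhsr.
  have dV : is_derive x 1 (fun y : R => y^-1) (- x ^- 2).
    rewrite (_ : - x ^- 2 = - x ^- 2 *: 1); last by rewrite /GRing.scale/= mulr1.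
    by apply: is_deriveV; rewrite gt_eqF.
  have dp : is_derive x 1 (fun y : R => p.[y^-1]) (p^`().[x^-1] * - x ^- 2).
    exact: (@is_derive1_comp _ (horner p) (fun y => y^-1)).
  have de : is_derive x 1 (fun y : R => expR (- (c / y)))
      (expR (- (c / x)) * (c * x ^- 2)).
    apply: (@is_derive1_comp _ expR (fun y => - (c / y))).
    rewrite (_ : c * _ = - (c *: - x ^- 2)); last by rewrite scalerN opprK.
    by apply: is_deriveN; apply: is_deriveZ.
  have := is_deriveM dp de.
  rewrite /GRing.scale /=; suff -> : flat c (dflat c p) x =
    p.[x^-1] * (expR (- (c / x)) * (c / x ^+ 2)) +
    expR (- (c / x)) * (p^`().[x^-1] * - x ^- 2) by [].
  by rewrite /flat x0 /dflat hornerM hornerXn hornerD hornerN hornerZ exprVn; ring.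
- apply: (@near_eq_is_derive _ _ _ (cst 0)).
    near=> y; rewrite /flat ifF//; apply/negbTE; rewrite -leNgt ltW//.
    by near: y; exact: lt_nbhsl.
  by rewrite /flat ltNge (ltW x0)/=; exact: is_derive_cst.
- rewrite -x0 {2}/flat ltxx.
  (* For [h > 0] the difference quotient at 0 is [h] times the bounded function [flat c ('X^2 * p)];
     for [h < 0] it is 0. *)
  have [M M0 HM] := flat_bounded ('X^2 * p) c0.
  suff H : h^-1 *: ((flat c p \o shift 0) (h *: 1) - flat c p 0) @[h --> 0^'] --> 0.
    apply: DeriveDef; first by apply/cvg_ex; exists 0; exact: H.
    by rewrite /derive; exact: cvg_lim.
  apply/cvgr0Pnorm_le => e e0; near=> h.
  have h0 : h != 0 by near: h; exact: nbhs_dnbhs_neq.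
  rewrite /= /flat ltxx subr0 addr0 /GRing.scale /= mulr1.
  case: ifPn => hgt0; last by rewrite mulr0 normr0 ltW.
  apply: (@le_trans _ _ (h * M)).
    rewrite (_ : h^-1 * _ = h * flat c ('X^2 * p) h).
      by rewrite normrM (gtr0_norm hgt0)// ler_pM2l.
    by rewrite /flat hgt0 hornerM hornerXn exprVn; field.
  rewrite -ler_pdivlMr//; apply: (le_trans (ler_norm _)).
  near: h; apply: dnbhs0_le; exact: divr_gt0.
Unshelve. all: by end_near. Qed.

Lemma smooth_flat c p (s t : R) : 0 < c -> smooth (fun x => flat c p (s * x + t)).
Proof.
move=> c0; pose S := [set f : R -> R | exists q, f = fun x => flat c q (s * x + t)].
apply: (smooth_stable (S := S)); last by exists p.
have H q (x : R) : is_derive x 1 (fun x => flat c q (s * x + t))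
    (flat c (s *: dflat c q) (s * x + t)).
  have -> : flat c (s *: dflat c q) (s * x + t) = flat c (dflat c q) (s * x + t) * s.
    by rewrite /flat; case: ifP => _; rewrite ?mul0r// hornerZ; lra.
  apply: (@is_derive1_comp _ (flat c q) (fun x => s * x + t)).
    exact: is_derive_flat.
  have h1 : is_derive x 1 (s \*: (id : R -> R)) (s *: 1) by exact: is_deriveZ.
  have h2 : is_derive x 1 (cst t : R -> R) 0 by exact: is_derive_cst.
  by have := is_deriveD h1 h2; rewrite addr0 /GRing.scale/= mulr1.
move=> _ [q ->]; split=> [x|]; first by have [] := H q x.
by exists (s *: dflat c q); apply/funext => x; exact: (derive1_eq (H q x)).
Qed.

End flat_function.

(** * Pairing a monotone function with the derivative of a bump *)

Section integration_by_parts_monotone.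
Context (R : realType).
Variables (psi g phi : R -> R) (M : R).
Hypothesis dpsi : forall x : R, is_derive x 1 psi (g x).
Hypothesis cg : continuous g.
Hypothesis gM : forall x, `|g x| <= M.
Hypothesis phi_nd : {homo phi : s t / s <= t}.
Local Notation lambda := (@lebesgue_measure R).

Lemma integrable_monotoneM (G : R -> R) (s t : R) : {homo G : x y / x <= y} ->
  lambda.-integrable `[s, t] (EFin \o (fun x => G x * g x)).
Proof.
move=> ndG; apply: measurable_bounded_integrable => //=.
- by rewrite lebesgue_measure_itv/=; case: ifPn => _; rewrite ?ltry// -EFinB ltry.
- apply: measurable_funTS; apply: measurable_funM.
    exact: nondecreasing_measurable.
  exact: continuous_measurable_fun.
- exists ((`|G s| + `|G t|) * M); split; first exact: num_real.
  move=> x hx y /=; rewrite in_itv/= => /andP[sy yt].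
  apply: le_trans (ltW hx); rewrite normrM; apply: ler_pM => //.
  rewrite ler_norml; apply/andP; split.
    rewrite (le_trans _ (ndG _ _ sy))// lerNl.
    by apply: le_trans (_ : `|G s| <= _); rewrite ?lerDl// -normrN ler_norm.
  by rewrite (le_trans (ndG _ _ yt))// (le_trans (ler_norm _))// lerDr.
Qed.

Let J (G : R -> R) (s t : R) := \int[lambda]_(x in `[s, t]) (G x * g x).

Let J_split G (s m t : R) : {homo G : x y / x <= y} -> s <= m -> m <= t ->
  J G s t = J G s m + J G m t.
Proof.
move=> ndG sm mt; apply/eqP; rewrite addrC -subr_eq; apply/eqP.
rewrite /J (Rintegral_itvB (x := m)) ?bnd_simp//; last exact: integrable_monotoneM.
apply: Rintegral_itv_obnd_cbnd.
apply: integrableS (integrable_monotoneM s t ndG) => //.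
by apply: subset_itv; rewrite bnd_simp.
Qed.

Let J_cst k (s t : R) : s <= t -> J (fun=> k) s t = k * (psi t - psi s).
Proof.
rewrite le_eqVlt => /predU1P[->|st].
  by rewrite /J subrr mulr0 set_itv1 Rintegral_set1.
have ig := @integrable_monotoneM (fun=> 1) s t (fun _ _ _ => lexx _).
have {}ig : lambda.-integrable `[s, t] (EFin \o g).
  by apply: eq_integrable ig => // x _ /=; rewrite mul1r.
rewrite /J RintegralZl//; congr (_ * _); rewrite /Rintegral.
rewrite (@continuous_FTC2 _ g psi)//.
- exact: continuous_subspaceT.
- have cpsi : continuous psi.
    by move=> x; apply/differentiable_continuous/derivable1_diffP; have [] := dpsi x.
  split.
  + by move=> x _; have [] := dpsi x.
  + by apply: cvg_at_right_filter; exact: cpsi.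
  + by apply: cvg_at_left_filter; exact: cpsi.
- by move=> x _; exact: derive1_eq.
Qed.

Let J_le G G' (s t : R) : {homo G : x y / x <= y} -> {homo G' : x y / x <= y} ->
  (forall x, s <= x -> x <= t -> G x * g x <= G' x * g x) -> J G s t <= J G' s t.
Proof.
move=> ndG ndG' h; apply: le_Rintegral => //; try exact: integrable_monotoneM.
by move=> x /=; rewrite in_itv/= => /andP[]; exact: h.
Qed.

Variables (a m b : R).
Hypotheses (am : a < m) (mb : m < b).
Hypothesis g_inc : forall x, x <= m -> 0 <= g x.
Hypothesis g_dec : forall x, m <= x -> g x <= 0.
Hypothesis g_out : forall x, ~~ (a <= x <= b) -> g x = 0.
Hypotheses (psia : psi a = 0) (psib : psi b = 0).

Let JE : (\int[lambda]_x (phi x * g x)%:E = (J phi a b)%:E)%E.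
Proof.
transitivity (\int[lambda]_(x in `[a, b]) (phi x * g x)%:E)%E.
  rewrite [RHS]integral_mkcond; apply: eq_integral => x _.
  rewrite patchE; case: ifPn => // /negP xab; rewrite g_out ?mulr0//.
  by apply/negP => h; apply: xab; rewrite inE/= in_itv.
rewrite -[LHS]fineK//; apply: integrable_fin_num => //.
exact: (integrable_monotoneM a b phi_nd).
Qed.

(** [phi] may jump, so it is replaced by constants, for which the fundamental theorem applied to
    [psi] suffices: [phi a] before the peak [m], where [g >= 0], and [phi b] after it, where
    [g <= 0]. *)
Lemma integral_monotone_derive_le :
  (- (\int[lambda]_x (phi x * g x)%:E) <= ((phi b - phi a) * psi m)%:E)%E.
Proof.
rewrite JE -EFinN lee_fin (J_split phi_nd (ltW am) (ltW mb)).
rewrite lerNl.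
have h1 : phi a * psi m <= J phi a m.
  rewrite -[psi m]subr0 -psia -(J_cst _ (ltW am)); apply: J_le => // x ax xm.
  by apply: ler_wpM2r; [exact: g_inc|exact: phi_nd].
have h2 : phi b * - psi m <= J phi m b.
  rewrite -[- psi m]add0r -psib -(J_cst _ (ltW mb)); apply: J_le => // x mx xb.
  by apply: ler_wnM2r; [exact: g_dec|exact: phi_nd].
apply: le_trans (lerD h1 h2); lra.
Qed.

(** On [[a, a']] and [[b', b]] the constants are [phi a'] and [phi b']. In between,
    [phi x * g x <= phi m * g x] on both sides of the peak, and the right-hand side integrates to 0
    because [psi a' = psi b']. *)
Lemma integral_monotone_derive_ge (a' b' : R) : a <= a' -> a' <= m -> m <= b' ->
  b' <= b -> psi a' = psi b' ->
  (((phi b' - phi a') * psi a')%:E <= - \int[lambda]_x (phi x * g x)%:E)%E.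
Proof.
move=> aa' a'm mb' b'b psiab.
rewrite JE -EFinN lee_fin (J_split phi_nd aa' (le_trans a'm (ltW mb))).
rewrite (J_split phi_nd (le_trans a'm mb') b'b).
rewrite lerNr.
have h1 : J phi a a' <= phi a' * psi a'.
  rewrite -[psi a']subr0 -psia -J_cst//; apply: J_le => // x ax xa'.
  by apply: ler_wpM2r; [apply: g_inc; exact: le_trans a'm|exact: phi_nd].
have h2 : J phi b' b <= phi b' * - psi b'.
  rewrite -[- psi b']add0r -psib -J_cst//; apply: J_le => // x b'x xb.
  by apply: ler_wnM2r; [apply: g_dec; exact: le_trans b'x|exact: phi_nd].
have h3 : J phi a' b' <= 0.
  rewrite -[leRHS](mulr0 (phi m)) -(subrr (psi b')) -{2}psiab -J_cst ?(le_trans a'm)//.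
  apply: J_le => // x a'x xb'; have [xm|mx] := leP x m.
    by apply: ler_wpM2r; [exact: g_inc|exact: phi_nd].
  by apply: ler_wnM2r; [apply: g_dec; exact: ltW|apply: phi_nd; exact: ltW].
apply: le_trans (lerD h1 (lerD h3 h2)) _; rewrite -psiab; lra.
Qed.

End integration_by_parts_monotone.

Section bump.
Context (R : realType).
Variables (a b : R).
Hypothesis ab : a < b.
Let m := (a + b) / 2.

(** As [c] decreases to 0, these functions increase to the indicator of []a, b[]. *)
Definition bump c (x : R) : R := flat c 1 (x - a) * flat c 1 (b - x).

Definition dbump c (x : R) : R :=
  flat c (dflat c 1) (x - a) * flat c 1 (b - x) -
  flat c 1 (x - a) * flat c (dflat c 1) (b - x).

Lemma bumpE c x : bump c x =
  if a < x < b then expR (- (c * ((x - a)^-1 + (b - x)^-1))) else 0.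
Proof.
rewrite /bump /flat !subr_gt0; case: ltP => _ /=; last by rewrite mul0r.
case: ltP => _; last by rewrite mulr0.
by rewrite -polyC1 !hornerC !mul1r -expRD -opprD -mulrDr.
Qed.

Lemma bump_ge0 c x : 0 <= bump c x.
Proof. by rewrite bumpE; case: ifPn => // _; exact: expR_ge0. Qed.

Lemma bump_le1 c x : 0 <= c -> bump c x <= 1.
Proof.
move=> c0; rewrite bumpE; case: ifPn => // /andP[ax xb].
rewrite -[leRHS]expR0 ler_expR oppr_le0 mulr_ge0// addr_ge0// invr_ge0 subr_ge0 ltW//.
Qed.

(** Provides the two points of equal height that [integral_monotone_derive_ge] asks for. *)
Lemma bump_symmetric c x : bump c (a + x) = bump c (b - x).
Proof.
by rewrite /bump mulrC; congr (flat c 1 _ * flat c 1 _); lra.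
Qed.

Section derivative.
Variable c : R.
Hypothesis c0 : 0 < c.

Lemma smooth_bump : smooth (bump c).
Proof.
suff -> : bump c = (fun x => flat c 1 (1 * x - a)) * (fun x => flat c 1 (-1 * x + b)).
  by apply: smoothM; exact: smooth_flat.
apply/funext => x; rewrite mulrfctE /bump.
by rewrite mul1r mulN1r (addrC _ b).
Qed.

Lemma is_derive_bump (x : R) : is_derive x 1 (bump c) (dbump c x).
Proof.
have h1 : is_derive x 1 (fun y => flat c 1 (y - a)) (flat c (dflat c 1) (x - a)).
  rewrite -[X in is_derive _ _ _ X]mulr1.
  apply: (@is_derive1_comp _ (flat c 1) (fun y => y - a)); first exact: is_derive_flat.
  rewrite -[X in is_derive _ _ _ X]addr0.
  exact: (@is_deriveD _ _ _ id (cst (- a))).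
have h2 : is_derive x 1 (fun y => flat c 1 (b - y)) (- flat c (dflat c 1) (b - x)).
  rewrite -mulrN1.
  apply: (@is_derive1_comp _ (flat c 1) (fun y => b - y)); first exact: is_derive_flat.
  rewrite -[X in is_derive _ _ _ X]add0r.
  exact: (@is_deriveD _ _ _ (cst b) (fun y => - y)).
have := is_deriveM h1 h2; rewrite /GRing.scale/=.
suff -> : dbump c x = flat c 1 (x - a) * - flat c (dflat c 1) (b - x) +
  flat c 1 (b - x) * flat c (dflat c 1) (x - a) by [].
by rewrite /dbump; ring.
Qed.

Lemma derive1_bump : derive1 (bump c) = dbump c.
Proof. by apply/funext => x; exact/derive1_eq/is_derive_bump. Qed.

Lemma continuous_dbump : continuous (dbump c).
Proof.
rewrite -derive1_bump => x.
apply/differentiable_continuous/derivable1_diffP.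
exact/smooth_derivable/smooth_derive1/smooth_bump.
Qed.

Lemma dbump_bounded : exists M, forall x, `|dbump c x| <= M.
Proof.
have [M1 M10 h1] := flat_bounded 1 c0; have [M2 M20 h2] := flat_bounded (dflat c 1) c0.
exists (M2 * M1 + M1 * M2) => x; rewrite (le_trans (ler_normB _ _))// !normrM.
by rewrite lerD// ler_pM.
Qed.

Lemma dbump_out x : ~~ (a <= x <= b) -> dbump c x = 0.
Proof.
rewrite negb_and -!ltNge /dbump /flat !subr_gt0 => /orP[xa|bx].
  by rewrite ltNge (ltW xa)/= !mul0r subr0.
by rewrite [x < b]ltNge (ltW bx)/= !mulr0 subr0.
Qed.

Let flat_d x : flat c (dflat c 1) x = c * x ^- 2 * flat c 1 x.
Proof.
rewrite /flat; case: ifP => _; last by rewrite mulr0.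
by rewrite /dflat derivC subr0 hornerM hornerXn hornerZ hornerC exprVn; ring.
Qed.

(** Inside []a, b[] the bracket changes sign exactly at the midpoint, which is therefore the peak of
    the bump. *)
Let dbump_factor x :
  dbump c x = c * ((x - a) ^- 2 - (b - x) ^- 2) * bump c x.
Proof. by rewrite /dbump !flat_d /bump; ring. Qed.

Lemma dbump_ge0 x : x <= m -> 0 <= dbump c x.
Proof.
move=> xm; have [ax|xa] := ltP a x; last first.
  by rewrite /dbump !flat_d [flat _ _ (x - a)]/flat subr_gt0 ltNge xa/= !(mulr0, mul0r) subr0.
rewrite dbump_factor mulr_ge0// ?bump_ge0//.
rewrite mulr_ge0 ?(ltW c0)// subr_ge0 lef_pV2 ?posrE ?exprn_gt0 ?subr_gt0//.
  by rewrite ler_sqr ?nnegrE; rewrite /m in xm; lra.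
by rewrite /m in xm; lra.
Qed.

Lemma dbump_le0 x : m <= x -> dbump c x <= 0.
Proof.
move=> mx; have [xb|bx] := ltP x b; last first.
  by rewrite /dbump !flat_d [flat _ _ (b - x)]/flat subr_gt0 ltNge bx/= !(mulr0, mul0r) subr0.
rewrite dbump_factor mulr_le0_ge0// ?bump_ge0//.
rewrite mulr_ge0_le0 ?(ltW c0)// subr_le0 lef_pV2 ?posrE ?exprn_gt0 ?subr_gt0//.
  by rewrite ler_sqr ?nnegrE; rewrite /m in mx; lra.
by rewrite /m in mx; lra.
Qed.

Lemma test_function_bump : test_function (bump c).
Proof.
split; first exact: smooth_bump.
have sub : closure [set x | bump c x != 0] `<=` `[a, b]%classic.
  rewrite [X in _ `<=` X](proj1 (closure_id `[a, b]%classic)); last exact: itv_closed.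
  apply: closure_subset => x /=; rewrite bumpE in_itv/=.
  by case: ifPn; [move=> /andP[/ltW -> /ltW ->]|rewrite eqxx].
by apply: subclosed_compact sub; [exact: closed_closure|exact: segment_compact].
Qed.

End derivative.
End bump.

(** * Masses of intervals under the distributional derivative *)

Section distributional_derivative_of_monotone.
Context (R : realType).
Variables (phi : R -> R) (mu : {measure set (measurableTypeR R) -> \bar R}).
Hypothesis phi_nd : {homo phi : s t / s <= t}.
Hypothesis phi_mu : distributional_derivative phi mu.
Local Notation lambda := (@lebesgue_measure R).

Let measurable_bump (a b c : R) : 0 < c -> measurable_fun [set: R] (bump a b c).
Proof.
move=> c0; apply: continuous_measurable_fun => x.
by apply/differentiable_continuous/derivable1_diffP; have [] := is_derive_bump a b c0 x.
Qed.

(** The bumps with [c n = harmonic n] are at most 1, so each pairing is at most [phi b - phi a];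
    monotone convergence then gives the mass of the interval. *)
Lemma distributional_derivative_oo_le (a b : R) : a < b ->
  (mu `]a, b[%classic <= (phi b - phi a)%:E)%E.
Proof.
move=> ab; pose c n : R := harmonic n.
have c0 n : 0 < c n by exact: harmonic_gt0.
have am : a < (a + b) / 2 by rewrite midf_lt.
have mb : (a + b) / 2 < b by rewrite midf_lt.
have ba k : bump a b k a = 0 by rewrite bumpE ltxx.
have bb k : bump a b k b = 0 by rewrite bumpE ltxx andbF.
have h n : (\int[mu]_x (bump a b (c n) x)%:E <= (phi b - phi a)%:E)%E.
  rewrite (phi_mu (test_function_bump a b (c0 n))).
  have [M HM] := dbump_bounded a b (c0 n).
  rewrite derive1_bump//.
  have := integral_monotone_derive_le (is_derive_bump a b (c0 n))
    (@continuous_dbump _ a b _ (c0 n)) HM phi_nd am mb (@dbump_ge0 _ a b _ (c0 n))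
    (@dbump_le0 _ a b _ (c0 n)) (@dbump_out _ a b (c n)) (ba _) (bb _).
  move=> /le_trans -> //; rewrite lee_fin ler_piMr ?subr_ge0 ?phi_nd ?(ltW ab)//.
  by rewrite bump_le1// ltW.
have -> : mu `]a, b[%classic = (\int[mu]_x (\1_(`]a, b[%classic) x)%:E)%E.
  by rewrite integral_indic//= setIT.
have cvgE x : (fun n => (bump a b (c n) x)%:E) @ \oo --> (\1_(`]a, b[%classic) x : R)%:E.
  apply: cvg_EFin; first exact: nearW.
  under eq_fun do rewrite /= bumpE.
  rewrite indicE mem_setE in_itv/=; case: (a < x < b); last exact: cvg_cst.
  set k := _ + (b - x)^-1.
  have : - (c n * k) @[n --> \oo] --> - (0 * k).
    by apply: cvgN; apply: cvgMr_tmp; exact: cvg_harmonic.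
  rewrite mul0r oppr0 => H.
  rewrite -(expR0 R); apply: (@continuous_cvg _ _ _ _ _ (fun n => - (c n * k)) expR) => //.
  exact: continuous_expR.
have -> : (\int[mu]_x (\1_(`]a, b[%classic) x)%:E =
    \int[mu]_x limn (fun n => (bump a b (c n) x)%:E))%E.
  by apply: eq_integral => x _; apply/esym/cvg_lim.
rewrite monotone_convergence//; last 3 first.
- by move=> n; apply/measurable_EFinP; exact: measurable_bump.
- by move=> n x _; rewrite lee_fin bump_ge0.
- move=> x _ i j ij; rewrite lee_fin !bumpE; case: ifPn => // /andP[ax xb].
  rewrite ler_expR lerN2 ler_wpM2r// ?addr_ge0 ?invr_ge0 ?subr_ge0 ?(ltW ax) ?(ltW xb)//.
  by rewrite /c /= lef_pV2 ?posrE ?ltr0n// ler_nat.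
apply: lime_le; last exact: nearW.
apply: ereal_nondecreasing_is_cvgn => i j ij; apply: le_integral_nonneg => x _.
  by rewrite lee_fin bump_ge0.
rewrite lee_fin !bumpE; case: ifPn => // /andP[ax xb].
rewrite ler_expR lerN2 ler_wpM2r// ?addr_ge0 ?invr_ge0 ?subr_ge0 ?(ltW ax) ?(ltW xb)//.
by rewrite /c /= lef_pV2 ?posrE ?ltr0n// ler_nat.
Qed.

(** Bumps lie below the indicator of []a, b[]. The points [a'] and [b'] are strictly inside because
    jumps of [phi] at [a] and [b] need not be charged to the open interval. *)
Lemma distributional_derivative_oo_ge (a a' b' b : R) :
  a < a' -> a' <= b' -> b' < b -> ((phi b' - phi a')%:E <= mu `]a, b[%classic)%E.
Proof.
move=> aa' ab' b'b; have ab : a < b := lt_le_trans aa' (le_trans ab' (ltW b'b)).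
pose m := (a + b) / 2.
have am : a < m by rewrite midf_lt.
have mb : m < b by rewrite midf_lt.
have mE : m + m = a + b by rewrite /m; lra.
(* The symmetric points [a + e] and [b - e] must enclose [[a', b']] and lie on either side of the
   peak. *)
pose e := Num.min (Num.min (a' - a) (b - b')) (m - a).
have [e0 e1 e2 e3] : [/\ 0 < e, e <= a' - a, e <= b - b' & e <= m - a].
  by rewrite /e !lt_min !ge_min !lexx/= ?orbT !subr_gt0 aa' b'b/=.
have ae : a + e <= m by rewrite -lerBrDl.
have be : m <= b - e by rewrite lerBrDr; move: ae mE; clear; lra.
have aeb : a < a + e < b by rewrite ltrDl e0 (le_lt_trans ae).
have K0 : 0 <= phi b' - phi a' by rewrite subr_ge0 phi_nd.
have C0 : 0 <= e^-1 + (b - (a + e))^-1.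
  by rewrite addr_ge0// invr_ge0 ?subr_ge0 ltW//; case/andP: aeb.
set C := e^-1 + _ in C0.
(* [C] is the exponent of the bump at [a + e] per unit of [c], and [expR y >= 1 + y] bounds the
   height there from below by [1 - c * C]. *)
have h c : 0 < c -> (((phi b' - phi a') * (1 - c * C))%:E <= mu `]a, b[%classic)%E.
  move=> c0; apply: (@le_trans _ _ (\int[mu]_x (bump a b c x)%:E)%E); last first.
    have <- : (\int[mu]_x (\1_(`]a, b[%classic) x)%:E)%E = mu `]a, b[%classic.
      by rewrite integral_indic//= setIT.
    apply: le_integral_nonneg => x _; first by rewrite lee_fin bump_ge0.
    rewrite lee_fin indicE mem_setE in_itv/=; case axb: (a < x < b).
      by rewrite bump_le1// ltW.
    by rewrite bumpE axb.
  rewrite (phi_mu (test_function_bump a b c0)) derive1_bump//.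
  have [M HM] := dbump_bounded a b c0.
  have ba : bump a b c a = 0 by rewrite bumpE ltxx.
  have bb : bump a b c b = 0 by rewrite bumpE ltxx andbF.
  have ha : a <= a + e by rewrite lerDl ltW.
  have hb : b - e <= b by rewrite gerBl ltW.
  have := integral_monotone_derive_ge (is_derive_bump a b c0)
    (@continuous_dbump _ a b _ c0) HM phi_nd mb (@dbump_ge0 _ a b _ c0)
    (@dbump_le0 _ a b _ c0) (@dbump_out _ a b c) ba bb ha ae be hb
    (bump_symmetric a b c e).
  apply: le_trans; rewrite lee_fin (@le_trans _ _ ((phi b' - phi a') * bump a b c (a + e)))//.
    apply: ler_wpM2l => //; rewrite bumpE aeb addrAC subrr add0r.
    by apply: le_trans (expR_ge1Dx _).
  apply: ler_wpM2r; first exact: bump_ge0.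
  rewrite lerB// phi_nd//; first by rewrite lerBrDr -lerBrDl.
  by rewrite -lerBrDl.
have : (0 <= mu `]a, b[%classic)%E by [].
move: (mu _) h => [r| |] h r0; [|by rewrite leey|by move: r0; rewrite leeNy_eq].
rewrite lee_fin leNgt; apply/negP => rK.
pose K := phi b' - phi a'; have KC : 0 <= K * C by rewrite mulr_ge0.
(* Were the mass [r] smaller than [K], this value of [c] would make [K * (1 - c * C)] exceed [r];
   the summand 1 keeps the denominator positive. *)
have c0 : 0 < (K - r) / (K * C + 1).
  by rewrite divr_gt0 ?subr_gt0// ltr_wpDl.
have Kr : 0 < K - r by rewrite subr_gt0.
have : K * C / (K * C + 1) < 1 by rewrite ltr_pdivrMr ?ltr_wpDl// mul1r ltrDl.
rewrite -(ltr_pM2l Kr) mulr1 => lt1.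
have := h _ c0; rewrite lee_fin -/K.
have -> : K * (1 - (K - r) / (K * C + 1) * C) = K - (K - r) * (K * C / (K * C + 1)).
  by ring.
by move: lt1; clear; lra.
Qed.

Lemma distributional_derivative_oc_fin (a b : R) : a < b ->
  (mu `]a, b]%classic < +oo)%E.
Proof.
move=> ab; have ab1 : a < b + 1 by rewrite (lt_le_trans ab)// lerDl.
apply: le_lt_trans (ltry (phi (b + 1) - phi a)).
apply: le_trans (distributional_derivative_oo_le ab1).
apply: le_measure; rewrite ?inE//.
by apply: subset_itv; rewrite bnd_simp// ltrDl.
Qed.

(** []a, b]] is the intersection of the open intervals up to [b + n.+1%:R^-1], whose masses are
    finite. The right end may be reached since the jump at [b] is charged to []a, b]]; the one at
    [a] is not, hence [a < s]. *)
Lemma distributional_derivative_oc_ge (a b s t : R) :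
  a < s -> s <= t -> t <= b -> ((phi t - phi s)%:E <= mu `]a, b]%classic)%E.
Proof.
move=> as_ st tb; have ab : a < b := lt_le_trans as_ (le_trans st tb).
pose F n := `]a, (b + n.+1%:R^-1)[%classic : set (measurableTypeR R).
have F0 : (mu (F 0%N) < +oo)%E.
  apply: le_lt_trans (@distributional_derivative_oc_fin a (b + 1) _); last first.
    by rewrite (lt_le_trans ab)// lerDl.
  apply: le_measure; rewrite ?inE; [exact: measurable_itv|exact: measurable_itv|].
  by rewrite /F invr1; apply: subset_itv; rewrite bnd_simp.
have FE : \bigcap_n F n = `]a, b]%classic.
  apply/seteqP; split => [x Fx|x /= /[!in_itv]/= /andP[ax xb] n _]; last first.
    by rewrite /F /= in_itv/= ax (le_lt_trans xb)// ltrDl.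
  have := Fx 0%N I; rewrite /F /= !in_itv/= => /andP[-> _]/=.
  rewrite leNgt; apply/negP => bx.
  have xb0 : 0 < x - b by rewrite subr_gt0.
  have := Fx (Num.trunc (x - b)^-1) I; rewrite /F /= in_itv/= => /andP[_].
  apply/negP; rewrite -leNgt -lerBrDl -[leRHS]invrK lef_pV2 ?posrE ?invr_gt0//.
  exact/ltW/truncnS_gt.
have mF n : measurable (F n) by exact: measurable_itv.
have ndF : nonincreasing_seq F.
  move=> i j ij; rewrite subsetEset; apply: subset_itv; rewrite bnd_simp//.
  by rewrite lerD2l lef_pV2 ?posrE ?ltr0n// ler_nat.
have := nonincreasing_cvg_mu F0 mF (bigcapT_measurable mF) ndF.
rewrite FE => cvgF; rewrite -(cvg_lim _ cvgF)//.
apply: lime_ge; first by apply/cvg_ex; eexists; exact: cvgF.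
apply: nearW => n; apply: distributional_derivative_oo_ge => //.
by rewrite (le_lt_trans tb)// ltrDl.
Qed.

End distributional_derivative_of_monotone.

(** * Chain rule along a monotone function *)

Section borel_functions_of_extended_reals.
Context (R : realType).

Lemma extend_er_map (phi : R -> R) : extend phi = er_map phi.
Proof. by apply/funext => -[]. Qed.

Lemma measurable_extend (phi : R -> R) :
  {homo phi : s t / s <= t} -> measurable_fun setT (extend phi).
Proof.
move=> phi_nd; rewrite extend_er_map.
apply: (@measurable_er_map _ (measurableTypeR R)).
exact: nondecreasing_measurable.
Qed.

Lemma le_extend (phi : R -> R) : {homo phi : s t / s <= t} ->
  {homo extend phi : x y / (x <= y)%E}.
Proof.
move=> phi_nd [x| |] [y| |] //=; rewrite ?leey ?leNye//.
by rewrite !lee_fin; exact: phi_nd.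
Qed.

Variable g : R -> \bar R.
Hypotheses (mg : measurable_fun setT g) (g0 : forall x, (0 <= g x)%E).

Lemma measurable_extend_derivative : measurable_fun setT (extend_derivative g).
Proof.
rewrite (_ : extend_derivative _ =
  fun x => if x \is a fin_num then g (fine x) else +oo%E); last first.
  by apply: funext => -[].
apply: measurable_fun_ifT => //=.
  by apply: (measurable_fun_bool true); exact/emeasurable_fin_num.
exact: measurableT_comp.
Qed.

Lemma extend_derivative_ge0 x : (0 <= extend_derivative g x)%E.
Proof. by case: x => [r| |] //=; exact: leey. Qed.

(* Vanishes where [extend_derivative g] is [0] or [+oo], since [0^-1 = 0] and
   [fine +oo = 0]. *)
Definition inverse_derivative (x : \bar R) : \bar R :=
  ((fine (extend_derivative g x))^-1)%:E.

Lemma inverse_derivative_ge0 x : (0 <= inverse_derivative x)%E.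
Proof. by rewrite lee_fin invr_ge0 fine_ge0// extend_derivative_ge0. Qed.

Lemma measurable_inverse_derivative : measurable_fun setT inverse_derivative.
Proof.
apply/measurable_EFinP; rewrite (_ : (fun _ => _) =
    fun x => fine (extend_derivative g x) `^ (-1)); last first.
  by apply/funext => x; rewrite powR_inv1// fine_ge0// extend_derivative_ge0.
apply: (measurableT_comp (measurable_powR (-1))).
exact: measurableT_comp measurable_extend_derivative.
Qed.

End borel_functions_of_extended_reals.

Section chain_rule_along_a_monotone_function.
Local Open Scope ereal_scope.
Context (R : realType).
Variables (phi : R -> R) (g : R -> \bar R).
Hypothesis phi_nd : {homo phi : s t / (s <= t)%R}.
Hypothesis phi_g : is_ac_derivative phi g.
Variables (u v : R -> \bar R).
Hypothesis u_nd : {homo u : s t / (s <= t)%R >-> s <= t}.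
Hypotheses (mv : measurable_fun setT v) (v0 : forall x, 0 <= v x).
Local Notation lambda := (@lebesgue_measure R).

(** With the convention that equal infinities differ by [+oo], upper bounds by an increment are
    trivial unless both ends are finite. *)
Lemma subx_monotone_dichotomy (x y : \bar R) : x <= y ->
  subx y x = +oo \/ exists r s : R, [/\ x = r%:E, y = s%:E & (r <= s)%R].
Proof.
case: x y => [r| |] [s| |] //=; try by left.
by rewrite lee_fin => rs; right; exists r, s.
Qed.

(** Stated for rational times so that it can hold along almost every curve, as a countable
    conjunction. *)
Definition increments_dominate (w : R -> \bar R) :=
  forall p q : rat, (0 <= ratr p :> R)%R -> (ratr p < ratr q :> R)%R ->
    (ratr q <= 1 :> R)%R ->
    \int[lambda]_(t in `[ratr p, ratr q]) v t <= subx (w (ratr q)) (w (ratr p)).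

Lemma increments_dominate_lebesgue : increments_dominate u ->
  forall B : set (measurableTypeR R), measurable B ->
  \int[lambda]_(t in `[0%R, 1%R] `&` u @^-1` (EFin @` B)) v t <= lambda B.
Proof.
have lambda_oc (a b : R) : (a < b)%R -> lambda `]a, b]%classic = (b - a)%:E.
  by move=> ab; rewrite lebesgue_measure_itv/= lte_fin ab.
move=> H; apply: integral_preimage_le => // a b.
  by move=> ab; rewrite [X in X < _]lambda_oc// ltry.
move=> p q ab p0 pq q1 aup uqb; apply: le_trans (H p q p0 pq q1) _.
rewrite [leRHS]lambda_oc//.
have := u_nd (ltW pq).
move: (u (ratr p)) (u (ratr q)) aup uqb => [r| |] [s| |] //=; rewrite ?lee_fin ?lte_fin.
by move=> *; lra.
Qed.

(** The strict inequality [a < u (ratr p)] and the weak one at [b] are exactly those that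
    [distributional_derivative_oc_ge] accepts. *)
Lemma increments_dominate_derivative (mu : {measure set (measurableTypeR R) -> \bar R}) :
  distributional_derivative phi mu -> increments_dominate (extend phi \o u) ->
  forall B : set (measurableTypeR R), measurable B ->
  \int[lambda]_(t in `[0%R, 1%R] `&` u @^-1` (EFin @` B)) v t <= mu B.
Proof.
move=> phi_mu H; apply: integral_preimage_le => //.
  by move=> a b ab; apply: distributional_derivative_oc_fin phi_mu _ _ ab.
move=> a b p q ab p0 pq q1 aup uqb; apply: le_trans (H p q p0 pq q1) _.
have := u_nd (ltW pq); rewrite /=.
move: (u (ratr p)) (u (ratr q)) aup uqb => [r| |] [s| |] //=; rewrite ?lee_fin ?lte_fin.
by move=> ? ? ?; apply: distributional_derivative_oc_ge.
Qed.

Let mu_ := nondecreasing_emeasurable u_nd.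

Let mfu : measurable_fun setT (fine \o u : R -> R).
Proof. exact: measurableT_comp. Qed.

Lemma chain_rule_ge : increments_dominate u ->
  \int[lambda]_(t in `[0%R, 1%R]) (extend_derivative g (u t) * v t) <=
  subx (extend phi (u 1%R)) (extend phi (u 0%R)).
Proof.
move=> H; have u01 : u 0%R <= u 1%R by exact: u_nd.
have [->|] := subx_monotone_dichotomy (le_extend phi_nd u01); first exact: leey.
(* [extend phi] fixes the infinities, so if it is finite at both end values, then so is [u]. *)
have [uoo|[r0 [r1 [u0 u1 r01]]] _] := subx_monotone_dichotomy u01.
  by move: uoo; case: (u 0%R) (u 1%R) => [?| |] [?| |] //= _ [? [? []]].
have u_r t : (0 <= t)%R -> (t <= 1)%R ->
    exists r, [/\ u t = r%:E, (r0 <= r)%R & (r <= r1)%R].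
  move=> t0 t1; move: (u_nd t0) (u_nd t1); rewrite u0 u1.
  by case: (u t) => [r| |] //; rewrite !lee_fin => *; exists r.
have [mg g0 [mu [sigma [phi_mu muE _ _]]]] := phi_g.
rewrite u0 u1 /= -EFinB.
pose I : set (measurableTypeR R) := `[r0, r1]%classic.
have mI : measurable I by exact: measurable_itv.
have m1I : measurable_fun setT (fun x => (\1_I x : R)%:E).
  by apply/measurable_EFinP; exact: measurable_indic.
apply: (@le_trans _ _ (\int[lambda]_y (g y * (\1_I y)%:E))).
  have -> : \int[lambda]_(t in `[0%R, 1%R]) (extend_derivative g (u t) * v t) =
      \int[lambda]_(t in `[0%R, 1%R]) (g ((fine \o u) t) * v t).
    apply: eq_integral => t; rewrite inE/= in_itv/= => /andP[t0 t1].
    by have [r [-> _ _]] := u_r _ t0 t1.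
  apply: le_integral_comp => //.
  move=> B mB; rewrite (@integral_indic _ (measurableTypeR R))//.
  apply: le_trans (increments_dominate_lebesgue H (measurableI _ _ mI mB)).
  suff -> : `[0%R, 1%R]%classic `&` (fine \o u) @^-1` B =
    `[0%R, 1%R]%classic `&` u @^-1` (EFin @` (I `&` B)) by [].
  apply/seteqP; split => t [] /=; rewrite in_itv/= => /andP[t0 t1] b; (split; first by rewrite t0).
    have [r [ut r0r rr1]] := u_r _ t0 t1.
    exists r => //; split; first by rewrite /I /= in_itv/= r0r.
    by move: b; rewrite ut.
  by case: b => r [_ Br] <-.
have -> : \int[lambda]_y (g y * (\1_I y)%:E) = \int[lambda]_(y in I) g y.
  by rewrite [RHS]integral_mkcond epatch_indic.
have [r01e|ne] := eqVneq r0 r1.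
  by rewrite /I r01e set_itv1 integral_set1 subrr.
have r01' : (r0 < r1)%R by rewrite lt_neqAle ne.
(* The end points are dropped before comparing with [mu], which may have atoms there: only the mass
   of the open interval is at most [phi r1 - phi r0]. *)
rewrite /I (integral_itv_bndoo true false); last exact: measurable_funTS.
apply: le_trans (distributional_derivative_oo_le phi_nd phi_mu r01').
rewrite muE; last exact: measurable_itv.
by rewrite leeDl.
Qed.

(** The set [Z] where [g = 0] is [mu]-null: the density vanishes on it and [sigma] is carried by the
    set where [g = +oo]. *)
Lemma chain_rule_derivative0 : increments_dominate (extend phi \o u) ->
  \int[lambda]_(t in `[0%R, 1%R] `&` [set t | extend_derivative g (u t) = 0]) v t = 0.
Proof.
move=> H; have [mg g0 [mu [sigma [phi_mu muE _ sigma0]]]] := phi_g.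
have fin0 (x : \bar R) : extend_derivative g x = 0 -> exists2 r : R, g r = 0 & r%:E = x.
  by case: x => [r gr|/= h|/= h] //; exists r.
pose Z : set (measurableTypeR R) := [set x | g x = 0].
have mZ : measurable Z by rewrite -[Z]setTI; exact: (mg measurableT _ (emeasurable_set1 0)).
have muZ : mu Z = 0.
  rewrite muE// integral0_eq ?add0e; last by move=> x.
  apply/eqP; rewrite eq_le measure_ge0 andbT -sigma0; apply: le_measure; rewrite ?inE//.
    rewrite -[X in measurable X]setTI.
    exact: emeasurable_fun_infty_o.
  by move=> x /= ->.
apply/eqP; rewrite eq_le; apply/andP; split; last exact: integral_ge0.
rewrite -[leRHS]muZ; apply: le_trans (increments_dominate_derivative phi_mu H mZ).
rewrite le_eqVlt; apply/orP; left; apply/eqP; congr (integral _ _ _).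
apply/seteqP; split => t [t01 /= ut]; split => //.
  by have [r gr <-] := fin0 _ ut; exists r.
by case: ut => r gr <-.
Qed.

Lemma chain_rule_le : increments_dominate (extend phi \o u) ->
  \int[lambda]_(t in `[0%R, 1%R]) (inverse_derivative g (u t) * v t) <=
  subx (u 1%R) (u 0%R).
Proof.
move=> H; have u01 : u 0%R <= u 1%R by exact: u_nd.
have [->|[r0 [r1 [u0 u1 r01]]]] := subx_monotone_dichotomy u01; first exact: leey.
have u_r t : (0 <= t)%R -> (t <= 1)%R ->
    exists r, [/\ u t = r%:E, (r0 <= r)%R & (r <= r1)%R].
  move=> t0 t1; move: (u_nd t0) (u_nd t1); rewrite u0 u1.
  by case: (u t) => [r| |] //; rewrite !lee_fin => *; exists r.
have [mg g0 [mu [sigma [phi_mu muE _ sigma0]]]] := phi_g.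
rewrite u0 u1 /= -EFinB.
pose I : set (measurableTypeR R) := `[r0, r1]%classic.
have mI : measurable I by exact: measurable_itv.
pose F : set (measurableTypeR R) := [set x | g x < +oo].
have mF : measurable F.
  by rewrite -[F]setTI; exact: emeasurable_fun_infty_o.
(* On [F] the singular part vanishes, so the push-forward of [v dt] restricted to [F] has [gI] as a
   bounding density. *)
pose gI y := g y * (\1_(I `&` F) y)%:E.
have mgI : measurable_fun setT gI.
  apply: emeasurable_funM => //.
  by apply/measurable_EFinP; apply: measurable_indic; exact: measurableI.
have gI0 y : 0 <= gI y by rewrite mule_ge0// lee_fin.
pose k y := ((fine (g y))^-1)%:E.
have k0 y : 0 <= k y by rewrite lee_fin invr_ge0 fine_ge0.
have mk : measurable_fun setT k.
  exact: (measurableT_comp (measurable_inverse_derivative mg g0) (@EFin_measurable R setT)).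
pose D : set (measurableTypeR R) := `[0%R, 1%R]%classic `&` (fine \o u) @^-1` F.
have mD : measurable D.
  apply: measurableI; first exact: measurable_itv.
  by rewrite -[X in measurable X]setTI; exact: mfu.
have -> : \int[lambda]_(t in `[0%R, 1%R]) (inverse_derivative g (u t) * v t) =
    \int[lambda]_(t in D) (k ((fine \o u) t) * v t).
  rewrite [in RHS]integral_mkcondr; apply: eq_integral => t.
  rewrite inE/= in_itv/= => /andP[t0 t1].
  have [r [ur _ _]] := u_r _ t0 t1.
  rewrite patchE; case: ifPn => tD; first by rewrite /k /= ur.
  rewrite ur /inverse_derivative /=.
  suff -> : g r = +oo by rewrite /= invr0 mul0e.
  apply/eqP; rewrite -leye_eq leNgt; apply: contra tD; rewrite inE /= ur //.
apply: (@le_trans _ _ (\int[lambda]_y (k y * gI y))).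
  apply: (@le_integral_comp _ _ (measurableTypeR R) (measurableTypeR R) R lambda lambda
    (fine \o u) v gI D k) => // B mB.
  have mIFB : measurable (I `&` F `&` B) by do 2 apply: measurableI => //.
  have -> : D `&` (fine \o u) @^-1` B =
    `[0%R, 1%R]%classic `&` u @^-1` (EFin @` (I `&` F `&` B)).
    apply/seteqP; split => t /=; rewrite /D /= in_itv/=.
      move=> [[/andP[t0 t1] Ft] Bt].
      have [r [ut r0r rr1]] := u_r _ t0 t1; rewrite t0 t1; split => //.
      exists r => //; rewrite ut /= in Ft Bt.
      by split => //; split => //; rewrite /I /= in_itv/= r0r.
    by move=> [t01 [r [[_ Fr] Br] <-]].
  apply: le_trans (increments_dominate_derivative phi_mu H mIFB) _.
  rewrite muE// (_ : sigma _ = 0); last first.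
    apply/eqP; rewrite eq_le measure_ge0 andbT -sigma0; apply: le_measure; rewrite ?inE//.
    by move=> x [[]].
  rewrite adde0 [leLHS](_ : _ = \int[lambda]_(y in B) (g y * (\1_(I `&` F) y)%:E))//.
  rewrite setIC integral_mkcondr; apply: eq_integral => y _.
  by rewrite epatch_indic.
apply: (@le_trans _ _ (\int[lambda]_y (\1_I y)%:E)); last first.
  rewrite (@integral_indic _ (measurableTypeR R))// setIT.
  rewrite [leLHS](_ : _ = lambda `[r0, r1]%classic)// lebesgue_measure_itv/= lte_fin.
  by case: ifPn => // _; rewrite lee_fin subr_ge0.
(* [k y * g y] is 1 where [g y] is positive and finite, and 0 where [g y = 0] since [0^-1 = 0]. *)
apply: le_integral_nonneg => y _; first exact: mule_ge0.
rewrite /k /gI !indicE; case: (boolP (y \in I `&` F)); last first.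
  by rewrite mule0 mule0 lee_fin.
rewrite inE => -[Iy Fy]; rewrite (mem_set Iy) mule1.
have gfin : g y \is a fin_num by rewrite ge0_fin_numE.
rewrite -[X in _ * X](fineK gfin) -EFinM lee_fin.
have [->|ne] := eqVneq (fine (g y)) 0%R; first by rewrite mulr0.
by rewrite mulVf.
Qed.

End chain_rule_along_a_monotone_function.

(** * The Borel structure of the space of curves *)

Section left_continuous_paths.
Context (R : realType).

(** The grid of mesh [n.+1%:R^-1] is approached from the left, the only side on which the curves are
    continuous. Truncation sends negative reals to 0, in accordance with curves being constant
    before time 0. *)
Definition step_index (n : nat) (t : R) : nat := Num.trunc (n.+1%:R * t).

Definition step_time (n : nat) (t : R) : R := (step_index n t)%:R / n.+1%:R.

Lemma step_time_le0 n (t : R) : t <= 0 -> step_time n t = 0.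
Proof.
move=> t0; rewrite /step_time /step_index (_ : Num.trunc _ = 0%N) ?mul0r//.
apply/truncn0Pn; rewrite -ltNge (@le_lt_trans _ _ 0)//.
by rewrite mulr_ge0_le0.
Qed.

Lemma step_time_bounds n (t : R) : 0 <= t ->
  t - n.+1%:R^-1 < step_time n t <= t.
Proof.
move=> t0; have nt0 : 0 <= n.+1%:R * t by rewrite mulr_ge0.
have /andP[h1 h2] := truncn_itv nt0.
rewrite /step_time ler_pdivrMr// [leRHS]mulrC h1 andbT.
rewrite ltrBlDr -[ltRHS]/(_ / _ + _) -[X in _ / _ + X]mul1r -mulrDl ltr_pdivlMr//.
by rewrite mulrC natr1.
Qed.

Lemma measurable_step_index n (j : nat) : measurable [set t | step_index n t = j].
Proof.
apply: is_interval_measurable => s t /= sj tj w /andP[sw wt].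
apply/eqP; rewrite eqn_leq /step_index -{1}tj -sj.
by rewrite !le_truncn// ler_wpM2l.
Qed.

Definition left_continuous_path (f : R -> R) :=
  (forall t, t <= 0 -> f t = f 0) /\
  (forall t, 0 < t -> f s @[s --> t^'-] --> f t).

Lemma cvg_step_time (f : R -> R) t : left_continuous_path f ->
  f (step_time n t) @[n --> \oo] --> f t.
Proof.
move=> [f0 fl]; have [t0|t0] := leP t 0.
  under eq_fun do rewrite step_time_le0//.
  by rewrite (f0 t)//; exact: cvg_cst.
apply/cvgrPdist_lt => e e0.
have := fl _ t0 => /cvgrPdist_lt/(_ _ e0).
rewrite near_withinE => -[del /= del0 H].
near=> n.
have /andP[h1 h2] := step_time_bounds n (ltW t0).
(* The left limit ignores the value at [t] itself, so grid points equal to [t] are treated apart. *)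
have [->|ne] := eqVneq (step_time n t) t; first by rewrite subrr normr0.
apply: H; last by rewrite lt_neqAle ne.
rewrite /ball/= ger0_norm ?subr_ge0// ltrBlDr -ltrBlDl.
apply: le_lt_trans h1; rewrite lerD2l lerN2.
near: n; exists (Num.trunc del^-1) => // n /= hn.
rewrite -[leRHS]invrK lef_pV2 ?posrE ?invr_gt0//.
by rewrite (le_trans (ltW (truncnS_gt _)))// ler_nat ltnS.
Unshelve. all: by end_near. Qed.

Lemma measurable_step d (T : measurableType d) d' (Y : measurableType d')
    n (F : nat -> T -> Y) : (forall j, measurable_fun setT (F j)) ->
  measurable_fun setT (fun z : T * measurableTypeR R => F (step_index n z.2) z.1).
Proof.
move=> mF _ B mB; rewrite setTI.
rewrite (_ : _ @^-1` _ = \bigcup_j ((F j @^-1` B) `*` [set t | step_index n t = j])).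
  apply: bigcupT_measurable => j; apply: measurableX.
    by rewrite -[X in measurable X]setTI; exact: mF.
  exact: measurable_step_index.
apply/seteqP; split => [[x t] /= h|[x t] [j _ [/= h jt]]].
  by exists (step_index n t).
by rewrite /= jt.
Qed.

(** The pointwise limit of the maps frozen at the preceding grid time, each measurable because
    [step_index] takes countably many values. *)
Lemma measurable_left_continuous d (T : measurableType d) (F : T -> R -> R) :
  (forall t, measurable_fun setT (F ^~ t)) ->
  (forall x, left_continuous_path (F x)) ->
  measurable_fun setT (fun z : T * measurableTypeR R => F z.1 z.2).
Proof.
move=> mF Fl; apply: (@measurable_fun_cvg _ _ _ _
    (fun n (z : T * measurableTypeR R) => F z.1 (step_time n z.2))).
  by move=> n; exact: (@measurable_step _ _ _ _ n (fun j => F ^~ (j%:R / n.+1%:R))).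
by move=> [x t] _; exact: cvg_step_time.
Qed.

Lemma measurable_left_continuous_path (f : R -> R) :
  left_continuous_path f -> measurable_fun setT f.
Proof.
move=> fl; have := @measurable_left_continuous _ (measurableTypeR R) (fun=> f)
  (fun t => measurable_cst _) (fun=> fl).
move=> mf; have mp : measurable_fun [set: measurableTypeR R]
  (fun t : measurableTypeR R => (t, t)) by apply: measurable_fun_pair.
exact: (measurableT_comp mf mp).
Qed.

End left_continuous_paths.

Section evaluation_maps.
Context (R : realType) (X : mmSpacetime R) (d : X -> X -> R).
Hypothesis hd : bounded_distance d.
Local Notation lambda := (@lebesgue_measure R).

Lemma dist_ge0 x y : 0 <= d x y. Proof. by have [[]] := hd. Qed.

Lemma dist_xx x : d x x = 0.
Proof. by have [[_ d0 _ _] _ _] := hd; apply/d0. Qed.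

Lemma distC x y : d x y = d y x. Proof. by have [[]] := hd. Qed.

Lemma dist_triangle y x z : d x z <= d x y + d y z.
Proof. by have [[_ _ _ +] _ _] := hd; exact. Qed.

Lemma dist_lipschitz x y z : `|d x y - d x z| <= d y z.
Proof.
have := dist_triangle y x z; have := dist_triangle z x y.
by rewrite (distC z y) ler_norml => *; apply/andP; split; lra.
Qed.

Lemma open_dball x (e : R) : open [set y | d x y < e].
Proof.
have [_ top _] := hd; rewrite openE => y /= xy.
apply/top; exists (e - d x y); first by rewrite subr_gt0.
move=> z /= yz; rewrite (le_lt_trans (dist_triangle y _ _))//.
by rewrite -ltrBrDl.
Qed.

Lemma dense_sequence : exists a : nat -> X, forall x (e : R), 0 < e ->
  exists n, d (a n) x < e.
Proof.
have [_ [A /countable_injP[f finj] dA]] := mms_polish X.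
exists (fun n => xget point [set y | A y /\ f y = n]) => x e e0.
have [y [ye Ay]] : [set y | d x y < e] `&` A !=set0.
  by apply: dA; [exists x; rewrite /= dist_xx|exact: open_dball].
exists (f y).
have [Az fz] : [set z | A z /\ f z = f y] (xget point [set z | A z /\ f z = f y]).
  by apply: xgetPex; exists y.
by rewrite (finj _ _ (mem_set Az) (mem_set Ay) fz) distC.
Qed.

Lemma measurable_fun_lt d' (T : measurableType d') (F : T -> R) :
  (forall r, measurable [set t | F t < r]) -> measurable_fun setT F.
Proof.
move=> H; apply: (measurability (@RGenInftyO.G R)) => [|/= _ [_] [r] -> <-].
  exact: RGenInftyO.measurableE.
by rewrite setTI (_ : _ @^-1` _ = [set t | F t < r]).
Qed.

(** Every open set is a countable union of balls with rational radii centred at a dense sequence. *)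
Lemma measurable_fun_borel d' (T : measurableType d') (F : T -> borel X) :
  (forall x r, measurable [set t | d x (F t) < r]) -> measurable_fun setT F.
Proof.
move=> H; have [a aP] := dense_sequence.
apply: (@measurability _ _ T (borel X) setT F (@open X)) => [//|/= _ [U oU <-]]; rewrite setTI.
pose S (nq : nat * rat) := [set t | d (a nq.1) (F t) < ratr nq.2 /\
  [set y | d (a nq.1) y < ratr nq.2] `<=` U].
rewrite (_ : _ @^-1` _ = \bigcup_nq S nq); last first.
  apply/seteqP; split => [t /= Ut|t [nq _ [h]]]; last exact.
  have [_ top _] := hd; move: oU; rewrite openE => /(_ _ Ut) /top[e e0 eU].
  have [n na] := aP (F t) (e / 2) (divr_gt0 e0 (ltr0Sn _ 1)).
  have [q] := rat_in_itvoo na; rewrite in_itv/= => /andP[q1 q2].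
  exists (n, q) => //; split => //= y yq; apply: eU => /=.
  rewrite (le_lt_trans (dist_triangle (a n) _ _))// (distC (F t)).
  by rewrite [e]splitr ltrD// (lt_trans _ q2).
apply: countable_bigcupT_measurable => // -[n q].
have [sub|nsub] := pselect ([set y | d (a n) y < ratr q] `<=` U).
  rewrite (_ : S _ = [set t | d (a n) (F t) < ratr q])//.
  by apply/seteqP; split => t; rewrite /S /= => // -[].
rewrite (_ : S _ = set0)//.
by apply/seteqP; split => t; rewrite /S /= => // -[].
Qed.

Lemma measurable_dist d' (T : measurableType d') (F : T -> borel X) x :
  measurable_fun setT F -> measurable_fun setT (fun t => d x (F t)).
Proof.
move=> mF; apply: measurable_fun_lt => r; rewrite -[X in measurable X]setTI.
by apply: (mF measurableT [set y | d x y < r]); apply: sub_sigma_algebra; exact: open_dball.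
Qed.

Lemma lcc_left_close (c : lcc X) (t e : R) : 0 < t -> 0 < e ->
  \forall s \near t^'-, d (c s) (c t) < e.
Proof.
move=> t0 e0; have [t1|t1] := leP t 1.
  have [_ top _] := hd.
  have : nbhs (c t) [set y | d (c t) y < e] by apply/top; exists e.
  move=> /(@lcc_left_continuous _ _ c t t0 t1) h.
  by near=> s; rewrite distC; near: s; exact: h.
near=> s; rewrite (@lcc_after _ _ c s); last by near: s; exact: nbhs_left_gt.
by rewrite (@lcc_after _ _ c t)// dist_xx.
Unshelve. all: by end_near. Qed.

Lemma lcc_le0 (c : lcc X) (t : R) : t <= 0 -> c t = c 0.
Proof. by rewrite le_eqVlt => /predU1P[->//|]; exact: lcc_before. Qed.

Lemma lcc_left_continuous_dist (c e : lcc X) :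
  left_continuous_path (fun t => d (c t) (e t)).
Proof.
split => [t t0|t t0]; first by rewrite (lcc_le0 c t0) (lcc_le0 e t0).
apply/cvgrPdist_lt => r r0; have r20 : 0 < r / 2 by rewrite divr_gt0.
near=> s.
apply: (@le_lt_trans _ _ (d (c s) (c t) + d (e s) (e t))); last first.
  rewrite [ltRHS]splitr ltrD//; near: s; exact: lcc_left_close.
rewrite (_ : _ - _ = (d (c t) (e t) - d (c t) (e s)) + (d (e s) (c t) - d (e s) (c s))).
  rewrite (le_trans (ler_normD _ _))// addrC lerD//.
    by rewrite (le_trans (dist_lipschitz _ _ _))// distC.
  by rewrite (le_trans (dist_lipschitz _ _ _))// distC.
by rewrite (distC (e s) (c t)) (distC (e s) (c s)); ring.
Unshelve. all: by end_near. Qed.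

Lemma lcc_left_continuous_dist_pt (c : lcc X) x :
  left_continuous_path (fun t => d x (c t)).
Proof. exact: (lcc_left_continuous_dist (lcc_cst x) c). Qed.

Lemma measurable_lcc_dist (c e : lcc X) :
  measurable_fun [set: R] (fun t => d (c t) (e t)).
Proof.
apply: measurable_left_continuous_path; exact: (lcc_left_continuous_dist c e).
Qed.

Lemma measurable_lcc (c : lcc X) :
  measurable_fun setT (c : measurableTypeR R -> borel X).
Proof.
apply: measurable_fun_borel => x r.
have := measurable_left_continuous_path (lcc_left_continuous_dist_pt c x).
move=> /(_ measurableT `]-oo, r[%classic (measurable_itv _)); rewrite setTI.
by congr measurable; apply/seteqP; split => t /=; rewrite in_itv.
Qed.

Lemma integrable_bounded01 (f : R -> R) (a b C : R) : measurable_fun setT f ->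
  (forall t, 0 <= f t <= C) -> lambda.-integrable `[a, b] (EFin \o f).
Proof.
move=> mf fC; apply: measurable_bounded_integrable => //=.
- by rewrite lebesgue_measure_itv/=; case: ifPn => _; rewrite ?ltry// -EFinB ltry.
- exact: measurable_funTS.
- exists C; split; first exact: num_real.
  move=> x hx t /= _; have /andP[f0 fC'] := fC t.
  by rewrite ger0_norm// (le_trans fC')// ltW.
Qed.

Lemma lcc_dist_ge0_head (c e : lcc X) : d (c 0) (e 0) <= lcc_dist d c e.
Proof. by rewrite lerDl; apply: Rintegral_ge0 => t _; exact: dist_ge0. Qed.

Lemma lcc_dist_ge_integral (c e : lcc X) (a b : R) : 0 <= a -> b <= 1 ->
  \int[lambda]_(t in `[a, b]) d (c t) (e t) <= lcc_dist d c e.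
Proof.
move=> a0 b1; have [_ _ [C dC]] := hd.
have int (s t : R) : lambda.-integrable `[s, t] (EFin \o (fun t => d (c t) (e t))).
  by apply: (@integrable_bounded01 _ _ _ C) => [|r]; [exact: measurable_lcc_dist|rewrite dist_ge0 dC].
rewrite /lcc_dist ler_wpDl ?dist_ge0// /Rintegral fine_le//; try exact: integrable_fin_num.
apply: ge0_subset_integral => //.
- by apply/measurable_EFinP/measurable_funTS; exact: measurable_lcc_dist.
- by move=> t _; rewrite lee_fin dist_ge0.
- by apply: subset_itv; rewrite bnd_simp.
Qed.

End evaluation_maps.

Section evaluation_measurable.
Context (R : realType) (X : mmSpacetime R) (d : X -> X -> R).
Hypothesis hd : bounded_distance d.
Local Notation lambda := (@lebesgue_measure R).

Lemma lcc_left_interval (c : lcc X) (t e : R) : 0 < t -> 0 < e ->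
  exists2 s : R, 0 <= s < t & forall r, s <= r -> r <= t -> d (c r) (c t) < e.
Proof.
move=> t0 e0; have := lcc_left_close hd c t0 e0.
rewrite near_withinE => -[del /= del0 H].
exists (Num.max 0 (t - del / 2)).
  by rewrite le_max lexx/= gt_max t0/= gtrBl divr_gt0.
move=> r; rewrite ge_max => /andP[r0 rdel]; rewrite le_eqVlt => /predU1P[->|rt].
  by rewrite dist_xx.
apply: H => //; rewrite /ball/= gtr0_norm ?subr_gt0//; lra.
Qed.

Lemma measurable_lcc0 x (r : R) : measurable ([set c | d x (c 0) < r] : set (borel_lcc d)).
Proof.
apply: sub_sigma_algebra => c /= cr; exists (r - d x (c 0)); first by rewrite subr_gt0.
move=> e /= ce; rewrite (le_lt_trans (dist_triangle hd (c 0) _ _))// -ltrBrDl.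
exact: le_lt_trans (lcc_dist_ge0_head hd _ _) ce.
Qed.

Section excess.
Variables (x : X) (q s t : R).
Hypotheses (s0 : 0 <= s) (t1 : t <= 1).

Let exc (c : lcc X) r := Num.max (d x (c r) - q) 0.

(** A continuous substitute for evaluation at [t]: it is 1-Lipschitz for [lcc_dist], and it is at
    most 0 when [c] stays within distance [q] of [x] on [[s, t]]. By left continuity the latter then
    passes to [c t]. *)
Definition excess (c : lcc X) : R := \int[lambda]_(r in `[s, t]) exc c r.

Let exc_bounded : exists C, forall c r, 0 <= exc c r <= C.
Proof.
have [_ _ [C dC]] := hd; exists (Num.max (C - q) 0) => c r.
by rewrite /exc le_max lexx orbT/= ge_max !le_max lexx orbT lerB.
Qed.

Let mexc c : measurable_fun setT (exc c).
Proof.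
apply: measurable_maxr => //; apply: measurable_funB => //.
exact: (measurable_lcc_dist hd (lcc_cst x) c).
Qed.

Lemma integrable_exc c (a b : R) : lambda.-integrable `[a, b] (EFin \o exc c).
Proof.
by have [C exC] := exc_bounded; exact: (integrable_bounded01 _ _ (mexc c) (exC c)).
Qed.

Lemma excess_lipschitz c e : excess c <= excess e + lcc_dist d c e.
Proof.
have [_ _ [C dC]] := hd.
have int : lambda.-integrable `[s, t] (EFin \o (fun r => d (c r) (e r))).
  by apply: (@integrable_bounded01 _ _ _ _ C) => [|r]; [exact: measurable_lcc_dist|rewrite dist_ge0// dC].
apply: le_trans (lerD (lexx _) (lcc_dist_ge_integral hd c e s0 t1)).
rewrite /excess -RintegralD//; last exact: integrable_exc.
apply: le_Rintegral => //; first exact: integrable_exc.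
  rewrite (_ : _ \o _ = (EFin \o exc e) \+ (EFin \o (fun r => d (c r) (e r))))%E//.
  by apply: integrableD => //; exact: integrable_exc.
move=> r _; rewrite /exc ge_max; apply/andP; split.
  have := dist_triangle hd (e r) x (c r); rewrite (distC hd (e r)) => h.
  have : d x (e r) - q <= Num.max (d x (e r) - q) 0 by rewrite le_max lexx.
  by lra.
by rewrite addr_ge0// ?dist_ge0// le_max lexx orbT.
Qed.

Lemma measurable_excess : measurable ([set c | excess c <= 0] : set (borel_lcc d)).
Proof.
rewrite -[X in measurable X]setCK; apply: measurableC; apply: sub_sigma_algebra.
move=> c /= /negP; rewrite -ltNge => c0; exists (excess c) => // e /= ce.
apply/negP; rewrite -ltNge; have := excess_lipschitz c e; lra.
Qed.

Lemma excess_le0 (c : lcc X) : (forall r, s <= r -> r <= t -> d x (c r) <= q) -> excess c <= 0.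
Proof.
move=> H; rewrite /excess /Rintegral integral0_eq// => r /=; rewrite in_itv/= => /andP[sr rt].
congr EFin; apply/eqP; rewrite eq_le ge_max lexx andbT subr_le0 H//.
by rewrite le_max lexx orbT.
Qed.

Lemma le0_excess (c : lcc X) : 0 < t -> s < t -> excess c <= 0 -> d x (c t) <= q.
Proof.
move=> t0 st; rewrite !leNgt; apply: contra => qt.
(* By left continuity, half of the gap persists on an interval [[s2, t]] of positive length, which
   makes the excess positive. *)
pose k := (d x (c t) - q) / 2; have k0 : 0 < k by rewrite divr_gt0// subr_gt0.
have [s' /andP[s'0 s't] H] := lcc_left_interval c t0 k0.
pose s2 := Num.max s s'; have s2t : s2 < t by rewrite gt_max st.
have s2s : s <= s2 by rewrite le_max lexx.
apply: (@lt_le_trans _ _ (k * (t - s2))); first by rewrite mulr_gt0// subr_gt0.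
apply: (@le_trans _ _ (\int[lambda]_(r in `[s2, t]) exc c r)).
  rewrite -[t - s2]/(fine (t - s2)%:E) (_ : (t - s2)%:E = lambda `[s2, t]%classic); last first.
    by rewrite lebesgue_measure_itv/= lte_fin s2t.
  rewrite -Rintegral_cst//; apply: le_Rintegral => //; last 2 first.
  - exact: integrable_exc.
  - move=> r /=; rewrite in_itv/= ge_max -andbA => /and3P[_ s'r rt].
    rewrite le_max; apply/orP; left.
    have := H _ s'r rt; have := dist_triangle hd (c r) x (c t); rewrite /k; lra.
  - by apply: (@integrable_bounded01 _ _ _ _ k) => // r; rewrite lexx (ltW k0).
rewrite /excess /Rintegral fine_le//; try (apply: integrable_fin_num => //; exact: integrable_exc).
apply: ge0_subset_integral => //.
- by apply/measurable_EFinP/measurable_funTS; exact: mexc.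
- by move=> r _; rewrite lee_fin le_max lexx orbT.
- by apply: subset_itv; rewrite bnd_simp.
Qed.

End excess.

(** At time 0 evaluation is controlled by the first term of [lcc_dist]. For [t > 0], [d x (c t) < r]
    holds when some excess with rational [q < r] and rational [s < t] is at most 0, and conversely
    by left continuity. *)
Lemma measurable_eval (t : R) : measurable_fun setT (fun c : borel_lcc d => (c : lcc X) t : borel X).
Proof.
apply: (measurable_fun_borel hd) => x r.
have [t0|t0] := leP t 0.
  by under eq_set do rewrite lcc_le0//; exact: measurable_lcc0.
wlog t1 : t t0 / t <= 1.
  move=> H; have [/H|t1] := leP t 1; first exact.
  by under eq_set do rewrite lcc_after//; exact: H.
pose S (qs : rat * rat) : set (borel_lcc d) := [set c | excess x (ratr qs.1) (ratr qs.2) t c <= 0 /\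
  [/\ ratr qs.1 < r :> R, 0 <= ratr qs.2 :> R & ratr qs.2 < t :> R]].
rewrite (_ : [set _ | _] = \bigcup_qs S qs); last first.
  apply/seteqP; split => [c /= cr|c [[q s] _ [/= ec [qr s0 st]]]]; last first.
    exact: le_lt_trans (le0_excess t0 st ec) qr.
  have [q] := rat_in_itvoo cr; rewrite in_itv/= => /andP[q1 q2].
  have q1' : 0 < ratr q - d x (c t) by rewrite subr_gt0.
  have [s' /andP[s'0 s't] H] := lcc_left_interval c t0 q1'.
  have [s] := rat_in_itvoo s't; rewrite in_itv/= => /andP[s1 s2].
  exists (q, s) => //; split => /=; last by rewrite (le_trans s'0 (ltW s1)).
  apply: excess_le0 => w sw wt; have := H _ (le_trans (ltW s1) sw) wt.
  have := dist_triangle hd (c t) x (c w); rewrite (distC hd (c t)); lra.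
apply: countable_bigcupT_measurable => // -[q s].
have [[qr s0 st]|h] := pselect [/\ ratr q < r :> R, 0 <= ratr s :> R & ratr s < t :> R].
  rewrite (_ : S _ = [set c | excess x (ratr q) (ratr s) t c <= 0]); first exact: measurable_excess.
  by apply/seteqP; split => c; rewrite /S /= => // -[].
rewrite (_ : S _ = set0)//.
by apply/seteqP; split => c; rewrite /S /= => // -[].
Qed.

Lemma measurable_eval_joint :
  measurable_fun setT (fun z : borel_lcc d * measurableTypeR R => (z.1 : lcc X) z.2 : borel X).
Proof.
apply: (measurable_fun_borel hd) => x r.
have := @measurable_left_continuous R _ (borel_lcc d) (fun c t => d x ((c : lcc X) t)) _ _.
move=> /(_ (fun t => measurable_dist hd x (measurable_eval t))).
move=> /(_ (fun c => lcc_left_continuous_dist_pt hd c x)).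
move=> /(_ measurableT `]-oo, r[%classic (measurable_itv _)); rewrite setTI.
by congr measurable; apply/seteqP; split => t /=; rewrite in_itv.
Qed.

End evaluation_measurable.

Section maps_into_lcc.
Context (R : realType) (X : mmSpacetime R) (d : X -> X -> R).
Hypothesis hd : bounded_distance d.
Local Notation lambda := (@lebesgue_measure R).

Lemma measurable_step_diag n (F : nat -> R -> R) :
  (forall j, measurable_fun setT (F j)) ->
  measurable_fun [set: R] (fun t => F (step_index n t) t).
Proof.
move=> mF; have mp : measurable_fun [set: measurableTypeR R]
  (fun t : measurableTypeR R => (t, t)) by apply: measurable_fun_pair.
exact: (measurableT_comp (@measurable_step R _ (measurableTypeR R) _ _ n F mF) mp).
Qed.

Lemma integral_step_time_cvg0 (c : lcc X) :
  \int[lambda]_(t in `[0, 1]) d (c t) (c (step_time n t)) @[n --> \oo] --> (0 : R).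
Proof.
have [_ _ [C dC]] := hd.
have m1 n : measurable_fun [set: R] (fun t => d (c t) (c (step_time n t))).
  apply: (@measurable_step_diag n (fun j t => d (c t) (c (j%:R / n.+1%:R)))) => j.
  exact: (measurable_lcc_dist hd c (lcc_cst _)).
apply: fine_cvg; rewrite (_ : 0%:E = \int[lambda]_(t in `[0%R, 1%R]) 0)%E; last first.
  by rewrite integral0.
apply: (@dominated_cvg _ (measurableTypeR R) R lambda `[0, 1]%classic _
  (fun n t => (d (c t) (c (step_time n t)))%:E) (fun=> 0%E) (fun=> C%:E)) => //.
- by move=> n; apply/measurable_EFinP/measurable_funTS; exact: m1.
- move=> t _; apply: cvg_EFin; first exact: nearW.
  rewrite -(dist_xx hd (c t)).
  exact: (cvg_step_time (lcc_left_continuous_dist_pt hd c (c t))).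
- have C0 : 0 <= C by apply: le_trans (dC point point); exact: dist_ge0.
  by apply: (@integrable_bounded01 _ _ _ _ C) => // t; rewrite lexx C0.
- by move=> n t _; rewrite abse_EFin lee_fin ger0_norm ?dist_ge0.
Qed.

Section step_paths.
Variable a : nat -> X.

Definition step_path (n : nat) (s : seq nat) (t : R) : X :=
  a (nth 0%N s (step_index n t)).

(** The formula of [lcc_dist], restated because step paths are in general neither causal nor
    left-continuous, hence not elements of [lcc X]. *)
Definition step_dist (n : nat) (s : seq nat) (c : lcc X) : R :=
  d (c 0) (step_path n s 0) + \int[lambda]_(t in `[0, 1]) d (c t) (step_path n s t).

Lemma measurable_dist_step_path n s (c : lcc X) :
  measurable_fun [set: R] (fun t => d (c t) (step_path n s t)).
Proof.
apply: (@measurable_step_diag n (fun j t => d (c t) (a (nth 0%N s j)))) => j.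
exact: (measurable_lcc_dist hd c (lcc_cst _)).
Qed.

Lemma integrable_dist_step_path n s (c : lcc X) :
  lambda.-integrable `[0, 1] (EFin \o (fun t => d (c t) (step_path n s t))).
Proof.
have [_ _ [C dC]] := hd; apply: (@integrable_bounded01 _ _ _ _ C).
  exact: measurable_dist_step_path.
by move=> t; rewrite dist_ge0// dC.
Qed.

Lemma lcc_dist_step_triangle n s (c e : lcc X) :
  lcc_dist d c e <= step_dist n s c + step_dist n s e.
Proof.
have [_ _ [C dC]] := hd.
rewrite /lcc_dist /step_dist addrACA lerD//.
  by rewrite (distC hd (e 0)) dist_triangle.
rewrite -RintegralD//; [|exact: integrable_dist_step_path..].
apply: le_Rintegral => //.
- by apply: (@integrable_bounded01 _ _ _ _ C) => [|t]; [exact: measurable_lcc_dist|rewrite dist_ge0// dC].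
- rewrite (_ : _ \o _ = (EFin \o (fun t => d (c t) (step_path n s t))) \+
    (EFin \o (fun t => d (e t) (step_path n s t))))%E//.
  by apply: integrableD => //; exact: integrable_dist_step_path.
- by move=> t _; rewrite (distC hd (e t)) dist_triangle.
Qed.

Lemma step_dist_small (c : lcc X) (r : R) :
  (forall x (e : R), 0 < e -> exists n, d (a n) x < e) -> 0 < r ->
  exists n s, step_dist n s c < r.
Proof.
move=> aP r0; have r3 : 0 < r / 3 by rewrite divr_gt0.
have [_ _ [C dC]] := hd.
have /cvgrPdist_lt/(_ _ r3) [n _ /(_ n (leqnn n)) /=] := integral_step_time_cvg0 c.
rewrite sub0r normrN => /(le_lt_trans (ler_norm _)) hn.
have [b bP] : {b : nat -> nat & forall j, d (a (b j)) (c (j%:R / n.+1%:R)) < r / 3}.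
  apply: (@choice _ _ (fun j k => d (a k) (c (j%:R / n.+1%:R)) < r / 3)) => j.
  exact: aP.
(* Times in [[0, 1]] have indices up to [n.+1], hence [n.+2] values. The three thirds of [r] pay for
   the value at 0, the discretisation of time and the approximation of the values. *)
exists n, (mkseq b n.+2).
have near_ t : t <= 1 -> d (c (step_time n t)) (step_path n (mkseq b n.+2) t) <= r / 3.
  move=> t1; rewrite /step_path nth_mkseq.
    by rewrite (distC hd) ltW// bP.
  rewrite ltnS /step_index truncn_le_nat.
  by rewrite (@le_lt_trans _ _ n.+1%:R) ?ltr_nat// ler_piMr.
rewrite /step_dist.
have h0 : d (c 0) (step_path n (mkseq b n.+2) 0) <= r / 3.
  by have := near_ 0 ler01; rewrite step_time_le0.
suff h1 : \int[lambda]_(t in `[0, 1]) d (c t) (step_path n (mkseq b n.+2) t) <=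
    \int[lambda]_(t in `[0, 1]) d (c t) (c (step_time n t)) + r / 3.
  by move: h0 h1 hn; clear; lra.
have i1 : lambda.-integrable `[0, 1] (EFin \o (fun t => d (c t) (c (step_time n t)))).
  apply: (@integrable_bounded01 _ _ _ _ C) => [|t]; last by rewrite dist_ge0// dC.
  apply: (@measurable_step_diag n (fun j t => d (c t) (c (j%:R / n.+1%:R)))) => j.
  exact: (measurable_lcc_dist hd c (lcc_cst _)).
have i2 : lambda.-integrable `[0, 1] (EFin \o (fun _ : R => r / 3)).
  by apply: (@integrable_bounded01 _ _ _ _ (r / 3)) => // t; rewrite lexx (ltW r3).
have -> : r / 3 = \int[lambda]_(t in `[0, 1]) (r / 3).
  have L1 : lambda `[0, 1]%classic = 1%E.
    by rewrite lebesgue_measure_itv/= lte_fin ltr01 oppr0 adde0.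
  by rewrite Rintegral_cst// [X in fine X]L1 mulr1.
rewrite -RintegralD//; apply: le_Rintegral => //.
- exact: integrable_dist_step_path.
- rewrite (_ : _ \o _ = (EFin \o (fun t => d (c t) (c (step_time n t)))) \+
    (EFin \o (fun _ : R => (r / 3)%R)))%E//.
  exact: integrableD.
- move=> t /=; rewrite in_itv/= => /andP[_ t1].
  by rewrite (le_trans (dist_triangle hd (c (step_time n t)) _ _))// lerD2l near_.
Qed.

Lemma measurable_step_dist d' (T : measurableType d') (F : T -> lcc X) n s :
  (forall t, measurable_fun setT (fun x => F x t : borel X)) ->
  measurable_fun setT (fun x => step_dist n s (F x)).
Proof.
move=> mF; apply: measurable_funD.
  under eq_fun do rewrite (distC hd).
  exact: (measurable_dist hd).
pose G (z : T * measurableTypeR R) : \bar R :=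
  (\1_(`[0, 1]%classic) z.2 * d (F z.1 z.2) (step_path n s z.2))%:E.
have mG : measurable_fun setT G.
  apply/measurable_EFinP; apply: measurable_funM.
    have mi : measurable_fun [set: measurableTypeR R] (\1_(`[0, 1]%classic) : _ -> R).
      by apply: measurable_indic; exact: measurable_itv.
    have m2 : measurable_fun [set: T * measurableTypeR R] snd by exact: measurable_snd.
    exact: (measurableT_comp mi m2).
  have mj j : measurable_fun [set: T * measurableTypeR R]
      (fun z => d (F z.1 z.2) (a (nth 0%N s j))).
    under eq_fun do rewrite (distC hd).
    apply: (@measurable_left_continuous R _ T (fun x t => d (a (nth 0%N s j)) (F x t))).
      by move=> t; exact: (measurable_dist hd).
    by move=> x; exact: (lcc_left_continuous_dist_pt hd).
  have mp : measurable_fun [set: T * measurableTypeR R] (fun z => (z, z.2)).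
    by apply: measurable_fun_pair.
  exact: (measurableT_comp (@measurable_step R _ (T * measurableTypeR R)%type _ _ n
    (fun j z => d (F z.1 z.2) (a (nth 0%N s j))) mj) mp).
have G0 z : (0 <= G z)%E by rewrite lee_fin mulr_ge0// dist_ge0.
have mI := @measurable_fun_fubini_tonelli_F _ _ T (measurableTypeR R) R lambda G mG G0.
have := measurableT_comp (@fine_measurable R setT measurableT) mI.
congr measurable_fun; apply/funext => x; rewrite /= /fubini_F /Rintegral; congr fine.
rewrite [RHS]integral_mkcond; apply: eq_integral => t _.
by rewrite /G/= patchE indicE; case: ifPn => _; rewrite ?mul1r ?mul0r.
Qed.

End step_paths.

(* The Borel sigma-algebra of [lcc X] is generated by the evaluation maps,
   because [lcc_dist] is separable: step paths with values in a dense sequence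
   approximate every curve. *)
Lemma measurable_fun_lcc d' (T : measurableType d') (F : T -> borel_lcc d) :
  (forall t : R, measurable_fun setT (fun x => (F x : lcc X) t : borel X)) ->
  measurable_fun setT F.
Proof.
move=> mF; have [a aP] := dense_sequence hd.
apply: (@measurability _ _ T (borel_lcc d) setT F (lcc_open d)) => [//|/= _ [U oU <-]].
rewrite setTI.
pose S (nsq : nat * seq nat * rat) := [set x | step_dist a nsq.1.1 nsq.1.2 (F x) < ratr nsq.2 /\
  [set e : lcc X | step_dist a nsq.1.1 nsq.1.2 e < ratr nsq.2] `<=` U].
rewrite (_ : _ @^-1` _ = \bigcup_nsq S nsq); last first.
  apply/seteqP; split => [x /= Ux|t [nsq _ [h]]]; last exact.
  have [r r0 rU] := oU _ Ux.
  have [n [s ns]] := step_dist_small (F x) aP (divr_gt0 r0 (ltr0Sn R 1)).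
  have [q] := rat_in_itvoo ns; rewrite in_itv/= => /andP[q1 q2].
  exists (n, s, q) => //; split => //= e eq; apply: rU => /=.
  rewrite (le_lt_trans (lcc_dist_step_triangle a n s _ _))//.
  by rewrite [r]splitr ltrD// (lt_trans _ q2).
apply: countable_bigcupT_measurable => // -[[n s] q].
have [sub|nsub] := pselect ([set e : lcc X | step_dist a n s e < ratr q] `<=` U).
  rewrite (_ : S _ = [set x | step_dist a n s (F x) < ratr q]).
    have := measurable_step_dist a n s mF.
    move=> /(_ measurableT `]-oo, (ratr q)[%classic (measurable_itv _)); rewrite setTI.
    by congr measurable; apply/seteqP; split => t /=; rewrite in_itv.
  by apply/seteqP; split => t; rewrite /S /= => // -[].
rewrite (_ : S _ = set0)//.
by apply/seteqP; split => t; rewrite /S /= => // -[].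
Qed.

End maps_into_lcc.

(** * Restriction of curves *)

Section restriction_of_curves.
Context (R : realType) (X : mmSpacetime R).
Variables (s t : R).
Hypotheses (s0 : 0 <= s) (st : s < t) (t1 : t <= 1).

Definition affine (r : R) : R := s + (t - s) * r.

(** Produces the constant extension outside [[0, 1]] that the encoding of curves demands. *)
Definition unit_clamp (r : R) : R := Num.max 0 (Num.min r 1).

Lemma unit_clamp_id r : 0 <= r -> r <= 1 -> unit_clamp r = r.
Proof. by move=> r0 r1; rewrite /unit_clamp (min_idPl r1) (max_idPr r0). Qed.

Lemma unit_clamp_ge0 r : 0 <= unit_clamp r.
Proof. by rewrite le_max lexx. Qed.

Lemma unit_clamp_le1 r : unit_clamp r <= 1.
Proof. by rewrite ge_max ler01 ge_min lexx orbT. Qed.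

Let ts0 : 0 < t - s. Proof. by rewrite subr_gt0. Qed.

Lemma affine_itv r : 0 <= r -> r <= 1 -> s <= affine r <= t.
Proof.
move=> r0 r1; rewrite /affine lerDl mulr_ge0 ?(ltW ts0)//=.
by rewrite -lerBrDl ler_piMr// ltW.
Qed.

Lemma affine_le : {homo affine : a b / a <= b}.
Proof. by move=> a b ab; rewrite lerD2l ler_wpM2l// ltW. Qed.

Section restriction.
Variable c : lcc X.
Let f (r : R) : X := c (affine (unit_clamp r)).

Let f_causal (a b : R) : 0 <= a -> a <= b -> b <= 1 -> causal_le (f a) (f b).
Proof.
move=> a0 ab b1; have a1 := le_trans ab b1; have b0 := le_trans a0 ab.
rewrite /f !unit_clamp_id//; apply: lcc_causal.
- by have /andP[/(le_trans s0)] := affine_itv a0 a1.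
- exact: affine_le.
- by have /andP[_ /le_trans] := affine_itv b0 b1; apply.
Qed.

Let f_left (r : R) : 0 < r -> r <= 1 -> f w @[w --> r^'-] --> f r.
Proof.
move=> r0 r1; rewrite {2}/f unit_clamp_id ?(ltW r0)//.
have A0 : 0 < affine r by rewrite ltr_wpDl// mulr_gt0.
have A1 : affine r <= 1.
  by have /andP[_ /le_trans] := affine_itv (ltW r0) r1; apply.
move=> B /(@lcc_left_continuous _ _ c _ A0 A1) [del /= del0 H].
exists (Num.min (del / (t - s)) r) => /=.
  by rewrite lt_min r0 divr_gt0.
move=> w /=; rewrite lt_min => /andP[w1 w2] wr.
rewrite gtr0_norm ?subr_gt0// in w1 w2.
have w0 : 0 < w by move: w2; rewrite gtrBl.
rewrite /f unit_clamp_id ?(ltW w0)// ?(le_trans (ltW wr))//; apply: H.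
  rewrite /= /affine opprD addrACA subrr add0r -mulrBr gtr0_norm.
    by rewrite mulrC -ltr_pdivlMr.
  by rewrite mulr_gt0// subr_gt0.
by rewrite /affine ltrD2l ltr_pM2l.
Qed.

Let f_before (r : R) : r < 0 -> f r = f 0.
Proof.
move=> r0; rewrite /f (unit_clamp_id (lexx 0) ler01); congr (c (affine _)).
by apply/max_idPl; rewrite ge_min (ltW r0).
Qed.

Let f_after (r : R) : 1 < r -> f r = f 1.
Proof.
move=> r1; rewrite /f (unit_clamp_id ler01 (lexx 1)); congr (c (affine _)).
by rewrite /unit_clamp (min_idPr (ltW r1)); apply/max_idPr.
Qed.

Definition lcc_restr : lcc X := Lcc f_causal f_left f_before f_after.

Lemma lcc_restrE (r : R) : 0 <= r -> r <= 1 -> lcc_restr r = c (affine r).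
Proof. by move=> r0 r1; rewrite /= /f unit_clamp_id. Qed.

End restriction.

Variable d : X -> X -> R.
Hypothesis hd : bounded_distance d.

Lemma measurable_lcc_restr :
  measurable_fun setT (lcc_restr : borel_lcc d -> borel_lcc d).
Proof. by apply: (measurable_fun_lcc hd) => r; exact: (measurable_eval hd). Qed.

End restriction_of_curves.

(** * Null sets met by test plans *)

Section null_sets_along_plans.
Local Open Scope ereal_scope.
Context (R : realType) (X : mmSpacetime R) (d : X -> X -> R).
Hypothesis hd : bounded_distance d.
Variable P : probability (borel_lcc d) R.
Hypothesis tP : test_plan P.
Variable N : set X.
Hypotheses (mN : measurable (N : set (borel X))) (N0 : vol X N = 0).
Local Notation lambda := (@lebesgue_measure R).

Lemma measurable_eval_set (t : R) (A : set X) : measurable (A : set (borel X)) ->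
  measurable ([set c : lcc X | A (c t)] : set (borel_lcc d)).
Proof.
by move=> mA; have := measurable_eval hd t measurableT mA; rewrite setTI.
Qed.

Lemma test_plan_null (t : R) : (0 <= t)%R -> (t <= 1)%R ->
  P [set c : lcc X | N (c t)] = 0.
Proof.
move=> t0 t1; have [C C0 /(_ t t0 t1 N mN)] := tP.
rewrite N0 mule0 => h; apply/eqP; rewrite eq_le h /=.
exact: measure_ge0.
Qed.

(** Tonelli for [P] and Lebesgue measure: for each time in [[0, 1]] the section over curves is
    [P]-null. *)
Lemma test_plan_null_ae :
  {ae P, forall c, lambda (`[0%R, 1%R]%classic `&` [set t | N ((c : lcc X) t)]) = 0}.
Proof.
pose E : set (borel_lcc d * measurableTypeR R) :=
  [set z | `[0%R, 1%R]%classic z.2] `&` [set z | N ((z.1 : lcc X) z.2)].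
have mE : measurable E.
  apply: measurableI.
    have := @measurable_snd _ _ (borel_lcc d) (measurableTypeR R) measurableT _ (measurable_itv `[0%R, 1%R]).
    by rewrite setTI.
  by have := measurable_eval_joint hd measurableT mN; rewrite setTI.
pose f z : \bar R := (\1_E z)%:E.
have mf : measurable_fun setT f by apply/measurable_EFinP; exact: measurable_indic.
have f0 z : 0 <= f z by rewrite lee_fin.
pose F (c : borel_lcc d) := \int[lambda]_y f (c, y).
have FE c : F c = lambda (`[0%R, 1%R]%classic `&` [set t | N ((c : lcc X) t)]).
  set S : set (measurableTypeR R) := (X in lambda X).
  have mS : measurable S.
    have := measurable_lcc hd c measurableT mN; rewrite setTI => mcN.
    by apply: measurableI => //; exact: measurable_itv.
  have <- : \int[lambda]_y (\1_S y)%:E = lambda S.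
    by rewrite (@integral_indic _ (measurableTypeR R))// setIT.
  apply: eq_integral => y _; rewrite /f !indicE.
  by rewrite (_ : ((c, y) \in E) = (y \in S)).
have F0 : \int[P]_c F c = 0.
  rewrite (fubini_tonelli f)//; apply: integral0_eq => y _.
  have [y01|y01] := pselect (`[0%R, 1%R]%classic y); last first.
    by apply: integral0_eq => c _; rewrite /f indicE memNset// => -[].
  have [y0 y1] : (0 <= y)%R /\ (y <= 1)%R by move: y01; rewrite /= in_itv/= => /andP[].
  rewrite -(test_plan_null y0 y1).
  have <- : \int[P]_c (\1_[set c : lcc X | N (c y)] c)%:E = P [set c : lcc X | N (c y)].
    by rewrite integral_indic ?setIT//; exact: measurable_eval_set.
  apply: eq_integral => c _; rewrite /f !indicE.
  rewrite (_ : ((c, y) \in E) = (c \in [set c : lcc X | N (c y)]))//.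
  by apply/idP/idP => /set_mem h; apply/mem_set; [case: h|split].
have mF : measurable_fun setT F by exact: measurable_fun_fubini_tonelli_F.
have F_ge0 c : 0 <= F c by apply: integral_ge0 => y _; exact: f0.
have : \int[P]_c `|F c| = 0.
  by rewrite -[RHS]F0; apply: eq_integral => c _; rewrite gee0_abs.
move=> /(ae_eq_integral_abs P measurableT mF); apply: filterS => c /= cF.
by rewrite -FE cF.
Qed.

End null_sets_along_plans.

Section affine_change_of_variables.
Local Open Scope ereal_scope.
Context (R : realType) (s t : R).
Hypothesis st : (s < t)%R.
Local Notation lambda := (@lebesgue_measure R).
Local Notation aff := (affine s t).

Let ts0 : (0 < t - s)%R. Proof. by rewrite subr_gt0. Qed.

Definition affine_inv (w : R) : R := ((w - s) / (t - s))%R.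

Lemma affineK : cancel aff affine_inv.
Proof. by move=> r; rewrite /affine_inv /affine addrAC subrr add0r mulrC mulKf ?gt_eqF. Qed.

Lemma affine_invK : cancel affine_inv aff.
Proof. by move=> w; rewrite /affine_inv /affine mulrC divfK ?gt_eqF// addrC subrK. Qed.

Lemma measurable_affine : measurable_fun setT (aff : measurableTypeR R -> measurableTypeR R).
Proof. by apply: nondecreasing_measurable => // a b; exact: affine_le. Qed.

Lemma measurable_affine_inv :
  measurable_fun setT (affine_inv : measurableTypeR R -> measurableTypeR R).
Proof.
apply: nondecreasing_measurable => // a b ab.
by rewrite ler_wpM2r ?invr_ge0 ?(ltW ts0)// lerB.
Qed.

Lemma affine_preimage_itv (a b : R) (x y : bool) :
  aff @^-1` [set` Interval (BSide x a) (BSide y b)] =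
  [set` Interval (BSide x (affine_inv a)) (BSide y (affine_inv b))].
Proof.
have le1 u w : (u <= aff w)%R = (affine_inv u <= w)%R.
  by rewrite /affine_inv ler_pdivrMr// lerBlDl mulrC.
have le2 u w : (aff w <= u)%R = (w <= affine_inv u)%R.
  by rewrite /affine_inv ler_pdivlMr// lerBrDl mulrC.
apply/seteqP; split => r /=; rewrite !in_itv /=; case: x y => [] []/=;
  by rewrite ?ltNge ?le1 ?le2.
Qed.

Lemma lebesgue_measure_affine (B : set (measurableTypeR R)) : measurable B ->
  (t - s)%:E * lambda (aff @^-1` B) = lambda B.
Proof.
move=> mB; have [nu nuE] := pushforward_measure lambda measurable_affine.
rewrite -nuE -[LHS]/(mscale (NngNum (ltW ts0)) nu B).
apply/esym/lebesgue_measure_unique => // _ [[a b] _ <-] /=.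
rewrite /mscale/= nuE affine_preimage_itv lebesgue_measure_itv/= lte_fin.
rewrite [X in _ * X]lebesgue_measure_itv/= lte_fin.
rewrite /affine_inv ltr_pM2r ?invr_gt0// ltrD2r; case: ifPn => _; last by rewrite mule0.
rewrite -!EFinB -EFinM; congr EFin.
by rewrite -mulrBl mulrC divfK ?gt_eqF//; ring.
Qed.

Lemma integral_affine (h : R -> \bar R) (B : set (measurableTypeR R)) :
  measurable B -> measurable_fun setT h -> (forall x, 0 <= h x) ->
  \int[lambda]_(w in B) h w = (t - s)%:E * \int[lambda]_(r in aff @^-1` B) h (aff r).
Proof.
move=> mB mh h0.
have <- := ge0_integral_pushforward measurable_affine lambda mB (measurable_funTS mh)
  (fun x _ => h0 x).
rewrite -[(t - s)%:E]/((NngNum (ltW ts0))%:num%:E) -ge0_integral_mscale//; last first.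
  exact: measurable_funTS.
move=> maff; apply: eq_measure_integral => A mA _.
by rewrite -[RHS]/((t - s)%:E * lambda (aff @^-1` A)) lebesgue_measure_affine.
Unshelve. exact: measurable_affine.
Qed.

End affine_change_of_variables.

(** * Causal speed of restricted curves *)

Section speed_of_a_restriction.
Local Open Scope ereal_scope.
Context (R : realType) (X : mmSpacetime R).
Implicit Types c : lcc X.
Local Notation lambda := (@lebesgue_measure R).
Local Notation measR := {measure set (measurableTypeR R) -> \bar R}.

(** The reverse triangle inequality along a causal chain. As [addx] is not commutative, both orders
    of the sum must be shown to dominate each nonnegative term. *)
Lemma tsep_mono c (a a' b' b : R) : (0 <= a)%R -> (a <= a')%R -> (a' <= b')%R ->
  (b' <= b)%R -> (b <= 1)%R -> tsep (c a') (c b') <= tsep (c a) (c b).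
Proof.
have key (x y z : X) : causal_le x y -> causal_le y z ->
    tsep x y <= tsep x z /\ tsep y z <= tsep x z.
  move=> xy yz; have [_ _ /(_ x y z) tri] := mms_tsep X.
  have le1 (p q : \bar R) : 0 <= p -> 0 <= q -> p <= addx p q.
    by case: p => [r| |] //= _ q0; rewrite leeDl.
  have le2 (p q : \bar R) : 0 <= p -> 0 <= q -> p <= addx q p.
    by case: q => [r| |] //= p0 q0; [rewrite leeDr|rewrite leey].
  by split; (apply: le_trans; last exact: tri); rewrite le_min; rewrite ?le1 ?le2.
move=> a0 aa' a'b' b'b b1.
have a'0 := le_trans a0 aa'; have b'1 := le_trans b'b b1.
have h1 := key (c a) (c a') (c b') (lcc_causal c a0 aa' (le_trans a'b' b'1))
  (lcc_causal c a'0 a'b' b'1).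
have h2 := key (c a) (c b') (c b) (lcc_causal c a0 (le_trans aa' a'b') b'1)
  (lcc_causal c (le_trans a'0 a'b') b'b b1).
exact: le_trans h1.2 h2.1.
Qed.

Lemma tsep_ge0 c (a b : R) : (0 <= a)%R -> (a <= b)%R -> (b <= 1)%R -> 0 <= tsep (c a) (c b).
Proof. by move=> *; exact: lcc_causal. Qed.

(** Separates a genuine density from the default value 0, taken when no suitable pair of measure and
    density exists. *)
Lemma causal_speedP c :
  (exists2 nu : measR, largest_below_tsep c nu & is_ac_density nu (causal_speed c)) \/
  (causal_speed c = cst 0 /\
   forall nu g, largest_below_tsep c nu -> is_ac_density nu g -> False).
Proof.
rewrite /causal_speed; case: xgetP => [g _ gP|nog]; [by left|right; split => //].
by move=> nu g h1 h2; apply: (nog g); exists nu.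
Qed.

Lemma causal_speed_measurable c :
  measurable_fun [set: R] (causal_speed c) /\ (forall r, 0 <= causal_speed c r).
Proof.
have [[nu _ [[]]]|[-> _]] := causal_speedP c; first by [].
by split => // r; exact: lexx.
Qed.

Lemma infinite_atoms01 : exists m : measR,
  forall B : set (measurableTypeR R), measurable B ->
    (~ B 0%R -> ~ B 1%R -> m B = 0) /\ (B 0%R \/ B 1%R -> m B = +oo).
Proof.
have mc : measurable_fun [set: measurableTypeR R] (cst (+oo : \bar R)) by exact: measurable_cst.
have c0 (x : measurableTypeR R) : 0 <= cst (+oo : \bar R) x by exact: leey.
pose del (x : R) : measR := [the measR of @dirac _ (measurableTypeR R) x R].
pose m : measR := [the measR of mdensity (measure_add (del 0%R) (del 1%R)) mc c0].
exists m => B mB.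
have -> : m B = \d_(0%R : measurableTypeR R) B * +oo + \d_(1%R : measurableTypeR R) B * +oo.
  rewrite /m /= /mdensity ge0_integral_measure_add//.
  by rewrite !integral_dirac.
rewrite !diracE; split=> [B0 B1|].
  by rewrite !memNset// !mul0e adde0.
have neNy (x : bool) : x%:R%:E * (+oo : \bar R) != -oo.
  by rewrite -ltNye; apply: (@lt_le_trans _ _ 0) => //; rewrite mule_ge0// lee_fin.
move=> [B0|B1]; first by rewrite (mem_set B0) mul1e addye.
by rewrite (mem_set B1) mul1e addey.
Qed.

(* [nu] moved to [0,1] by the inverse affine map, with infinite atoms at the end
   points, which [below_tsep] does not constrain. *)
Lemma rescaled_measure (nu : measR) (s t : R) : (s < t)%R -> exists nu' : measR,
  forall B : set (measurableTypeR R), measurable B ->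
    (~ B 0%R -> ~ B 1%R -> nu' B = nu (affine_inv s t @^-1` B `&` `]s, t[%classic)) /\
    (B 0%R \/ B 1%R -> nu' B = +oo).
Proof.
move=> st; have [m mE] := infinite_atoms01.
have mst : measurable (`]s, t[%classic : set (measurableTypeR R)) by exact: measurable_itv.
have [nu1 nu1E] := pushforward_measure (mrestr nu mst) (measurable_affine_inv st).
pose nu' : measR := [the measR of measure_add nu1 m].
exists nu' => B mB; have -> : nu' B = nu1 B + m B by exact: measure_addE.
rewrite nu1E; have [m0 moo] := mE B mB; split=> [B0 B1|B01].
  by rewrite m0// adde0.
by rewrite moo// addey// -ltNye (lt_le_trans _ (measure_ge0 _ _)).
Qed.

Section restriction.
Variables (s t : R).
Hypotheses (s0 : (0 <= s)%R) (st : (s < t)%R) (t1 : (t <= 1)%R).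
Local Notation restr := (lcc_restr s0 st t1).
Local Notation aff := (affine s t).
Local Notation affV := (affine_inv s t).

Variable d : X -> X -> R.
Hypothesis hd : bounded_distance d.

Let ts0 : (0 < t - s)%R. Proof. by rewrite subr_gt0. Qed.

Let aff0 : aff 0 = s. Proof. by rewrite /affine mulr0 addr0. Qed.
Let aff1 : aff 1 = t. Proof. by rewrite /affine mulr1 addrC subrK. Qed.

Let affVs : affV s = 0%R. Proof. by rewrite -[RHS](affineK st) aff0. Qed.
Let affVt : affV t = 1%R. Proof. by rewrite -[RHS](affineK st) aff1. Qed.

Let aff_oo (a b : R) : aff @^-1` `]a, b[%classic = `]affV a, affV b[%classic.
Proof. exact: affine_preimage_itv. Qed.

Let affV_oo (a b : R) : affV @^-1` `]a, b[%classic = `]aff a, aff b[%classic.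
Proof.
apply/seteqP; split => w; rewrite /= !in_itv /= /affine_inv /affine;
  by rewrite ltr_pdivlMr// ltr_pdivrMr// ltrBrDl ltrBlDl !(mulrC (t - s)%R).
Qed.

(** For maximality, a competitor for the restricted curve is pushed forward to []s, t[], where it
    competes with [nu]: it charges only the part of []a, b[] inside []s, t[], and [tsep_mono]
    returns to the larger interval. Sets containing 0 or 1 have infinite mass. *)
Lemma rescaled_largest_below (c : lcc X) (nu nu' : measR) :
  largest_below_tsep c nu ->
  (forall B : set (measurableTypeR R), measurable B ->
    (~ B 0%R -> ~ B 1%R -> nu' B = nu (affV @^-1` B `&` `]s, t[%classic)) /\
    (B 0%R \/ B 1%R -> nu' B = +oo)) ->
  largest_below_tsep (restr c) nu'.
Proof.
move=> [nu_below nu_max] nu'E; split.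
  move=> a b a0 ab b1; have [+ _] := nu'E `]a, b[%classic (measurable_itv _); move=> ->.
  - have a1 := le_trans (ltW ab) b1; have b0 := le_trans a0 (ltW ab).
    have /andP[sa _] := affine_itv st a0 a1; have /andP[_ bt] := affine_itv st b0 b1.
    rewrite affV_oo setIidl; last by apply: subset_itv; rewrite bnd_simp.
    rewrite !lcc_restrE//; apply: nu_below.
    + exact: le_trans sa.
    + by rewrite /affine ltrD2l ltr_pM2l.
    + exact: le_trans t1.
  - by rewrite /= in_itv/= => /andP[]; rewrite ltNge a0.
  - by rewrite /= in_itv/= => /andP[_]; rewrite ltNge b1.
move=> mu mu_below B mB B01; have [nu'B nu'oo] := nu'E B mB.
have [B0|B0] := pselect (B 0%R); first by rewrite nu'oo ?leey//; left.
have [B1|B1] := pselect (B 1%R); first by rewrite nu'oo ?leey//; right.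
rewrite nu'B//.
have BI : B `<=` `]0%R, 1%R[%classic.
  move=> r Br; have := B01 _ Br; rewrite /= !in_itv/= => /andP[r0 r1].
  rewrite !lt_neqAle r0 r1 !andbT; apply/andP; split; apply/eqP => r_.
    by apply: B0; rewrite r_.
  by apply: B1; rewrite -r_.
have m01 : measurable (`]0%R, 1%R[%classic : set (measurableTypeR R)) by exact: measurable_itv.
have [mu1 mu1E] := pushforward_measure (mrestr mu m01) (measurable_affine st).
have {}mu1E A : mu1 A = mu (aff @^-1` A `&` `]0%R, 1%R[%classic) by exact: mu1E.
have mu1_below : below_tsep c mu1.
  move=> a b a0 ab b1; rewrite mu1E aff_oo.
  set a' := Num.max (affV a) 0%R; set b' := Num.min (affV b) 1%R.
  rewrite (_ : _ `&` _ = `]a', b'[%classic); last first.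
    apply/seteqP; split => r /=; rewrite !in_itv/= gt_max lt_min.
      by move=> [/andP[-> ->] /andP[-> ->]].
    by move=> /andP[/andP[-> ->] /andP[-> ->]].
  have [a'b'|b'a'] := ltP a' b'; last first.
    rewrite set_itv_ge ?measure0; last by rewrite bnd_simp -leNgt.
    exact: tsep_ge0 a0 (ltW ab) b1.
  have a'0 : (0 <= a')%R by rewrite le_max lexx orbT.
  have b'1 : (b' <= 1)%R by rewrite ge_min lexx orbT.
  apply: le_trans (mu_below a' b' a'0 a'b' b'1) _.
  have a'1 := le_trans (ltW a'b') b'1; have b'0 := le_trans a'0 (ltW a'b').
  rewrite !lcc_restrE//; apply: tsep_mono => //.
  - by rewrite -[leLHS](affine_invK st) affine_le// le_max lexx.
  - by apply: affine_le => //; exact: ltW.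
  - by rewrite -[leRHS](affine_invK st) affine_le// ge_min lexx.
have mAB : measurable (affV @^-1` B).
  by rewrite -[X in measurable X]setTI; exact: measurable_affine_inv.
have sub : affV @^-1` B `<=` `]s, t[%classic.
  by have := affV_oo 0 1; rewrite aff0 aff1 => <- w /BI.
rewrite setIidl//.
have -> : mu B = mu1 (affV @^-1` B).
  rewrite mu1E -comp_preimage; congr (mu _); rewrite setIidl//.
    by apply/seteqP; split => r /=; rewrite affineK.
  by move=> r /=; rewrite affineK// => /BI.
apply: nu_max => //; apply: subset_trans sub _.
by apply: subset_itv; rewrite bnd_simp.
Qed.

Let aff_in01 (r : R) : (0 <= r)%R -> (r <= 1)%R -> `[0%R, 1%R]%classic (aff r).
Proof.
move=> r0 r1; have /andP[h1 h2] := affine_itv st r0 r1.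
by rewrite /= in_itv/= (le_trans s0 h1) (le_trans h2 t1).
Qed.

Let ae_affine (Q : R -> Prop) : {ae lambda, forall w, Q w} -> {ae lambda, forall r, Q (aff r)}.
Proof.
move=> [N [mN N0 QN]]; exists (aff @^-1` N); split.
- by rewrite -[X in measurable X]setTI; exact: measurable_affine.
- have /eqP := lebesgue_measure_affine st mN.
  by rewrite N0 mule_eq0 eqe gt_eqF//= => /eqP.
- by move=> r /= nQ; apply: QN.
Qed.

Let ae_neq (x : R) : {ae lambda, forall r : R, r != x}.
Proof.
exists [set x]; split; [exact: measurable_set1|exact: lebesgue_measure_set1|].
by move=> r /= /negP; rewrite negbK => /eqP.
Qed.

(** The factor [t - s] is the Jacobian. For maximality, a competing density is carried to []s, t[],
    divided by [t - s] and extended by 0. *)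
Lemma rescaled_ac_density (nu nu' : measR) (g : R -> \bar R) :
  is_ac_density nu g ->
  (forall B : set (measurableTypeR R), measurable B ->
    (~ B 0%R -> ~ B 1%R -> nu' B = nu (affV @^-1` B `&` `]s, t[%classic)) /\
    (B 0%R \/ B 1%R -> nu' B = +oo)) ->
  is_ac_density nu' (fun r => (t - s)%:E * g (aff r)).
Proof.
move=> [[mg g0 gnu] g_max] nu'E.
have maff : measurable_fun setT (aff : measurableTypeR R -> measurableTypeR R) := measurable_affine st.
have maffV : measurable_fun setT (affV : measurableTypeR R -> measurableTypeR R) := measurable_affine_inv st.
have mga : measurable_fun [set: R] (fun r => g (aff r)) by exact: (measurableT_comp mg maff).
have ts0E : 0 <= (t - s)%:E by rewrite lee_fin ltW.
have mpre (f : measurableTypeR R -> measurableTypeR R) (B : set (measurableTypeR R)) :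
    measurable_fun setT f -> measurable B -> measurable (f @^-1` B).
  by move=> mf mB; rewrite -[X in measurable X]setTI; exact: mf.
have affVK (B : set (measurableTypeR R)) : aff @^-1` (affV @^-1` B) = B.
  by apply/seteqP; split => r /=; rewrite affineK.
have ge0V : 0 <= ((t - s)^-1)%:E by rewrite lee_fin invr_ge0 ltW.
split.
  split.
  - by apply: emeasurable_funM => //; exact: measurable_cst.
  - by move=> r; rewrite mule_ge0.
  - move=> B mB B01; have [nu'B nu'oo] := nu'E B mB.
    have [B0|B0] := pselect (B 0%R); first by rewrite nu'oo ?leey//; left.
    have [B1|B1] := pselect (B 1%R); first by rewrite nu'oo ?leey//; right.
    rewrite nu'B// ge0_integralZl_EFin//; last exact: measurable_funTS.
    have := integral_affine st (mpre _ _ maffV mB) mg g0; rewrite affVK => <-.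
    have B01' w : B (affV w) -> (s < w < t)%R.
      move=> Bw; have := B01 _ Bw; rewrite /= in_itv/= => /andP[w0 w1].
      suff : (affV @^-1` `]0%R, 1%R[%classic) w by rewrite affV_oo aff0 aff1 /= in_itv.
      rewrite /= in_itv/= !lt_neqAle w0 w1 !andbT; apply/andP; split; apply/eqP => wE.
        by apply: B0; rewrite wE.
      by apply: B1; rewrite -wE.
    rewrite setIidl; last by move=> w /= /B01'; rewrite in_itv.
    apply: gnu; first exact: mpre.
    move=> w /= /B01' /andP[sw wt].
    by rewrite in_itv/= (le_trans s0 (ltW sw)) (le_trans (ltW wt) t1).
move=> h [mh h0 hnu].
pose I : set (measurableTypeR R) := `]s, t[%classic.
have affI : aff @^-1` I = `]0%R, 1%R[%classic by rewrite aff_oo affVs affVt.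
pose h2 w := ((t - s)^-1)%:E * (h (affV w) * (\1_I w)%:E).
have mhV : measurable_fun [set: R] (fun r => h (affV r)) by exact: (measurableT_comp mh maffV).
have mhI : measurable_fun [set: R] (fun w => h (affV w) * (\1_I w)%:E).
  apply: emeasurable_funM => //.
  by apply/measurable_EFinP; apply: measurable_indic; exact: measurable_itv.
have h2_below : density_below nu h2.
  split.
  - by apply: emeasurable_funM => //; exact: measurable_cst.
  - by move=> w; rewrite mule_ge0// mule_ge0// lee_fin.
  - move=> B mB B01.
    have hI0 w : 0 <= h (affV w) * (\1_I w)%:E by rewrite mule_ge0// lee_fin.
    rewrite /h2 ge0_integralZl_EFin//; last exact: measurable_funTS.
    rewrite (integral_affine st)//.
    rewrite muleA -EFinM mulVf ?gt_eqF// mul1e.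
    pose B' : set (measurableTypeR R) := aff @^-1` B `&` `]0%R, 1%R[%classic.
    have mB' : measurable B' by apply: measurableI; [exact: mpre|exact: measurable_itv].
    have -> : \int[lambda]_(r in aff @^-1` B) (h (affV (aff r)) * (\1_I (aff r))%:E) =
        \int[lambda]_(r in B') h r.
      rewrite /B' integral_mkcondr; apply: eq_integral => r _; rewrite affineK// epatch_indic.
      by rewrite -affI.
    apply: le_trans (hnu B' mB' _) _.
      by move=> r [_] /=; rewrite !in_itv/= => /andP[/ltW -> /ltW ->].
    have [+ _] := nu'E B' mB'; move=> ->.
    + apply: le_measure; rewrite ?inE//.
        by apply: measurableI; [exact: mpre|exact: measurable_itv].
      by move=> w [[/=]]; rewrite affine_invK.
    + by move=> [_] /=; rewrite in_itv/= ltxx.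
    + by move=> [_] /=; rewrite in_itv/= ltxx andbF.
have FF : Filter (nbhs (almost_everywhere lambda)).
  exact: (@ae_filter_ringOfSetsType _ (measurableTypeR R) R lambda).
(* At 0 and 1 the cut-off to the open interval loses the bound; these two points are negligible. *)
apply: filterS3 (ae_affine (g_max h2 h2_below)) (ae_neq 0%R) (ae_neq 1%R) => r H r0 r1.
rewrite /= in_itv/= => /andP[r0' r1'].
have := H (aff_in01 r0' r1'); rewrite /h2 affineK// indicE mem_set; last first.
  suff : (aff @^-1` I) r by [].
  by rewrite affI /= in_itv/= !lt_neqAle r0' r1' eq_sym r0 r1.
rewrite mule1 => hg; have := lee_wpmul2l ts0E hg.
by rewrite muleA -EFinM divff ?gt_eqF// mul1e.
Qed.

(** If the speed of [c] is the default 0, the bound is trivial. Otherwise the rescaled pair shows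
    that the restricted curve has a genuine speed, and its chosen density dominates the rescaled one
    because any two largest measures agree on [[0, 1]]. This direction suffices to bound [G] along
    the piece. *)
Lemma causal_speed_restr (c : lcc X) :
  {ae lambda, forall r : R, `[0%R, 1%R]%classic r ->
    (t - s)%:E * causal_speed c (aff r) <= causal_speed (restr c) r}.
Proof.
have [[nu nu_largest g_ac]|[-> _]] := causal_speedP c; last first.
  apply: aeW => r _; rewrite mule0.
  by have [_] := causal_speed_measurable (restr c); exact.
have [nu' nu'E] := rescaled_measure nu st.
have l' := rescaled_largest_below nu_largest nu'E.
have ac' := rescaled_ac_density g_ac nu'E.
have [[nu1 nu1_largest g1_ac]|[_ nog]] := causal_speedP (restr c); last first.
  by exfalso; exact: nog l' ac'.
have [_ g1_max] := g1_ac; apply: g1_max.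
have [[mg' g'0 g'nu'] _] := ac'; split => // B mB B01.
apply: le_trans (g'nu' B mB B01) _.
by have [_] := nu1_largest; apply => //; have [] := l'.
Qed.

Lemma integral_speed_restr (c : lcc X) (G : X -> \bar R) : nneg_borel G ->
  \int[lambda]_(r in `[s, t]) (G (c r) * causal_speed c r) <=
  \int[lambda]_(r in `[0%R, 1%R]) (G (restr c r) * causal_speed (restr c) r).
Proof.
move=> [mG G0].
have [mv v0] := causal_speed_measurable c.
have [mv' v'0] := causal_speed_measurable (restr c).
have mGc (e : lcc X) : measurable_fun [set: R] (fun r => G (e r)).
  by exact: (measurableT_comp mG (measurable_lcc hd e)).
have ts0E : 0 <= (t - s)%:E by rewrite lee_fin ltW.
have mh : measurable_fun [set: R] (fun r => G (c r) * causal_speed c r).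
  exact: emeasurable_funM.
have h0 r : 0 <= G (c r) * causal_speed c r by exact: mule_ge0.
rewrite (integral_affine st (measurable_itv _) mh h0).
have maff : measurable_fun setT (aff : measurableTypeR R -> measurableTypeR R) := measurable_affine st.
rewrite (affine_preimage_itv st) affVs affVt.
rewrite -ge0_integralZl_EFin ?(ltW ts0)//; last first.
  by apply: measurable_funTS; exact: (measurableT_comp mh maff).
apply: (@ae_ge0_le_integral _ (measurableTypeR R) R lambda) => //.
- by move=> r _; rewrite !mule_ge0.
- apply: measurable_funTS; apply: emeasurable_funM; first exact: measurable_cst.
  exact: (measurableT_comp mh maff).
- by move=> r _; exact: mule_ge0.
- by apply: measurable_funTS; apply: emeasurable_funM; [exact: mGc|].
have FF : Filter (nbhs (almost_everywhere lambda)).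
  exact: (@ae_filter_ringOfSetsType _ (measurableTypeR R) R lambda).
apply: filterS (causal_speed_restr c) => r H r01; have {}H := H r01.
have /andP[r0 r1] : (0 <= r <= 1)%R by move: r01; rewrite /= in_itv.
by rewrite lcc_restrE// muleCA lee_wpmul2l.
Qed.

End restriction.

End speed_of_a_restriction.

(** * Upper integrals *)

Section upper_integrals.
Local Open Scope ereal_scope.
Context d (T : measurableType d) (R : realType).
Variable mu : {measure set T -> \bar R}.

Lemma ge0_integral_mrestr (D : set T) (mD : measurable D) (f : T -> \bar R) :
  measurable_fun setT f -> (forall x, 0 <= f x) ->
  \int[mrestr mu mD]_x f x = \int[mu]_(x in D) f x.
Proof.
move=> mf f0; have -> := @ge0_negligible_integral _ _ _ (mrestr mu mD) setT (~` D) f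
  (measurableC mD) measurableT mf (fun x _ => f0 x).
  rewrite setTD setCK; apply: eq_measure_integral => A mA AD.
  by rewrite -[LHS]/(mu (A `&` D)) setIidl.
by rewrite -[LHS]/(mu (~` D `&` D)) setICl measure0.
Qed.

Definition upper_integral_on (D : set T) (F : T -> \bar R) : \bar R :=
  ereal_inf [set \int[mu]_(x in D) h x | h in
    [set h : T -> \bar R | measurable_fun setT h /\ forall x, F x <= h x]].

Variables (F k : T -> \bar R).
Hypothesis F0 : forall x, 0 <= F x.
Hypotheses (mk : measurable_fun setT k) (k0 : forall x, 0 <= k x).
Hypothesis mu_fin : mu setT < +oo.
Hypothesis H : forall D, measurable D -> 0 < mu D ->
  upper_integral_on D F <= \int[mu]_(x in D) k x.

Let fin_mu D : measurable D -> mu D \is a fin_num.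
Proof.
move=> mD; rewrite ge0_fin_numE//; apply: le_lt_trans mu_fin.
by apply: le_measure; rewrite ?inE.
Qed.

(* [h] is a minimal measurable majorant of [F] on [k <= n].  On a set of positive
   measure where [h] exceeds [k], the hypothesis would provide a smaller one. *)
Let ae_le_on (n : nat) : {ae mu, forall x, k x <= n%:R%:E -> F x <= k x}.
Proof.
(* Truncating [k] makes the upper integral finite, without which strict comparisons of integrals are
   impossible. *)
pose D := [set x | k x <= n%:R%:E].
have mD : measurable D.
  by rewrite -[D]setTI; exact: emeasurable_fun_infty_c.
have [muD0|muD0] := eqVneq (mu D) 0.
  by exists D; split => // x /= /not_implyP[].
have {muD0} muD0 : 0 < mu D by rewrite lt0e muD0/=.
pose I := upper_integral_on D F.
have I0 : 0 <= I.
  apply: le_ereal_inf_tmp => _ [h [_ Fh] <-].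
  by apply: integral_ge0 => x _; exact: le_trans (Fh x).
have Ifin : I \is a fin_num.
  rewrite ge0_fin_numE//; apply: le_lt_trans (H mD muD0) _.
  apply: (@le_lt_trans _ _ (\int[mu]_(x in D) n%:R%:E)).
    exact: le_integral_nonneg.
  by rewrite integral_cst//= lte_mul_pinfty// ?lee_fin// -ge0_fin_numE// fin_mu.
have [h_ hP] : {h_ : nat -> T -> \bar R & forall j,
    [/\ measurable_fun setT (h_ j), forall x, F x <= h_ j x &
        \int[mu]_(x in D) h_ j x < I + (j.+1%:R^-1)%:E]}.
  apply: (@choice _ _ (fun j h => [/\ measurable_fun setT h, forall x, F x <= h x &
        \int[mu]_(x in D) h x < I + (j.+1%:R^-1)%:E])) => j.
  have j0 : (0 < j.+1%:R^-1 :> R)%R by rewrite invr_gt0.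
  by have [_ [h [mh Fh] <-] hI] := lb_ereal_inf_adherent j0 Ifin; exists h.
(* The infimum of almost optimal majorants attains the upper integral [I]. *)
pose h x := einfs (h_ ^~ x) 0%N.
have mh : measurable_fun setT h.
  by apply: measurable_fun_einfs => j; have [] := hP j.
have Fh x : F x <= h x.
  by apply: le_ereal_inf_tmp => _ [j _ <-]; have [] := hP j.
have h0 x : 0 <= h x := le_trans (F0 x) (Fh x).
have hI : \int[mu]_(x in D) h x <= I.
  apply/lee_addgt0Pr => e e0.
  have [_ _ hj] := hP (Num.trunc e^-1).
  apply: le_trans (_ : \int[mu]_(x in D) h_ (Num.trunc e^-1) x <= _).
    apply: le_integral_nonneg => // x _.
    by apply: ereal_inf_lbound; exists (Num.trunc e^-1).
  apply: le_trans (ltW hj) _; rewrite leeD2l// lee_fin.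
  by rewrite -[leRHS]invrK lef_pV2 ?posrE ?invr_gt0// ltW// truncnS_gt.
pose B (m : nat) := D `&` [set x | k x + (m.+1%:R^-1)%:E < h x].
have mB m : measurable (B m).
  apply: measurableI => //; rewrite -[X in measurable X]setTI.
  by apply: emeasurable_fun_lt => //; apply: emeasurable_funD.
have B0 m : mu (B m) = 0.
  apply/eqP; rewrite eq_le measure_ge0 andbT leNgt; apply/negP => muB.
  have m0 : (0 < m.+1%:R^-1 :> R)%R by rewrite invr_gt0.
  have kB : \int[mu]_(x in B m) k x \is a fin_num.
    rewrite ge0_fin_numE; last exact: integral_ge0.
    apply: (@le_lt_trans _ _ (\int[mu]_(x in B m) n%:R%:E)).
      by apply: le_integral_nonneg => // x [].
    by rewrite integral_cst//= lte_mul_pinfty// ?lee_fin// -ge0_fin_numE// fin_mu.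
  have lt1 : upper_integral_on (B m) F < \int[mu]_(x in B m) h x.
    apply: le_lt_trans (H (mB m) muB) _.
    apply: (@lt_le_trans _ _ (\int[mu]_(x in B m) (k x + (m.+1%:R^-1)%:E))).
      rewrite ge0_integralD//; last by first [exact: measurable_funTS|move=> *; rewrite lee_fin ltW].
      rewrite integral_cst//= lteDl//.
      by rewrite mule_gt0// lte_fin.
    apply: le_integral_nonneg => x [_ /= /ltW //].
    by move=> _; rewrite adde_ge0// lee_fin ltW.
  have [_ [h' [mh' Fh'] <-] h'lt] := ereal_inf_lt lt1.
  (* Splicing [h'] on [B m] with [h] elsewhere gives a measurable majorant of [F] whose integral
     over [D] is below [I]. *)
  pose h2 x := if x \in B m then h' x else h x.
  have mh2 : measurable_fun setT h2.
    apply: measurable_fun_ifT => //.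
    apply: (measurable_fun_bool true); rewrite setTI (_ : _ @^-1` _ = B m)//.
    by apply/seteqP; split => x /= xB; [exact: set_mem|exact: mem_set].
  have Fh2 x : F x <= h2 x by rewrite /h2; case: ifP.
  have h20 x : 0 <= h2 x := le_trans (F0 x) (Fh2 x).
  have split_int g : measurable_fun setT g -> (forall x, 0 <= g x) ->
      \int[mu]_(x in D) g x = \int[mu]_(x in B m) g x + \int[mu]_(x in D `\` B m) g x.
    move=> mg g0; rewrite -ge0_integral_setU//.
    - by rewrite setDUK//; move=> x [].
    - exact: measurableD.
    - exact: measurable_funTS.
    - by apply/disj_set2P; rewrite setIDA setIC -setIDA setDv setI0.
  have : I <= \int[mu]_(x in D) h2 x by apply: ereal_inf_lbound; exists h2.
  apply/negP; rewrite -ltNge; apply: (lt_le_trans _ hI).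
  rewrite (split_int _ mh2 h20) (split_int _ mh h0).
  have -> : \int[mu]_(x in B m) h2 x = \int[mu]_(x in B m) h' x.
    by apply: eq_integral => x xB; rewrite /h2 xB.
  have -> : \int[mu]_(x in D `\` B m) h2 x = \int[mu]_(x in D `\` B m) h x.
    apply: eq_integral => x; rewrite inE => -[_ xB]; rewrite /h2.
    by case: ifPn => // /set_mem.
  apply: lte_leD => //.
  rewrite ge0_fin_numE; last exact: integral_ge0.
  apply: le_lt_trans (_ : I < +oo); last by rewrite -ge0_fin_numE.
  apply: le_trans hI; apply: ge0_subset_integral => //.
  - exact: measurableD.
  - exact: measurable_funTS.
apply: (@negligibleS _ _ _ _ (\bigcup_m B m)); last first.
  by apply: negligible_bigcup => m; apply/(negligibleP _ (mB m)); exact: B0.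
move=> x /= /not_implyP[kn /negP]; rewrite -ltNge => kF.
  have kfin : k x \is a fin_num.
    by rewrite ge0_fin_numE// (le_lt_trans kn)// ltry.
  have kh : k x < h x := lt_le_trans kF (Fh x).
  have kr : (0 < fine (h x) - fine (k x))%R \/ h x = +oo.
    case: (h x) (k x) kfin kh => [a| |] [b| |] //= _; last by right.
    by rewrite lte_fin -subr_gt0; left.
  have [m hm] : exists m : nat, k x + (m.+1%:R^-1)%:E < h x.
    case: kr => [hk|->]; last first.
      by exists 0%N; rewrite -ge0_fin_numE ?adde_ge0 ?lee_fin// fin_numD kfin.
    exists (Num.trunc (fine (h x) - fine (k x))^-1); rewrite -lteBrDl//.
    have hfin : h x \is a fin_num \/ h x = +oo.
      by move: (h0 x); case: (h x) => [?| |]; [left|right|].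
    case: hfin => [hfin|->]; last by rewrite -(fineK kfin) ltry.
    rewrite -(fineK hfin) -(fineK kfin) -EFinB lte_fin.
    by rewrite -[ltRHS]invrK ltf_pV2 ?posrE ?invr_gt0// truncnS_gt.
  by exists m.
Qed.

(** Turns integrated bounds into a pointwise one although the set where [k x < F x] need not be
    measurable. It is applied with [F] the time integral of [G] against the speed, and with the sets
    [D] on which plans are conditioned. *)
Lemma ae_le_of_upper_integral : {ae mu, forall x, F x <= k x}.
Proof.
have : {ae mu, forall x (n : nat), k x <= n%:R%:E -> F x <= k x}.
  by apply: ae_foralln => n; exact: ae_le_on.
apply: filterS => x Hx; have [->|kx] := eqVneq (k x) +oo; first exact: leey.
have kfin : k x \is a fin_num by rewrite ge0_fin_numE// ltey.
apply: (Hx (Num.trunc (fine (k x))).+1).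
by rewrite -[leLHS](fineK kfin) lee_fin ltW// truncnS_gt.
Qed.

End upper_integrals.

(** * Weak subslopes along curves *)

Section borel_modification.
Context (R : realType) (X : mmSpacetime R).

(** The preimages of the rays below rational numbers are enclosed between Borel sets, and [N]
    collects the differences. The value on [N] is left free since three are used: [+oo] and [-oo] to
    bound increments of [f], and 0 for a plain Borel representative. *)
Lemma ae_measurable_modification (f : X -> \bar R) : ae_measurable f ->
  exists N : set X, [/\ measurable (N : set (borel X)), vol X N = 0%E &
    forall a : \bar R,
      measurable_fun [set: borel X] (fun x : borel X => if x \in N then a else f x)].
Proof.
move=> hf.
pose q_ (n : nat) : R := ratr (odflt 0 (unpickle n)).
have q_rat (q : rat) : q_ (pickle q) = ratr q by rewrite /q_ pickleK.
have hq n : exists A : set (borel X) * set (borel X),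
    [/\ measurable A.1, measurable A.2,
      A.1 `<=` f @^-1` `]-oo, (q_ n)%:E[%classic,
      f @^-1` `]-oo, (q_ n)%:E[%classic `<=` A.2 &
      vol X (A.2 `\` A.1) = 0%E].
  have [A1 [A2 [? ? ? ? ?]]] := hf `]-oo, (q_ n)%:E[%classic (emeasurable_itv _).
  by exists (A1, A2).
have {hq} [A AP] := choice hq.
pose N : set (borel X) := \bigcup_n ((A n).2 `\` (A n).1).
have mD n : measurable ((A n).2 `\` (A n).1).
  by have [? ? _ _ _] := AP n; exact: measurableD.
have mN : measurable N by exact: bigcupT_measurable.
exists N; split => // [|a].
  apply/(negligibleP _ mN); apply: negligible_bigcup => n.
  by apply/(negligibleP _ (mD n)); have [] := AP n.
apply: (@measurability _ _ (borel X) (\bar R) setT _ (@ErealGenInftyO.G R)) => [|/= _ [_ [r ->] <-]].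
  exact: ErealGenInftyO.measurableE.
rewrite setTI.
(* Outside [N] the inner sets [(A n).1] are the exact preimages, and rays below rationals exhaust
   the ray below [r]. *)
rewrite (_ : _ @^-1` _ = (if (a < r%:E)%E then N else set0) `|`
    (~` N `&` \bigcup_n (if q_ n <= r then (A n).1 else set0))).
  apply: measurableU; first by case: ifP.
  apply: measurableI; first exact: measurableC.
  apply: bigcupT_measurable => n; case: ifP => // _.
  by have [] := AP n.
apply/seteqP; split => x /=.
  rewrite in_itv/=; case: ifPn => [/set_mem Nx ar|/negP Nx fr]; first by left; rewrite ar.
  have {}Nx : ~ N x by move=> h; apply: Nx; exact: mem_set.
  right; split => //.
  have [n [qr fq]] : exists n, q_ n <= r /\ (f x < (q_ n)%:E)%E.
    move: fr; case: (f x) => [s| |] //; last first.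
      move=> _; have r1 : r - 1 < r by rewrite gtrBl.
      have [q] := rat_in_itvoo r1; rewrite in_itv/= => /andP[_ /ltW qr].
      by exists (pickle q); rewrite q_rat qr ltNyr.
    rewrite lte_fin => sr; have [q] := rat_in_itvoo sr.
    by rewrite in_itv/= => /andP[sq /ltW qr]; exists (pickle q); rewrite q_rat qr lte_fin.
  exists n => //; rewrite qr; have [_ _ _ sub _] := AP n.
  apply: contrapT => nA; apply: Nx; exists n => //; split => //.
  by apply: sub; rewrite /= in_itv.
rewrite in_itv/= => -[|[Nx [n _]]].
  by case: ifPn => // ar Nx; rewrite mem_set.
case: ifPn => // qr Aq; rewrite memNset//; have [_ _ sub _ _] := AP n.
have := sub _ Aq; rewrite /= in_itv/= => /lt_le_trans; apply.
by rewrite lee_fin.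
Qed.

End borel_modification.

Section increments.
Local Open Scope ereal_scope.
Context (R : realType).

(** A version of [subx] that is nonnegative everywhere: modified values of [f] along a curve need
    not be ordered. *)
Definition increment (x y : \bar R) : \bar R :=
  if (x == +oo) || (y == -oo) then +oo else maxe 0 (x - y).

Lemma increment_ge0 x y : 0 <= increment x y.
Proof. by rewrite /increment; case: ifP => _; rewrite ?leey// le_max lexx. Qed.

Lemma subx_increment x y : y <= x -> subx x y = increment x y.
Proof.
rewrite /increment; case: x y => [r| |] [s| |] //=.
by rewrite lee_fin => sr; rewrite -EFinB; apply/esym/max_idPr; rewrite lee_fin subr_ge0.
Qed.

Lemma subx_ge0 (x y : \bar R) : y <= x -> 0 <= subx x y.
Proof. by move=> yx; rewrite subx_increment// increment_ge0. Qed.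

Lemma measurable_increment d (T : measurableType d) (f g : T -> \bar R) :
  measurable_fun setT f -> measurable_fun setT g ->
  measurable_fun setT (fun x => increment (f x) (g x)).
Proof.
move=> mf mg; apply: measurable_fun_ifT => //.
  apply: measurable_or => /=.
    apply: (measurable_fun_bool true); rewrite setTI (_ : _ @^-1` _ = f @^-1` [set +oo]).
      by rewrite -[X in measurable X]setTI; exact: mf.
    by apply/seteqP; split => x /= /eqP.
  apply: (measurable_fun_bool true); rewrite setTI (_ : _ @^-1` _ = g @^-1` [set -oo]).
    by rewrite -[X in measurable X]setTI; exact: mg.
  by apply/seteqP; split => x /= /eqP.
by apply: measurable_maxe => //; exact: emeasurable_funB.
Qed.

End increments.

Section restricted_plans.
Local Open Scope ereal_scope.
Context (R : realType) (X : mmSpacetime R) (d : X -> X -> R).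
Hypothesis hd : bounded_distance d.
Variables (P : probability (borel_lcc d) R) (tP : test_plan P).

(* [P'] is the law of the restriction to [s, t] of a curve drawn from [P]
   conditioned on [D]. *)
Lemma restricted_plan (D : set (borel_lcc d)) (s t : R) (s0 : (0 <= s)%R)
    (st : (s < t)%R) (t1 : (t <= 1)%R) : measurable D -> 0 < P D ->
  exists2 P' : probability (borel_lcc d) R, test_plan P' &
  exists2 k : R, (0 < k)%R & forall h, measurable_fun setT h -> (forall c, 0 <= h c) ->
    \int[P']_c h c = k%:E * \int[P]_(c in D) h (lcc_restr s0 st t1 c).
Proof.
move=> mD PD; have mr := measurable_lcc_restr s0 st t1 hd.
have PDfin : P D \is a fin_num.
  by rewrite ge0_fin_numE// (le_lt_trans (probability_le1 P mD))// ltry.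
pose k := (fine (P D))^-1%R; have k0 : (0 < k)%R.
  by rewrite invr_gt0 fine_gt0// PD -ge0_fin_numE.
have [nu nuE] := pushforward_measure (mrestr P mD) mr.
have nuT : nu setT = P D by rewrite nuE preimage_setT -[LHS]/(P (setT `&` D)) setTI.
pose P' : probability (borel_lcc d) R := mnormalize nu P.
have P'E A : P' A = k%:E * P (lcc_restr s0 st t1 @^-1` A `&` D).
  rewrite /P' /= /mnormalize/= nuT gt_eqF//= lt_eqF -?ge0_fin_numE//=.
  by rewrite nuE muleC.
exists P'.
  have [C C0 HC] := tP; exists (k * C)%R; first exact: mulr_gt0.
  move=> r r0 r1 A mA; rewrite P'E EFinM -muleA; apply: lee_wpmul2l.
    by rewrite lee_fin ltW.
  have /andP[h1 h2] := affine_itv st r0 r1.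
  apply: le_trans (HC (affine s t r) (le_trans s0 h1) (le_trans h2 t1) A mA).
  have -> : lcc_restr s0 st t1 @^-1` [set c : lcc X | A (c r)] =
    [set c : lcc X | A (c (affine s t r))].
    by apply/seteqP; split => c; rewrite /preimage /mkset lcc_restrE.
  by apply: measureIl => //; exact: measurable_eval_set.
exists k => // h mh h0.
rewrite -(ge0_integral_mrestr P mD (measurableT_comp mh mr) (fun c => h0 (lcc_restr s0 st t1 c))).
rewrite -(ge0_integral_pushforward mr (mrestr P mD) measurableT mh)//.
rewrite -[k%:E]/((NngNum (ltW k0))%:num%:E) -ge0_integral_mscale//.
by apply: eq_measure_integral => A mA _; exact: P'E.
Qed.

Variables (f G : X -> \bar R).
Hypotheses (hf : causal_function f) (hG : weak_subslope d f G).

Lemma weak_subslope_along_curves : {ae P, forall c,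
  increments_dominate (fun t : R => G ((c : lcc X) t) * causal_speed c t)
    (fun t => f ((c : lcc X) t))}.
Proof.
have [N [mN N0 mfN]] := ae_measurable_modification hf.1.
have [mG G0] := hG.1.
pose e1 (a : \bar R) (t : R) (c : borel_lcc d) :=
  if (c : lcc X) t \in N then a else f ((c : lcc X) t).
have me1 a t : measurable_fun setT (e1 a t).
  exact: (measurableT_comp (mfN a) (measurable_eval hd t)).
(* With [+oo] at the later time and [-oo] at the earlier one, [kk] is a measurable upper bound for
   the increment of [f] along every curve, with equality when neither end lies in [N]. *)
pose kk (s t : R) c := increment (e1 +oo t c) (e1 -oo s c).
have FP : Filter (nbhs (almost_everywhere P)) := ae_filter_ringOfSetsType P.
have mkk s t : measurable_fun setT (kk s t) by exact: measurable_increment.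
have kk0 s t c : 0 <= kk s t c by exact: increment_ge0.
have subx_kk s t (c : lcc X) : (0 <= s)%R -> (s <= t)%R -> (t <= 1)%R ->
    subx (f (c t)) (f (c s)) <= kk s t c.
  move=> s0 st t1; have fst := hf.2 _ _ (lcc_causal c s0 st t1).
  rewrite /kk /e1; case: ifP => _; first by rewrite /increment eqxx leey.
  case: ifP => _; first by rewrite /increment eqxx orbT leey.
  by rewrite subx_increment.
have key (s t : R) : (0 <= s)%R -> (s < t)%R -> (t <= 1)%R ->
    {ae P, forall c, \int[lebesgue_measure]_(r in `[s, t])
      (G ((c : lcc X) r) * causal_speed c r) <= kk s t c}.
  move=> s0 st t1.
  apply: ae_le_of_upper_integral => //.
  - by move=> c; apply: integral_ge0 => r _; apply: mule_ge0 => //;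
      have [_] := causal_speed_measurable c.
  - by apply: le_lt_trans (probability_le1 P _) (ltry 1).
  move=> D mD PD; have [P' tP' [k k0 kP']] := restricted_plan s0 st t1 mD PD.
  have kE : (0 < k%:E :> \bar R) by rewrite lte_fin.
  rewrite -(lee_pmul2l _ kE)//.
  apply: (@le_trans _ _ (plan_integral P' G)).
    apply: le_ereal_inf_tmp => _ [h [mh Fh] <-].
    have h0 c : 0 <= h c.
      apply: le_trans (Fh c); apply: integral_ge0 => r _; apply: mule_ge0 => //.
      by have [_] := causal_speed_measurable (c : lcc X).
    rewrite kP'//; apply: lee_wpmul2l; first by rewrite lee_fin ltW.
    apply: ereal_inf_lbound; exists (h \o lcc_restr s0 st t1 : borel_lcc d -> \bar R) => //.
    split; first exact: (measurableT_comp mh (measurable_lcc_restr s0 st t1 hd)).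
    move=> c; apply: le_trans (Fh (lcc_restr s0 st t1 c)).
    exact: (integral_speed_restr s0 st t1 hd c hG.1).
  apply: (le_trans (hG.2 _ tP')).
  apply: (@le_trans _ _ (\int[P']_c kk 0%R 1%R c)).
    apply: le_integral_nonneg => c _; last exact: subx_kk.
    by apply: subx_ge0; apply: hf.2; exact: lcc_causal.
  rewrite kP'//; apply: lee_wpmul2l; first by rewrite lee_fin ltW.
  apply: le_integral_nonneg => c _ //.
  by rewrite /kk /e1 !lcc_restrE// /affine mulr1 mulr0 addr0 addrC subrK.
have eval_null (r : R) : (0 <= r)%R -> (r <= 1)%R -> {ae P, forall c, ~ N ((c : lcc X) r)}.
  move=> r0 r1; exists [set c : lcc X | N (c r)]; split.
  - exact: measurable_eval_set.
  - exact: test_plan_null.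
  - by move=> c /= /contrapT.
have step (p q : rat) : {ae P, forall c,
    (0 <= ratr p :> R)%R -> (ratr p < ratr q :> R)%R -> (ratr q <= 1 :> R)%R ->
    \int[lebesgue_measure]_(r in `[ratr p, ratr q])
      (G ((c : lcc X) r) * causal_speed c r) <=
    subx (f ((c : lcc X) (ratr q))) (f ((c : lcc X) (ratr p)))}.
  have [p0|p0] := boolP (0 <= ratr p :> R)%R; last by apply: aeW.
  have [pq|pq] := boolP (ratr p < ratr q :> R)%R; last by apply: aeW.
  have [q1|q1] := boolP (ratr q <= 1 :> R)%R; last by apply: aeW.
  have := key _ _ p0 pq q1.
  have := eval_null _ p0 (le_trans (ltW pq) q1).
  have := eval_null _ (le_trans p0 (ltW pq)) q1.
  apply: filterS3 => c Nq Np + _ _ _.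
  rewrite /kk /e1 !memNset// -subx_increment//.
  by apply: hf.2; apply: lcc_causal => //; exact: ltW.
(* Pairs of rationals are coded by natural numbers, so that a single null set of curves serves for
   all of them. *)
have : {ae P, forall c (n : nat), forall p q : rat, unpickle n = Some (p, q) ->
    (0 <= ratr p :> R)%R -> (ratr p < ratr q :> R)%R -> (ratr q <= 1 :> R)%R ->
    \int[lebesgue_measure]_(r in `[ratr p, ratr q])
      (G ((c : lcc X) r) * causal_speed c r) <=
    subx (f ((c : lcc X) (ratr q))) (f ((c : lcc X) (ratr p)))}.
  apply: ae_foralln => n.
  case: (unpickle n : option (rat * rat)) => [[p q]|]; last by apply: aeW.
  by apply: filterS (step p q) => c + p' q' [<- <-].
apply: filterS => c Hc p q; apply: (Hc (pickle (p, q))).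
exact: pickleK.
Qed.

End restricted_plans.

(** * Chain rule for slopes *)

#[local] Instance lebesgue_ae_filter (R : realType) :
  Filter (nbhs (almost_everywhere (@lebesgue_measure R))).
Proof. exact: (@ae_filter_ringOfSetsType _ (measurableTypeR R) R). Qed.

#[local] Instance plan_ae_filter (R : realType) (X : mmSpacetime R) (d : X -> X -> R)
  (P : probability (borel_lcc d) R) : Filter (nbhs (almost_everywhere P)).
Proof. exact: ae_filter_ringOfSetsType. Qed.

#[local] Instance vol_ae_filter (R : realType) (X : mmSpacetime R) :
  Filter (nbhs (almost_everywhere (vol X))).
Proof. exact: ae_filter_ringOfSetsType. Qed.

Section curvewise_criteria.
Local Open Scope ereal_scope.
Context (R : realType) (X : mmSpacetime R) (d : X -> X -> R).
Hypothesis hd : bounded_distance d.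
Local Notation lambda := (@lebesgue_measure R).

Lemma upper_integral_ae_le d' (T : measurableType d') (mu : {measure set T -> \bar R})
    (F k : T -> \bar R) : measurable_fun setT k -> (forall x, 0 <= k x) ->
  {ae mu, forall x, F x <= k x} -> upper_integral mu F <= \int[mu]_x k x.
Proof.
move=> mk k0 [N [mN N0 HN]].
pose h x := if x \in N then +oo else k x.
have mh : measurable_fun setT h.
  apply: measurable_fun_ifT => //.
  apply: (measurable_fun_bool true); rewrite setTI (_ : _ @^-1` _ = N)//.
  by apply/seteqP; split => x /= xB; [exact: set_mem|exact: mem_set].
apply: (@le_trans _ _ (\int[mu]_x h x)).
  apply: ereal_inf_lbound; exists h => //; split => // x; rewrite /h.
  case: ifPn => [_|xN]; first exact: leey.
  by apply: contrapT => Fk; move: xN; rewrite mem_set//; exact: HN.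
rewrite (ge0_negligible_integral mN _ mh _ N0)//; last first.
  by move=> x _; rewrite /h; case: ifP.
rewrite (ge0_negligible_integral mN _ mk _ N0)//.
apply: le_integral_nonneg => x [_ xN]; first by rewrite /h memNset.
by rewrite /h memNset.
Qed.

(** The increment of [f] need not be measurable, so it is compared with the Borel function [k]: from
    below for the curvewise bound and, outside a null set of curves, from above for the final
    integral. *)
Lemma weak_subslope_of_curves (f G : X -> \bar R) : causal_function f ->
    nneg_borel G ->
    (forall P : probability (borel_lcc d) R, test_plan P -> {ae P, forall c,
      \int[lambda]_(t in `[0%R, 1%R]) (G ((c : lcc X) t) * causal_speed c t) <=
      subx (f ((c : lcc X) 1%R)) (f ((c : lcc X) 0%R))}) ->
  weak_subslope d f G.
Proof.
move=> hf hG H; split => // P tP.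
have [N [mN N0 mfN]] := ae_measurable_modification hf.1.
pose e1 (a : \bar R) (t : R) (c : borel_lcc d) :=
  if (c : lcc X) t \in N then a else f ((c : lcc X) t).
have me1 a t : measurable_fun setT (e1 a t).
  exact: (measurableT_comp (mfN a) (measurable_eval hd t)).
pose k c := increment (e1 +oo 1%R c) (e1 -oo 0%R c).
have mk : measurable_fun setT k by exact: measurable_increment.
have k0 c : 0 <= k c by exact: increment_ge0.
have f01 (c : lcc X) : f (c 0%R) <= f (c 1%R) by apply: hf.2; exact: lcc_causal.
have subx_k (c : lcc X) : subx (f (c 1%R)) (f (c 0%R)) <= k c.
  rewrite /k /e1; case: ifP => _; first by rewrite /increment eqxx leey.
  case: ifP => _; first by rewrite /increment eqxx orbT leey.
  by rewrite subx_increment.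
apply: (@le_trans _ _ (\int[P]_c k c)).
  apply: upper_integral_ae_le => //.
  apply: filterS (H _ tP) => c Hc; exact: le_trans Hc (subx_k c).
(* Only the two end times matter here, so it suffices to discard the curves that start or end in
   [N]. *)
pose E := [set c : lcc X | N (c 0%R)] `|` [set c : lcc X | N (c 1%R)].
have mE : measurable (E : set (borel_lcc d)).
  by apply: measurableU; exact: measurable_eval_set.
have E0 : P E = 0.
  apply/eqP; rewrite eq_le measure_ge0 andbT.
  apply: le_trans (measureU2 _ _ _) _; try exact: measurable_eval_set.
  rewrite [X in X + _](test_plan_null tP mN N0 (lexx _) ler01).
  by rewrite [X in _ + X](test_plan_null tP mN N0 ler01 (lexx _)) adde0.
rewrite (ge0_negligible_integral mE measurableT mk (fun c _ => k0 c) E0).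
rewrite integral_mkcond; apply: le_integral_nonneg => c _.
  by rewrite patchE; case: ifP.
rewrite patchE; case: ifPn => [/set_mem[_ cE]|_]; last exact: subx_ge0.
have [N0' N1'] : ~ N ((c : lcc X) 0%R) /\ ~ N ((c : lcc X) 1%R).
  by split => Nc; apply: cE; [left|right].
by rewrite /k /e1 !memNset// -subx_increment.
Qed.

(** Monotonicity on the whole line comes from the constant extension of curves;
    [nondecreasing_emeasurable] asks for it in this form. *)
Lemma causal_function_along (f : X -> \bar R) (c : lcc X) : causal_function f ->
  {homo (fun t => f (c t)) : s t / (s <= t)%R >-> s <= t}.
Proof.
move=> hf s t st; apply: hf.2.
have clampE (r : R) : c r = c (unit_clamp r).
  have [r0|r0] := ltP r 0%R.
    rewrite (lcc_before c r0); congr (c _); apply/esym/max_idPl.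
    by rewrite ge_min (ltW r0).
  have [r1|r1] := ltP 1%R r; last by rewrite unit_clamp_id.
  rewrite (lcc_after c r1); congr (c _).
  by rewrite /unit_clamp (min_idPr (ltW r1)); apply/esym/max_idPr.
rewrite (clampE s) (clampE t); apply: lcc_causal.
- exact: unit_clamp_ge0.
- by rewrite /unit_clamp ge_max !le_max lexx/= le_min !ge_min st lexx !orbT.
- exact: unit_clamp_le1.
Qed.

Section modified_function.
Variables (f ft : X -> \bar R) (N : set X).
Hypotheses (hf : causal_function f).
Hypotheses (mN : measurable (N : set (borel X))) (N0 : vol X N = 0).
Hypothesis mft : measurable_fun [set: borel X] (ft : borel X -> \bar R).
Hypothesis ftE : forall x, ~ N x -> ft x = f x.

Lemma modification_along_curves (P : probability (borel_lcc d) R) : test_plan P ->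
  {ae P, forall c, {ae lambda, forall t : R,
    `[0%R, 1%R]%classic t -> ft ((c : lcc X) t) = f ((c : lcc X) t)}}.
Proof.
move=> tP; apply: filterS (test_plan_null_ae hd tP mN N0) => c cN.
exists (`[0%R, 1%R]%classic `&` [set t | N ((c : lcc X) t)]); split => //.
  have := measurable_lcc hd c measurableT mN; rewrite setTI => mcN.
  by apply: measurableI => //; exact: measurable_itv.
by move=> t /= /not_implyP[t01 h]; split => //; apply: contrapT => /ftE.
Qed.

(** The common core of both directions of the chain rule. Weak subslopes are Borel by definition, so
    the weight is evaluated at [ft]; along almost every curve this agrees with [f] at almost every
    time. *)
Lemma weak_subslope_mul (f1 f2 G : X -> \bar R) (w : \bar R -> \bar R) :
    causal_function f1 -> causal_function f2 -> weak_subslope d f1 G ->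
    measurable_fun setT w -> (forall x, 0 <= w x) ->
    (forall (c : lcc X) (v : R -> \bar R), measurable_fun setT v ->
      (forall t, 0 <= v t) -> increments_dominate v (fun t => f1 (c t)) ->
      \int[lambda]_(t in `[0%R, 1%R]) (w (f (c t)) * v t) <=
      subx (f2 (c 1%R)) (f2 (c 0%R))) ->
  weak_subslope d f2 (fun x => w (ft x) * G x).
Proof.
move=> hf1 hf2 hG mw w0 H.
have [mG G0] := hG.1.
have mwf : measurable_fun [set: borel X] (fun x : borel X => w (ft x)).
  exact: (measurableT_comp mw mft).
apply: weak_subslope_of_curves => // [|P tP].
  by split=> [|x]; [exact: emeasurable_funM|exact: mule_ge0].
apply: filterS2 (weak_subslope_along_curves hd tP hf1 hG)
  (modification_along_curves tP) => c Hc cft.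
have [mv v0] := causal_speed_measurable (c : lcc X).
have mGc : measurable_fun [set: R] (fun r => G ((c : lcc X) r)).
  exact: (measurableT_comp mG (measurable_lcc hd c)).
have mwfc : measurable_fun [set: R] (fun r => w (ft ((c : lcc X) r))).
  exact: (measurableT_comp mwf (measurable_lcc hd c)).
have mGv : measurable_fun [set: R] (fun r => G ((c : lcc X) r) * causal_speed c r).
  exact: emeasurable_funM.
have mfc : measurable_fun [set: R] (fun r => f ((c : lcc X) r)).
  exact: nondecreasing_emeasurable (causal_function_along c hf).
apply: le_trans (H _ _ mGv _ Hc) => [|t]; last exact: mule_ge0.
apply: (@ae_ge0_le_integral _ (measurableTypeR R) R lambda) => //.
- by move=> r _; rewrite !mule_ge0.
- by apply: measurable_funTS; apply: emeasurable_funM => //; exact: emeasurable_funM.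
- by move=> r _; rewrite !mule_ge0.
- apply: measurable_funTS; apply: emeasurable_funM => //.
  exact: (measurableT_comp mw mfc).
by apply: filterS cft => t cft t01; rewrite cft// muleA.
Qed.

Variables (phi : R -> R) (g : R -> \bar R).
Hypotheses (phi_nd : {homo phi : s t / (s <= t)%R}) (phi_g : is_ac_derivative phi g).

Lemma causal_function_extend : causal_function (extend phi \o f).
Proof.
split=> [B mB|x y xy]; last by apply: le_extend => //; exact: hf.2.
have := measurable_extend phi_nd measurableT mB; rewrite setTI => mB'.
by have := hf.1 _ mB'.
Qed.

Lemma weak_subslope_extend (G : X -> \bar R) : weak_subslope d f G ->
  weak_subslope d (extend phi \o f) (fun x => extend_derivative g (ft x) * G x).
Proof.
have [mg g0 _] := phi_g.
move=> hG; apply: (weak_subslope_mul hf causal_function_extend hG).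
- exact: measurable_extend_derivative.
- exact: extend_derivative_ge0.
- move=> c v mv v0 Hv.
  exact: (chain_rule_ge phi_nd phi_g (causal_function_along c hf) mv v0 Hv).
Qed.

Lemma weak_subslope_unextend (G : X -> \bar R) : weak_subslope d (extend phi \o f) G ->
  weak_subslope d f (fun x => inverse_derivative g (ft x) * G x).
Proof.
have [mg g0 _] := phi_g.
move=> hG; apply: (weak_subslope_mul causal_function_extend hf hG).
- exact: measurable_inverse_derivative.
- exact: inverse_derivative_ge0.
- move=> c v mv v0 Hv.
  exact: (chain_rule_le phi_nd phi_g (causal_function_along c hf) mv v0 Hv).
Qed.

Variables (G : X -> \bar R) (hG : weak_subslope d (extend phi \o f) G).

Let A : set X := [set x | extend_derivative g (ft x) = 0 /\ 0 < G x].

Lemma measurable_derivative0 : measurable (A : set (borel X)).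
Proof.
have [[mg _ _] [mG _]] := (phi_g, hG.1).
apply: measurableI.
  have := measurableT_comp (measurable_extend_derivative mg) mft.
  by move=> /(_ measurableT [set 0] (emeasurable_set1 _)); rewrite setTI.
by rewrite -[X in measurable X]setTI; exact: emeasurable_fun_o_infty.
Qed.

(** Along almost every curve [G] times the speed vanishes at almost every time where the derivative
    is 0; as [G > 0] on [A], the speed itself vanishes while the curve is in [A]. *)
Lemma plan_integral_derivative0 (P : probability (borel_lcc d) R) : test_plan P ->
  plan_integral P (fun x => (\1_A x)%:E) = 0.
Proof.
move=> tP; have [[mg _ _] [mG G0]] := (phi_g, hG.1).
have ge0 c r : 0 <= (\1_A ((c : lcc X) r))%:E * causal_speed c r.
  by rewrite mule_ge0 ?lee_fin//; have [] := causal_speed_measurable c.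
apply/eqP; rewrite eq_le; apply/andP; split; last first.
  apply: le_ereal_inf_tmp => _ [h [_ Fh] <-]; apply: integral_ge0 => c _.
  by apply: le_trans (Fh c); exact: integral_ge0.
rewrite -(integral0 P setT); apply: upper_integral_ae_le => //.
apply: filterS2 (weak_subslope_along_curves hd tP causal_function_extend hG)
  (modification_along_curves tP) => c Hc cft.
have [mv v0] := causal_speed_measurable (c : lcc X).
have mGc : measurable_fun [set: R] (fun r => G ((c : lcc X) r)).
  exact: (measurableT_comp mG (measurable_lcc hd c)).
have mGv : measurable_fun [set: R] (fun r => G ((c : lcc X) r) * causal_speed c r).
  exact: emeasurable_funM.
have Gv0 r : 0 <= G ((c : lcc X) r) * causal_speed c r by exact: mule_ge0.
have mfc : measurable_fun [set: R] (fun r => f ((c : lcc X) r)).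
  exact: nondecreasing_emeasurable (causal_function_along c hf).
pose S : set (measurableTypeR R) :=
  `[0%R, 1%R]%classic `&` [set t | extend_derivative g (f ((c : lcc X) t)) = 0].
have mS : measurable S.
  apply: measurableI; first exact: measurable_itv.
  have := measurableT_comp (measurable_extend_derivative mg) mfc.
  by move=> /(_ measurableT [set 0] (emeasurable_set1 _)); rewrite setTI.
have int0 : \int[lambda]_(t in S) (G ((c : lcc X) t) * causal_speed c t) = 0.
  exact: (chain_rule_derivative0 phi_nd phi_g (causal_function_along c hf) mGv Gv0 Hc).
have : \int[lambda]_(t in S) `|G ((c : lcc X) t) * causal_speed c t| = 0.
  by rewrite -[RHS]int0; apply: eq_integral => t _; rewrite gee0_abs.
move=> /(@ae_eq_integral_abs _ (measurableTypeR R) R lambda _ mS _ (measurable_funTS mGv)).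
move=> Gv_ae; have mAc : measurable_fun [set: R] (fun r => (\1_A ((c : lcc X) r))%:E : \bar R).
  have mi : measurable_fun [set: borel X] (\1_A : borel X -> R).
    by apply: measurable_indic; exact: measurable_derivative0.
  by apply/measurable_EFinP; exact: (measurableT_comp mi (measurable_lcc hd c)).
suff -> : \int[lambda]_(t in `[0%R, 1%R]) ((\1_A ((c : lcc X) t))%:E * causal_speed c t)
  = \int[lambda]_(t in `[0%R, 1%R]) 0 by rewrite integral0.
apply: (@ge0_ae_eq_integral _ (measurableTypeR R) R lambda) => //.
  by apply: measurable_funTS; exact: emeasurable_funM.
apply: filterS2 cft Gv_ae => t cft Gv_ae t01; rewrite indicE.
case: (boolP (_ \in A)) => /= [/set_mem[]|_]; last by rewrite mul0e.
rewrite cft// => gt0 G_gt0; have /eqP := Gv_ae (conj t01 gt0).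
rewrite mule_eq0 gt_eqF//= => /eqP ->; exact: mule0.
Qed.

(** Every plan density vanishes almost everywhere on [A], so [V] without [A] still covers all plans,
    and minimality of [V] applies. *)
Lemma derivative0_invisible (V : set X) : is_vis d V -> {ae vol X, forall x, V x -> ~ A x}.
Proof.
have mA := measurable_derivative0.
move=> [mV covV minV]; have : {ae vol X, forall x : X, V x -> (V `\` A) x}.
  apply: minV => [|P rho tP rhoP]; first exact: measurableD.
  have [[mrho rho0] rhoE] := rhoP.
  have : \int[vol X]_(x in A) `|rho x| = 0.
    rewrite -(plan_integral_derivative0 tP) -rhoE//.
    by apply: eq_integral => x _; rewrite gee0_abs.
  move=> /(ae_eq_integral_abs _ mA (measurable_funTS mrho)) rhoA.
  apply: filterS2 (covV _ _ tP rhoP) rhoA => x Vx Ax rhox; split; first exact: Vx.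
  by move=> /Ax rhox0; move: rhox; rewrite rhox0 ltxx.
by apply: filterS => x Vx /Vx[].
Qed.

End modified_function.

End curvewise_criteria.

Theorem proposition3p23 (R : realType) (X : mmSpacetime R)
    (d : X -> X -> R) (hd : bounded_distance d)
    (f : X -> \bar R) (hf : causal_function f)
    (phi : R -> R) (hphi : {homo phi : s t / s <= t}) :
  causal_function (extend phi \o f) /\
  forall dphi : R -> \bar R, is_ac_derivative phi dphi ->
  forall slope_f slope_phif : X -> \bar R,
    is_slope d f slope_f -> is_slope d (extend phi \o f) slope_phif ->
  forall Vis : set X, is_vis d Vis ->
  {ae vol X, forall x : X, Vis x ->
    (0 < slope_f x)%E \/ (extend_derivative dphi (f x) < +oo)%E ->
    slope_phif x = (extend_derivative dphi (f x) * slope_f x)%E}.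
Proof.
split=> [|dphi dphiP slope_f slope_phif [subf maxf] [subphif maxphif] Vis VisP].
  exact: causal_function_extend.
have [N [mN N0 mft]] := ae_measurable_modification hf.1.
pose ft (x : X) := if x \in N then 0%E else f x.
have {}mft : measurable_fun [set: borel X] (ft : borel X -> \bar R) := mft 0%E.
have ftE x : ~ N x -> ft x = f x by move=> Nx; rewrite /ft memNset.
have N_ae : {ae vol X, forall x : X, ft x = f x}.
  by exists N; split => // x /=; apply: contra_notP => /ftE.
have le1 := maxphif _ (weak_subslope_extend hd hf mN N0 mft ftE hphi dphiP subf).
have le2 := maxf _ (weak_subslope_unextend hd hf mN N0 mft ftE hphi dphiP subphif).
have vis0 := derivative0_invisible hd hf mN N0 mft ftE hphi dphiP subphif VisP.
have [_ g0 _] := dphiP.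
have : {ae vol X, forall x : X, [/\ ft x = f x,
    (extend_derivative dphi (ft x) * slope_f x <= slope_phif x)%E &
    (inverse_derivative dphi (ft x) * slope_phif x <= slope_f x)%E]}.
  by apply: filterS3 N_ae le1 le2 => x.
apply: filterS2 vis0 => x + [fE + +] Vx; move=> /(_ Vx); rewrite /= fE.
rewrite /inverse_derivative; move: (extend_derivative_ge0 g0 (f x)).
have := subphif.1.2 x; have := subf.1.2 x.
case: (extend_derivative dphi (f x)) => [r| |] //=; last first.
  (* Infinite derivative: the hypothesis leaves only [slope_f x > 0], and the product [+oo] is
     already a lower bound for [slope_phif x]. *)
  move=> a0 b0 _ _ + _ [a_gt0|]; last by rewrite ltxx.
  by rewrite gt0_mulye// leye_eq => /eqP.
move=> a0 b0; rewrite lee_fin le_eqVlt => /predU1P[<-|r0] Ax ra_le b_le _.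
  (* Zero derivative: the inverse weight is 0 and says nothing, so invisibility of [A] is what
     forces [slope_phif x] to vanish. *)
  rewrite mul0e; apply/eqP; rewrite eq_le b0 andbT leNgt.
  by apply/negP => b_gt0; exact: Ax.
(* Positive finite derivative: the two subslope bounds are inverse to each other. *)
apply/eqP; rewrite eq_le ra_le andbT.
by move: b_le; rewrite muleC lee_pdivrMr// muleC.
Qed.
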